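(* There exists a universal constant $C>0$ (independent of $\varepsilon$) such that for all $\varepsilon>0$, each choice of the sign $\pm$ and all $g\in\dot H^1(\mathbb{R}^3)$, $$\left\Vert e^{\pm i\frac{t}{\varepsilon}\frac{D_3}{|D|}}g\right\Vert_{L^6_xL^3_t}\le C\,\varepsilon^{\frac13}\,\Vert g\Vert_{\dot H^1}.$$
   Context: The operator $e^{\pm i\frac{t}{\varepsilon}\frac{D_3}{|D|}}$ is defined by $$e^{\pm i\frac t\varepsilon\frac{D_3}{|D|}}g:(t,x)\longmapsto\int_{\mathbb{R}^3}e^{ix\cdot\xi\pm i\frac t\varepsilon\frac{\xi_3}{|\xi|}}\hat g(\xi)\,d\xi,\qquad \xi=(\xi_1,\xi_2,\xi_3),$$ (understood as an inverse Fourier transform, by density, when the integral is not absolutely convergent), with $\hat g(\xi)=\int_{\mathbb{R}^3}e^{-ix\cdot\xi}g(x)\,dx$. The mixed norm is $\Vert u\Vert_{L^6_xL^3_t}=\left(\int_{\mathbb{R}^3}\left(\int_{\mathbb{R}}|u(t,x)|^3dt\right)^{2}dx\right)^{1/6}$ (inner norm in time over all of $\mathbb{R}$, outer norm in space), and $\Vert g\Vert_{\dot H^1}=\left(\int_{\mathbb{R}^3}|\hat g(\xi)|^2|\xi|^{2}d\xi\right)^{1/2}$. *)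

(* Defs.v *)
From HB Require Import structures.
From mathcomp Require Import all_boot all_order all_algebra.
From mathcomp Require Import all_classical all_reals all_analysis.
From mathcomp Require Import complex.

Set Implicit Arguments.
Unset Strict Implicit.
Unset Printing Implicit Defensive.

Import Order.TTheory GRing.Theory Num.Theory.
Import numFieldNormedType.Exports.
Import Normc.

Local Open Scope classical_set_scope.
Local Open Scope ring_scope.

(* A point (x1, x2, x3) of three-dimensional space is ((x1, x2), x3), so that
   Lebesgue measure on it is an iterated product measure. *)
Notation euclid3 R := (R * R * R)%type.
Notation leb1 R := (@lebesgue_measure R).
Notation leb3 R := ((leb1 R \x leb1 R) \x leb1 R)%E.

Section Definitions.
Variable R : realType.
Local Notation R3 := (euclid3 R).
Local Notation C := (complex R).

Definition dot (x y : R3) : R :=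
  x.1.1 * y.1.1 + x.1.2 * y.1.2 + x.2 * y.2.

(* The Euclidean norm; the library norm of the product type is the sup norm. *)
Definition enorm (x : R3) : R := Num.sqrt (dot x x).

Definition expi (a : R) : C := Complex (cos a) (sin a).

Definition cintegrable (f : R3 -> C) : Prop :=
  (leb3 R).-integrable setT (EFin \o (fun x => complex.Re (f x))) /\
  (leb3 R).-integrable setT (EFin \o (fun x => complex.Im (f x))).

Definition cintegral (f : R3 -> C) : C :=
  Complex (\int[leb3 R]_x complex.Re (f x)) (\int[leb3 R]_x complex.Im (f x)).

Definition basis (i : 'I_3) : R3 :=
  ((i == 0 :> nat)%:R, (i == 1 :> nat)%:R, (i == 2 :> nat)%:R).

Definition partial (s : seq 'I_3) (f : R3 -> R) : R3 -> R :=
  foldr (fun i h x => 'D_(basis i) h x) f s.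

Definition smooth (f : R3 -> R) : Prop :=
  forall s x, differentiable (partial s f) x.

(* M bounds the N-th Schwartz seminorm of f. *)
Definition seminorm_le (N : nat) (M : R) (f : R3 -> R) : Prop :=
  forall s x, (size s <= N)%N -> (1 + enorm x) ^+ N * `|partial s f x| <= M.

Definition cseminorm_le (N : nat) (M : R) (phi : R3 -> C) : Prop :=
  seminorm_le N M (fun x => complex.Re (phi x)) /\
  seminorm_le N M (fun x => complex.Im (phi x)).

Definition schwartz (phi : R3 -> C) : Prop :=
  [/\ smooth (fun x => complex.Re (phi x)),
      smooth (fun x => complex.Im (phi x)) &
      forall N, exists M, cseminorm_le N M phi].

(* Only the values of T on Schwartz functions matter. *)
Definition tempered (T : (R3 -> C) -> C) : Prop :=
  (forall (a : C) (phi psi : R3 -> C), schwartz phi -> schwartz psi ->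
     T (fun x => a * phi x + psi x) = a * T phi + T psi) /\
  (exists (N : nat) (K : R), forall (phi : R3 -> C) (M : R), schwartz phi ->
     cseminorm_le N M phi -> normc (T phi) <= K * M).

Definition fourier (phi : R3 -> C) (xi : R3) : C :=
  cintegral (fun x => expi (- dot x xi) * phi x).

(* No factor (2 pi)^-3. *)
Definition inv_fourier (phi : R3 -> C) (x : R3) : C :=
  cintegral (fun xi => expi (dot x xi) * phi xi).

(* The Fourier transform of the tempered distribution g, defined by
   duality as phi |-> g (fourier phi), is the function G. *)
Definition is_fourier (g : (R3 -> C) -> C) (G : R3 -> C) : Prop :=
  forall phi, schwartz phi ->
    cintegrable (fun xi => G xi * phi xi) /\
    g (fourier phi) = cintegral (fun xi => G xi * phi xi).

(* The inverse Fourier transform of the function G, again by duality, is the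
   function v; when G is integrable this is v x = inv_fourier G x for almost
   every x. *)
Definition is_inv_fourier (G v : R3 -> C) : Prop :=
  forall phi, schwartz phi ->
    [/\ cintegrable (fun x => v x * phi x),
        cintegrable (fun xi => G xi * inv_fourier phi xi) &
        cintegral (fun x => v x * phi x) =
        cintegral (fun xi => G xi * inv_fourier phi xi)].

(* Unique up to a null set whenever such a function exists. *)
Definition hat (g : (R3 -> C) -> C) : R3 -> C :=
  xget (fun=> 0) [set G | is_fourier g G].

Definition Hdot1_norm (g : (R3 -> C) -> C) : \bar R :=
  ((\int[leb3 R]_xi (normc (hat g xi) ^+ 2 * enorm xi ^+ 2)%:E) `^ 2^-1)%E.

Definition Hdot1 (g : (R3 -> C) -> C) : Prop :=
  [/\ tempered g, exists G, is_fourier g G & (Hdot1_norm g < +oo)%E].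

(* The exponent carries the sign - when minus is true and + otherwise. *)
Definition multiplier (minus : bool) (eps t : R) (xi : R3) : C :=
  expi ((-1) ^+ minus * (t / eps) * (xi.2 / enorm xi)).

(* The product sigma-algebra underlying the measure leb1 R \x leb3 R. *)
Local Notation RxR3 := (measurableTypeR R * euclid3 (measurableTypeR R))%type.

(* u is a jointly measurable representative of the propagator applied to g.
   Any two of them agree almost everywhere on R x R^3. *)
Definition is_propagation (minus : bool) (eps : R) (g : (R3 -> C) -> C)
    (u : R -> R3 -> C) : Prop :=
  [/\ measurable_fun setT (fun p : RxR3 => complex.Re (u p.1 p.2)),
      measurable_fun setT (fun p : RxR3 => complex.Im (u p.1 p.2)) &
      {ae leb1 R, forall t,
        is_inv_fourier (fun xi => multiplier minus eps t xi * hat g xi) (u t)}].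

Definition L6x_L3t_norm (u : R -> R3 -> C) : \bar R :=
  ((\int[leb3 R]_x (\int[leb1 R]_t (normc (u t x) ^+ 3)%:E) ^+ 2) `^ 6^-1)%E.

End Definitions.

(* Main.v *)
(** In the coordinates xi = (h, a |h|), with h in R^2 and a real, the time
    frequency xi_3 / |xi| is the function slope a = a / sqrt (1 + a^2) of a
    alone, so that the propagator is the oscillatory integral in a of
    V_x(a) = \int e^{i x . (h, a |h|)} f_a(h) dh, where f_a(h) = w(h, a |h|) |h|.

    For fixed x, Plancherel in t bounds in L^2_t the contribution of the set
    where lev a = |a|^(1/3) / sqrt (1 + a^2) exceeds a threshold, and that of
    the rest is bounded pointwise in t; integrating over the level sets of the
    propagator with a threshold proportional to the level gives
      \int |u(t,x)|^3 dt <= C eps (\int |a|^(1/3) (1 + a^2) |V_x(a)|^2 da)^(3/2).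
    Minkowski's inequality in L^3_x then moves the a-integral outside, and each
    slice is the endpoint Strichartz inequality of the cone in R^3,
      \int |V_x(a)|^6 dx <= C / |a| (\int |f_a(h)|^2 |h| dh)^3,
    which is a TT^* bound for the tensor cube of V_x(a): it only needs that the
    triple convolution of dh / |h| on the cone is a bounded function.
    Integrating in a gives back the square of the homogeneous H^1 norm.

    This treats integrable amplitudes.  In general the propagator is the limit
    along the dyadic truncations |xi| <= 2^j, which converge almost everywhere
    because their increments are summable in a weighted L^1, and it is unique
    since it is determined by its integrals against polynomials in the
    coordinates and sigmoids times a Gaussian.                                 *)

(* The Plancherel bounds in time, in space and on the cone are one Schur test. The square of an
   oscillatory integral is integrated against the damping [expR (- d * |x|)], whose cosine
   transform, 2 pi times the Poisson kernel, is explicit, nonnegative and of mass 2 pi for every d.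
   The row sums are therefore bounded uniformly in d, and d tends to 0 by Fatou's lemma. Cosines and
   sines keep every quantity real; the complex modulus is assembled at the end from four real
   amplitudes.

   The weight is dictated by two requirements. The square of the cone estimate costs |a|^(-1/3) in
   L^3_x, which |a|^(1/3) cancels, while 1 + a^2 = |xi|^2 / |h|^2 produces the H^1 norm. And since
   lev a is of order |a|^(1/3) near 0 and |a|^(-2/3) near infinity, the reciprocal weight has mass
   O(s^2) on the set where lev a < s, at both ends. Cauchy-Schwarz then bounds the low part by a
   multiple of the threshold s, so a threshold proportional to the level makes it at most half of
   the level, without a logarithmic loss. *)
From HB Require Import structures.
From mathcomp Require Import all_boot all_order all_algebra.
From mathcomp Require Import all_classical all_reals all_analysis.
From mathcomp Require Import measurable_realfun complex.
From mathcomp Require Import ring lra zify.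
Require Import Defs.
Set Implicit Arguments.
Unset Strict Implicit.
Unset Printing Implicit Defensive.
Import Order.TTheory GRing.Theory Num.Theory.
Import numFieldNormedType.Exports.
Local Open Scope classical_set_scope.
Local Open Scope ring_scope.

(** * Measurability and integration *)
Section le_integral_nonmeasurable.
Context d (T : measurableType d) (R : realType).
Variable m : {measure set T -> \bar R}.

(* The integral of a nonnegative function is a supremum over simple minorants, which makes it monotone on all functions. *)
Lemma ge0_le_integral_mono (f g : T -> \bar R) : (forall x, 0 <= f x)%E ->
  (forall x, f x <= g x)%E -> (\int[m]_x f x <= \int[m]_x g x)%E.
Proof.
move=> f0 fg; have g0 x : (0 <= g x)%E by exact: le_trans (fg x).
rewrite !ge0_integralTE//; apply: ereal_sup_le => _ [h hf <-].
by exists h => // x; exact: le_trans (fg x).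
Qed.

Lemma ge0_intZl (k : \bar R) (f : T -> \bar R) : measurable_fun setT f ->
  (forall x, 0 <= f x)%E -> (0 <= k)%E -> (\int[m]_x (k * f x) = k * \int[m]_x f x)%E.
Proof. by move=> mf f0 k0; rewrite ge0_integralZl. Qed.

End le_integral_nonmeasurable.

Section measurable_tools.
Context d (T : measurableType d) (R : realType).

Lemma measurable_funV (f : T -> R) : measurable_fun setT f ->
  measurable_fun setT (fun x => (f x)^-1).
Proof.
move=> mf; have minv : measurable_fun setT (@GRing.inv R).
  (* The inverse is discontinuous at 0, where it takes the value 0; on each half-line it is a
     composition of [expR] and [ln]. *)
  have -> : (@GRing.inv R) = (fun x : R => if x == 0 then 0 else if 0 < x then expR (- ln x) else - expR (- ln (- x))).
    apply/funext => x; case: eqVneq => [->|x0]; first by rewrite invr0.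
    case: ltP => xp; first by rewrite expRN lnK.
    have xn : 0 < - x by rewrite oppr_gt0 lt_neqAle x0 xp.
    by rewrite expRN lnK ?posrE// invrN opprK.
  apply: measurable_fun_ifT => //; first exact: measurable_fun_eqr.
  apply: measurable_fun_ifT => //; first exact: measurable_fun_ltr.
    by apply: measurableT_comp => //; apply: measurableT_comp.
  by apply: measurableT_comp => //; apply: measurableT_comp => //; apply: measurableT_comp => //; apply: measurableT_comp.
exact: (measurableT_comp minv mf).
Qed.

Lemma measurable_fun_cos (f : T -> R) : measurable_fun setT f ->
  measurable_fun setT (fun x => cos (f x)).
Proof.
move=> mf; apply: (measurableT_comp _ mf).
by apply: continuous_measurable_fun; exact: continuous_cos.
Qed.

Lemma measurable_fun_sin (f : T -> R) : measurable_fun setT f ->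
  measurable_fun setT (fun x => sin (f x)).
Proof.
move=> mf; apply: (measurableT_comp _ mf).
by apply: continuous_measurable_fun; exact: continuous_sin.
Qed.

Lemma measurable_fun_sqrt (f : T -> R) : measurable_fun setT f ->
  measurable_fun setT (fun x => Num.sqrt (f x)).
Proof.
move=> mf; apply: (measurableT_comp _ mf).
by apply: continuous_measurable_fun; exact: sqrt_continuous.
Qed.

Lemma measurable_fun_expR (f : T -> R) : measurable_fun setT f ->
  measurable_fun setT (fun x => expR (f x)).
Proof. by move=> mf; apply: measurableT_comp. Qed.

Lemma measurable_fun_normr (f : T -> R) : measurable_fun setT f ->
  measurable_fun setT (fun x => `|f x|).
Proof. by move=> mf; apply: measurableT_comp. Qed.

Lemma measurable_fun_powR (p : R) (f : T -> R) : measurable_fun setT f ->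
  measurable_fun setT (fun x => f x `^ p).
Proof. by move=> mf; apply: (measurableT_comp (measurable_powR p)). Qed.

Lemma measurable_fun_EFin (f : T -> R) : measurable_fun setT f ->
  measurable_fun setT (fun x => (f x)%:E).
Proof. by move=> mf; apply: measurableT_comp. Qed.

Lemma measurable_fun_N (f : T -> R) : measurable_fun setT f ->
  measurable_fun setT (fun x => - f x).
Proof. by move=> mf; apply: measurableT_comp. Qed.

Lemma measurable_fun_nat (f : T -> bool) : measurable_fun setT f ->
  measurable_fun setT (fun x => (f x)%:R : R).
Proof.
move=> mf; have -> : (fun x => (f x)%:R : R) = (fun x => if f x then 1 else 0).
  by apply/funext => x; case: (f x).
exact: measurable_fun_ifT.
Qed.

Lemma measurable_fun_abse (f : T -> \bar R) : measurable_fun setT f ->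
  measurable_fun setT (fun x => `|f x|)%E.
Proof. by move=> mf; apply: measurableT_comp. Qed.

Lemma measurable_fun_expe n (f : T -> \bar R) : measurable_fun setT f ->
  measurable_fun setT (fun x => f x ^+ n)%E.
Proof.
move=> mf; elim: n => [|n ih]; first exact: measurable_cst.
have -> : (fun x => f x ^+ n.+1)%E = (fun x => f x * f x ^+ n)%E by apply/funext => x; rewrite expeS.
exact: emeasurable_funM.
Qed.

End measurable_tools.

Section measurable_integral.
Context d (T : measurableType d) (R : realType).

(** The positive and negative parts are measurable by Tonelli, and their difference remains
    measurable where it reads [+oo - +oo]. Through [fine], the real-valued integral below inherits
    this, with the default value 0 where the integral is infinite. *)
Lemma measurable_fun_integral d2 (T2 : measurableType d2)
    (m2 : {sigma_finite_measure set T2 -> \bar R}) (f : T -> T2 -> \bar R) :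
  measurable_fun setT (fun p : T * T2 => f p.1 p.2) ->
  measurable_fun setT (fun x => \int[m2]_y f x y)%E.
Proof.
move=> mf.
have -> : (fun x => \int[m2]_y f x y)%E =
    (fun x => \int[m2]_y (fun p => f p.1 p.2)^\+ (x, y) -
     \int[m2]_y (fun p => f p.1 p.2)^\- (x, y))%E.
  apply/funext => x. rewrite [LHS]integralE.
  by congr (_ - _)%E; apply: eq_integral => y _; rewrite ?funeposE ?funenegE.
apply: emeasurable_funB.
  exact: (measurable_fun_fubini_tonelli_F (m2 := m2) _ (measurable_funepos mf)).
exact: (measurable_fun_fubini_tonelli_F (m2 := m2) _ (measurable_funeneg mf)).
Qed.

Lemma measurable_fun_Rintegral d2 (T2 : measurableType d2)
    (m2 : {sigma_finite_measure set T2 -> \bar R}) (f : T -> T2 -> R) :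
  measurable_fun setT (fun p : T * T2 => f p.1 p.2) ->
  measurable_fun setT (fun x => \int[m2]_y f x y)%R.
Proof.
move=> mf; apply: (measurableT_comp (@fine_measurable R setT measurableT)).
by apply: (@measurable_fun_integral _ _ m2 (fun x y => (f x y)%:E)); apply: measurable_fun_EFin.
Qed.

End measurable_integral.

Lemma ge0_integral_swap d1 d2 (T1 : measurableType d1) (T2 : measurableType d2) (R : realType)
    (m1 : {sigma_finite_measure set T1 -> \bar R}) (m2 : {sigma_finite_measure set T2 -> \bar R})
    (f : T1 -> T2 -> \bar R) :
  measurable_fun setT (fun p : T1 * T2 => f p.1 p.2) -> (forall x y, 0 <= f x y)%E ->
  (\int[m1]_x \int[m2]_y f x y = \int[m2]_y \int[m1]_x f x y)%E.
Proof. by move=> mf f0; exact: (fubini_tonelli (fun p => f p.1 p.2)). Qed.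

Lemma measurable_fun_fstc d d1 d2 (T : measurableType d) (T1 : measurableType d1)
  (T2 : measurableType d2) (f : T -> T1 * T2) : measurable_fun setT f ->
  measurable_fun setT (fun x => (f x).1).
Proof. by move=> mf; apply: (measurableT_comp measurable_fst mf). Qed.

Lemma measurable_fun_sndc d d1 d2 (T : measurableType d) (T1 : measurableType d1)
  (T2 : measurableType d2) (f : T -> T1 * T2) : measurable_fun setT f ->
  measurable_fun setT (fun x => (f x).2).
Proof. by move=> mf; apply: (measurableT_comp measurable_snd mf). Qed.

(** Syntax-directed: each clause extracts the inner function by a higher-order pattern. The last two
    clauses use facts from the context, which is why measurability statements are introduced as
    hypotheses just before a call. *)
Ltac mstep := match goal with
 | |- measurable_fun _ (fun x => x) => exact: measurable_id
 | |- measurable_fun _ (fun _ => ?c) => exact: measurable_cst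
 | |- measurable_fun _ (fun x => fst (@?f x)) => apply: (@measurable_fun_fstc _ _ _ _ _ _ f)
 | |- measurable_fun _ (fun x => snd (@?f x)) => apply: (@measurable_fun_sndc _ _ _ _ _ _ f)
 | |- measurable_fun _ (fun x => (@?f x, @?g x)) => apply: (@measurable_fun_pair _ _ _ _ _ _ f g)
 | |- measurable_fun _ (EFin \o ?f) => apply: (@measurable_fun_EFin _ _ _ f)
 | |- measurable_fun _ (fun x => (@?f x)%:E) => apply: (@measurable_fun_EFin _ _ _ f)
 | |- measurable_fun _ (fun x => (@?f x + @?g x)%E) => apply: (@emeasurable_funD _ _ _ _ f g)
 | |- measurable_fun _ (fun x => (@?f x * @?g x)%E) => apply: (@emeasurable_funM _ _ _ _ f g)
 | |- measurable_fun _ (fun x => (`|@?f x|)%E) => apply: (@measurable_fun_abse _ _ _ f)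
 | |- measurable_fun _ (fun x => (@?f x ^+ ?n)%E) => apply: (@measurable_fun_expe _ _ _ n f)
 | |- measurable_fun _ (fun x => @?f x + @?g x) => apply: (@measurable_funD _ _ _ _ f g)
 | |- measurable_fun _ (fun x => @?f x * @?g x) => apply: (@measurable_funM _ _ _ _ f g)
 | |- measurable_fun _ (fun x => - @?f x) => apply: (@measurable_fun_N _ _ _ f)
 | |- measurable_fun _ (fun x => (@?f x)^-1) => apply: (@measurable_funV _ _ _ f)
 | |- measurable_fun _ (fun x => @?f x ^+ ?n) => apply: (@measurable_funX _ _ _ _ f n)
 | |- measurable_fun _ (fun x => `|@?f x|) => apply: (@measurable_fun_normr _ _ _ f)
 | |- measurable_fun _ (fun x => Num.sqrt (@?f x)) => apply: (@measurable_fun_sqrt _ _ _ f)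
 | |- measurable_fun _ (fun x => cos (@?f x)) => apply: (@measurable_fun_cos _ _ _ f)
 | |- measurable_fun _ (fun x => sin (@?f x)) => apply: (@measurable_fun_sin _ _ _ f)
 | |- measurable_fun _ (fun x => expR (@?f x)) => apply: (@measurable_fun_expR _ _ _ f)
 | |- measurable_fun _ (fun x => (@?f x) `^ ?p) => apply: (@measurable_fun_powR _ _ _ p f)
 | |- measurable_fun _ (fun x => GRing.natmul (GRing.one _) (nat_of_bool (@?f x))) => apply: (@measurable_fun_nat _ _ _ f)
 | |- measurable_fun _ (fun x => (@?f x) && (@?g x)) => apply: (@measurable_and _ _ _ f g)
 | |- measurable_fun _ (fun x => @Order.lt ring_display _ (@?f x) (@?g x)) => apply: (@measurable_fun_ltr _ _ _ _ f g)
 | |- measurable_fun _ (fun x => @Order.le ring_display _ (@?f x) (@?g x)) => apply: (@measurable_fun_ler _ _ _ _ f g)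
 | |- measurable_fun _ (fun x => Rintegral ?m setT (@?f x)) => apply: (@measurable_fun_Rintegral _ _ _ _ _ m f)
 | |- measurable_fun _ (fun x => integral ?m setT (@?f x)) => apply: (@measurable_fun_integral _ _ _ _ _ m f)
 | H : measurable_fun _ ?K |- measurable_fun _ (fun x => ?K (@?f x)) => apply: (measurableT_comp H (g := f))
 | H : measurable_fun _ ?K |- measurable_fun _ ?K => exact: H
 end.
Ltac mtac := cbv beta; repeat (mstep; cbv beta).

Section weighted_pushforward.
Context d d' (X : measurableType d) (Y : measurableType d') (R : realType) (m : {measure set X -> \bar R}).
Variables (phi : X -> Y) (w : X -> R).
Hypotheses (mphi : measurable_fun setT phi) (mw : measurable_fun setT w).
Hypothesis w0 : forall x, 0 <= w x.

(* The image under [phi] of the measure of density [w]. *)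
Definition wpush of measurable_fun setT phi & measurable_fun setT w & (forall x, 0 <= w x) :=
  fun A : set Y => (\int[m]_(x in phi @^-1` A) (w x)%:E)%E.

Local Notation nu := (wpush mphi mw w0).

Let nu0 : nu set0 = 0%E.
Proof. by rewrite /wpush preimage_set0 integral_set0. Qed.

Let nu_ge0 A : (0 <= nu A)%E.
Proof. by apply: integral_ge0 => x _; rewrite lee_fin. Qed.

Let nu_sigma : semi_sigma_additive nu.
Proof.
move=> /= F mF tF mUF; rewrite /wpush; apply: cvg_toP.
  apply: ereal_nondecreasing_is_cvgn => i j ij.
  by apply: lee_sum_nneg_natr => // k _ _; apply: integral_ge0 => /= x Fkx; rewrite lee_fin.
rewrite preimage_bigcup ge0_integral_bigcup//=.
- by move=> k; rewrite -[X in measurable X]setTI; exact: (mphi measurableT (mF k)).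
- by apply: measurable_funTS; mtac.
- by move=> x _; rewrite lee_fin.
- by apply/trivIsetP => i j _ _ ij; rewrite -preimage_setI; move/trivIsetP: tF => ->//; rewrite preimage_set0.
Qed.

HB.instance Definition _ := isMeasure.Build _ _ _ nu nu0 nu_ge0 nu_sigma.

End weighted_pushforward.

(** * Substitution and the fundamental theorem of calculus *)
Section substitution.
Context (R : realType).
Notation mu := (@lebesgue_measure R).

(** Layer-cake formula at one point: the integrand is the indicator of ]0, v[, of length [v] even
    when [v] is infinite. *)
Lemma integral_below (v : \bar R) : (0 <= v)%E ->
  (\int[mu]_s ((0 < s) && (s%:E < v)%E)%:R%:E)%E = v.
Proof.
have H (i : interval R) : ((i.1 : \bar R) < i.2)%E -> (\int[mu]_s (s \in i)%:R%:E = (i.2 : \bar R) - i.1)%E.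
  move=> i12; transitivity (\int[mu]_s (\1_[set` i] s)%:E)%E.
    by apply: eq_integral => x _; rewrite indicE mem_setE.
  by rewrite integral_indic//= setIT lebesgue_measure_itv i12.
case: v => [r||//]; rewrite ?lee_fin.
- rewrite le_eqVlt => /orP[/eqP <-|r0].
    rewrite integral0_eq// => x _; rewrite lte_fin.
    by case: ltP => //= x0; case: ltP => // /(lt_trans x0); rewrite ltxx.
  have := H `]0, r[ ; rewrite /= lte_fin => /(_ r0); rewrite sube0 => E; rewrite -[RHS]E.
  by apply: eq_integral => x _; rewrite in_itv/= lte_fin.
- move=> _; have := H `]0, +oo[ ; rewrite /= ltry => /(_ isT); rewrite sube0 => E; rewrite -[RHS]E.
  by apply: eq_integral => x _; rewrite in_itv/= ltry.
Qed.

(** By the layer-cake formula [g] is a superposition of the indicators of its superlevel sets.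
    Tonelli moves the level [s] outside, and for each level the hypothesis on measurable sets is the
    claim. *)
Lemma ge0_integral_wpush d (X : measurableType d) (m : {sigma_finite_measure set X -> \bar R})
    (phi w : X -> R) : measurable_fun setT phi -> measurable_fun setT w -> (forall x, 0 <= w x) ->
  (forall A, measurable A -> \int[m]_(x in phi @^-1` A) (w x)%:E = mu A)%E ->
  forall g : R -> \bar R, measurable_fun setT g -> (forall y, 0 <= g y)%E ->
  (\int[m]_x (g (phi x) * (w x)%:E) = \int[mu]_y g y)%E.
Proof.
move=> mphi mw w0 H g mg g0.
pose J (s : R) (v : \bar R) : \bar R := ((0 < s) && (s%:E < v)%E)%:R%:E.
have J0 s v : (0 <= J s v)%E by rewrite lee_fin.
have mI d' (T : measurableType d') (a : T -> R) (b : T -> \bar R) : measurable_fun setT a -> measurable_fun setT b ->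
    measurable_fun setT (fun x => J (a x) (b x)).
  move=> ma mb; rewrite /J; apply: measurable_fun_EFin; apply: measurable_fun_nat.
  apply: measurable_and; first by mtac.
  by apply: measurable_fun_lte => //; mtac.
transitivity (\int[m]_x \int[mu]_s (J s (g (phi x)) * (w x)%:E))%E.
  apply: eq_integral => x _; rewrite ge0_integralZr//; last 2 first.
  - by apply: mI; mtac.
  - by rewrite lee_fin.
  by rewrite integral_below.
rewrite ge0_integral_swap; last 2 first.
- by mtac; apply: mI; mtac.
- by move=> x s; apply: mule_ge0; rewrite ?lee_fin.
transitivity (\int[mu]_s \int[mu]_y J s (g y))%E.
  apply: eq_integral => s _.
  pose A := [set y | (0 < s) && (s%:E < g y)%E].
  have mA : measurable A.
    rewrite /A; have : measurable_fun setT (fun y => (0 < s) && (s%:E < g y)%E).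
      by apply: measurable_and; [mtac|apply: measurable_fun_lte; mtac].
    by move=> /(_ measurableT [set true] Logic.I); rewrite setTI.
  have IE y : J s (g y) = (\1_A y)%:E by rewrite /J indicE /A; congr (_%:R%:E); rewrite mem_setE.
  under [RHS]eq_integral do rewrite IE.
  rewrite integral_indic//= setIT -H// [RHS]integral_mkcond; apply: eq_integral => x _.
  rewrite patchE IE indicE (_ : (x \in phi @^-1` A) = (phi x \in A)); last by apply/idP/idP; rewrite !inE.
  by case: ifP => _; rewrite ?mul1e ?mul0e.
rewrite ge0_integral_swap//; last by apply: mI; mtac.
by apply: eq_integral => y _; exact: integral_below.
Qed.

End substitution.

Section FTC_nonneg.
Context (R : realType).
Notation mu := (@lebesgue_measure R).

Lemma integral_derive_itv (F f : R -> R) (a b : R) : a <= b ->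
  (forall x, a <= x <= b -> is_derive x 1 F (f x)) ->
  (forall x, a <= x <= b -> {for x, continuous f}) ->
  (\int[mu]_(x in `[a, b]) (f x)%:E = (F b - F a)%:E)%E.
Proof.
rewrite le_eqVlt => /orP[/eqP <-|ab] dF cf.
  by rewrite set_itv1 integral_set1 subrr.
have cF x : a <= x <= b -> {for x, continuous F}.
  by move=> /dF [+ _] => /derivable1_diffP/differentiable_continuous.
rewrite (continuous_FTC2 (F := F))//.
- apply: continuous_in_subspaceT => x; rewrite inE/= in_itv/= => xab; exact: cf.
- split.
  + move=> x; rewrite in_itv/= => /andP[ax xb]; have xab : a <= x <= b by rewrite (ltW ax) (ltW xb).
    by have [] := dF x xab.
  + by apply: cvg_at_right_filter; apply: cF; rewrite lexx ltW.
  + by apply: cvg_at_left_filter; apply: cF; rewrite lexx ltW.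
- move=> x; rewrite in_itv/= => /andP[ax xb]; rewrite derive1E.
have xab : a <= x <= b by rewrite (ltW ax) (ltW xb).
  by have [_ ->] := dF x xab.
Qed.

(* [D] is an interval exhausted by the compact intervals [a n, b n]. *)
Lemma ge0_integral_derive_le (D : R -> bool) (a b : R^nat) (F f : R -> R) (l u : R) :
  nonincreasing_seq a -> nondecreasing_seq b -> (forall n, a n <= b n) ->
  (forall n x, a n <= x <= b n -> D x) -> (forall x, D x -> exists n, a n <= x <= b n) ->
  (forall x, D x -> is_derive x 1 F (f x)) ->
  (forall x, D x -> {for x, continuous f}) ->
  (forall x, D x -> 0 <= f x) ->
  (forall x, D x -> l <= F x <= u) ->
  (\int[mu]_(x in [set x | D x]) (f x)%:E <= (u - l)%:E)%E.
Proof.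
move=> na nb ab abD Dab dF cf f0 Fb.
pose E n := `[a n, b n]%classic.
have -> : [set x | D x] = \bigcup_n E n.
  apply/seteqP; split => [x /Dab [n xn]|x [n _]]; first by exists n => //=; rewrite in_itv.
  by rewrite /E/= in_itv/= => /abD.
have ndE : {homo E : n m / (n <= m)%N >-> (n <= m)%O}.
  move=> n k nk; apply/subsetPset => x; rewrite /E/= !in_itv/= => /andP[ax xb].
  by rewrite (le_trans (na _ _ nk) ax) (le_trans xb (nb _ _ nk)).
have mE n : measurable (E n) by exact: measurable_itv.
have mf n : measurable_fun (E n) (EFin \o f).
  apply/measurable_EFinP; apply: subspace_continuous_measurable_fun => //.
  by apply: continuous_in_subspaceT => x; rewrite inE /E/= in_itv/= => xab; apply: cf; exact: abD xab.
have f0E n x : E n x -> (0 <= (EFin \o f) x)%E.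
  by rewrite /E/= in_itv/= lee_fin => xab; apply: f0; exact: abD xab.
have /cvg_lim <-// := ge0_nondecreasing_set_cvg_integral (mu := @lebesgue_measure R) ndE mE mf f0E.
apply: lime_le.
  apply: ereal_nondecreasing_is_cvgn => n k nk; apply: ge0_subset_integral => //=.
  - exact: mE.
  - exact: mE.
  - exact: mf.
  - exact: f0E.
  - exact/subsetPset/ndE.
apply: nearW => n.
have -> : (\int[mu]_(x in E n) (EFin \o f) x = (F (b n) - F (a n))%:E)%E.
  by apply: integral_derive_itv => // x xab; [apply: dF|apply: cf]; exact: abD xab.
have Dan : D (a n) by apply: (abD n); rewrite lexx ab.
have Dbn : D (b n) by apply: (abD n); rewrite lexx ab.
by rewrite lee_fin; apply: lerB; [have /andP[] := Fb _ Dbn|have /andP[] := Fb _ Dan].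
Qed.

(** Only the range of [F] enters: a bound on it stands in for the limits at [c] and [d], where [f]
    may blow up. This covers the arcsine and inverse square root densities below. *)
Lemma ge0_integral_derive_oo_le (c d : R) (F f : R -> R) (l u : R) :
  (forall x, c < x < d -> is_derive x 1 F (f x)) ->
  (forall x, c < x < d -> {for x, continuous f}) ->
  (forall x, c < x < d -> 0 <= f x) ->
  (forall x, c < x < d -> l <= F x <= u) -> l <= u ->
  (\int[mu]_(x in [set x : R | (c < x < d)%R]) (f x)%:E <= (u - l)%:E)%E.
Proof.
move=> dF cf f0 Fb lu; have [cd|dc] := ltP c d; last first.
  rewrite (_ : [set x | _] = set0) ?integral_set0 ?lee_fin ?subr_ge0//.
  by rewrite -subset0 => x /=; move=> /andP[cx xd]; have := lt_trans cx xd; rewrite ltNge dc.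
(* Each margin is at most half of the length, so that the compact intervals are nonempty. *)
pose e n : R := (d - c) / n.+2%:R.
have e0 n : 0 < e n by rewrite divr_gt0 ?subr_gt0.
have ne n k : (n <= k)%N -> e k <= e n.
  by move=> nk; rewrite ler_pM2l ?subr_gt0// lef_pV2 ?posrE// ler_nat.
have e2 n : e n <= (d - c) / 2 by rewrite ler_pM2l ?subr_gt0// lef_pV2 ?posrE// ler_nat.
apply: (@ge0_integral_derive_le (fun x => c < x < d) (fun n => c + e n) (fun n => d - e n)) => //.
- by move=> n k nk; rewrite lerD2l ne.
- by move=> n k nk; rewrite lerD2l lerN2 ne.
- by move=> n; have := e2 n; lra.
- by move=> n x /andP[cx xd]; have := e0 n; lra.
- move=> x /andP[cx xd].
  pose y := Num.min (x - c) (d - x).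
  have y0 : 0 < y by rewrite lt_min !subr_gt0 cx xd.
  have [n yn] : exists n : nat, (d - c) / y < n%:R by exists (Num.bound ((d - c)/ y)); apply: archi_boundP; rewrite divr_ge0 ?subr_ge0 ?(ltW cd) ?(ltW y0).
  exists n; have : e n < y.
    rewrite ltr_pdivrMr// mulrC -ltr_pdivrMr//; apply: (lt_le_trans yn); by rewrite ler_nat; lia.
  by rewrite lt_min; lra.
Qed.

Lemma ge0_integral_derive_T_le (F f : R -> R) (l u : R) :
  (forall x : R, is_derive x 1 F (f x)) -> continuous f ->
  (forall x, 0 <= f x) -> (forall x, l <= F x <= u) ->
  (\int[mu]_x (f x)%:E <= (u - l)%:E)%E.
Proof.
move=> dF cf f0 Fb.
rewrite (_ : setT = [set x : R | true])//; last by apply/seteqP.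
apply: (@ge0_integral_derive_le (fun x => true) (fun n => - n%:R) (fun n => n%:R) F) => //.
- by move=> n k nk; rewrite lerN2 ler_nat.
- by move=> n k nk; rewrite ler_nat.
- by move=> n; have : 0 <= n%:R :> R by []; lra.
- by move=> x _; exists (Num.bound `|x|) => /=; rewrite -ler_norml; apply/ltW/archi_boundP.
- by move=> x _; exact: cf.
Qed.

End FTC_nonneg.

Section change_of_variables.
Context (R : realType).
Notation mu := (@lebesgue_measure R).

(** The image under [F] of the measure of density [f] on [D] gives each interval ]c, d] the mass
    [F (G d) - F (G c) = d - c], by the fundamental theorem of calculus. Lebesgue measure is
    characterized by these values. The right inverse [G] makes [F] map onto the whole line. *)
Lemma ge0_integral_change (D : R -> bool) (F f G : R -> R) (g : R -> \bar R) :
  measurable_fun setT D -> measurable_fun setT F -> measurable_fun setT f ->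
  (forall x, D x -> 0 <= f x) ->
  (forall x y z, D x -> D z -> x <= y <= z -> D y) ->
  (forall y, D (G y)) -> (forall y, F (G y) = y) ->
  {in D &, {homo F : x y / x < y}} ->
  (forall x, D x -> is_derive x 1 F (f x)) ->
  (forall x, D x -> {for x, continuous f}) ->
  measurable_fun setT g -> (forall y, 0 <= g y)%E ->
  (\int[mu]_x (g (F x) * ((D x)%:R * f x)%:E) = \int[mu]_y g y)%E.
Proof.
move=> mD mF mf f0 Dconv DG FG incF dF cf mg g0.
pose w x := (D x)%:R * f x.
have mw : measurable_fun setT w by rewrite /w; mtac.
have w0 x : 0 <= w x by rewrite /w; case: (boolP (D x)) => Dx; rewrite ?mul0r// mul1r f0.
apply: (ge0_integral_wpush (m := @lebesgue_measure R) mF mw w0 _ mg g0) => A mA.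
have GD y : G y \in D by exact: DG.
have incFle : {in D &, {mono F : x y / x <= y}} by apply: le_mono_in.
rewrite -[LHS]/(wpush (@lebesgue_measure R) mF mw w0 A).
apply/esym; apply: (@lebesgue_measure_unique R (@wpush _ _ _ (measurableTypeR R) R (@lebesgue_measure R) _ _ mF mw w0)) => // X [[c d] _ <-] /=.
rewrite /wpush lebesgue_measure_itv/= lte_fin; case: ltP => [cd|dc]; last first.
  rewrite set_itv_ge; last by rewrite bnd_simp -leNgt.
  by rewrite preimage_set0 integral_set0.
have Gcd : G c <= G d by rewrite -(incFle _ _ (GD c) (GD d)) !FG ltW.
rewrite -EFinB (_ : d - c = F (G d) - F (G c)); last by rewrite !FG.
have DGcd x : G c <= x <= G d -> D x by exact: Dconv.
rewrite -(integral_derive_itv Gcd (fun x xcd => dF x (DGcd x xcd)) (fun x xcd => cf x (DGcd x xcd))).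
rewrite -integral_itv_obnd_cbnd; last first.
  by apply/measurable_funTS; mtac.
rewrite integral_mkcond [RHS]integral_mkcond; apply: eq_integral => x _; rewrite !patchE.
have -> : (x \in F @^-1` `]c, d]) = (c < F x <= d).
  by apply/idP/idP => [/set_mem/=|xcd]; [|apply/mem_set]; rewrite /= in_itv.
rewrite mem_setE in_itv/=.
rewrite /w; case: (boolP (D x)) => Dx.
  have incFlt : {in D &, {mono F : x y / x < y}} by apply: leW_mono_in.
  by rewrite mul1r -{2}(FG c) -{2}(FG d) incFlt ?incFle ?GD.
rewrite mul0r if_same; case: ifP => // /andP[Gx xG].
by move: Dx; rewrite (@Dconv (G c) x (G d)) ?(ltW Gx) ?xG.
Qed.

Lemma integral_affine (c d : R) (g : R -> \bar R) : c != 0 ->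
  measurable_fun setT g -> (forall y, 0 <= g y)%E ->
  (\int[mu]_x g (c * x + d)%R = (`|c|^-1)%:E * \int[mu]_y g y)%E.
Proof.
move=> c0 mg g0.
have pos c' d' (g' : R -> \bar R) : 0 < c' -> measurable_fun setT g' -> (forall y, 0 <= g' y)%E ->
   (\int[mu]_x g' (c' * x + d')%R = (c'^-1)%:E * \int[mu]_y g' y)%E.
  move=> c'0 mg' g'0.
  have <- : (\int[mu]_x (g' (c' * x + d')%R * (true%:R * c')%:E) = \int[mu]_y g' y)%E.
    apply: (@ge0_integral_change (fun=> true) (fun x => c' * x + d') (fun=> c') (fun y => (y - d') / c')) => //.
    - by mtac.
    - by move=> x _; exact: ltW.
    - by move=> y; rewrite mulrC divfK ?subrK//; exact: lt0r_neq0.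
    - by move=> x y _ _ xy; rewrite ltrD2r ltr_pM2l.
    - move=> x _; apply: is_derive_eq; by rewrite addr0 scaler1.
    - by move=> x _; exact: cvg_cst.
  rewrite -ge0_integralZl//; last 3 first.
  - by mtac.
  - by move=> x _; apply: mule_ge0; rewrite // mul1r lee_fin ltW.
  - by rewrite lee_fin invr_ge0 ltW.
  apply: eq_integral => x _; rewrite mul1r muleCA -EFinM mulVf ?mule1//; exact: lt0r_neq0.
(* The reflection is decreasing, so it is outside the scope of [ge0_integral_change]; its image
   measure is compared with Lebesgue measure directly on half-open intervals, which become half-open
   at the other end. *)
have neg (g' : R -> \bar R) : measurable_fun setT g' -> (forall y, 0 <= g' y)%E ->
   (\int[mu]_x g' (- x)%R = \int[mu]_y g' y)%E.
  move=> mg' g'0; have mN : measurable_fun setT (fun x : R => - x) by mtac.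
  have <- : (\int[mu]_x (g' (- x)%R * 1%:E) = \int[mu]_y g' y)%E; last first.
    by apply: eq_integral => x _; rewrite mule1.
  pose w : R -> R := fun=> 1.
  have w0 x : 0 <= w x by [].
  have mw : measurable_fun setT w by exact: measurable_cst.
  have H (A : set (measurableTypeR R)) : measurable A ->
      (\int[mu]_(x in (fun x : R => - x)%R @^-1` A) (w x)%:E = mu A)%E; last first.
    exact: (ge0_integral_wpush (m := @lebesgue_measure R) mN mw w0 H mg' g'0).
  move=> mA.
  rewrite -[LHS]/(wpush (@lebesgue_measure R) mN mw w0 A).
  apply/esym; apply: (@lebesgue_measure_unique R (@wpush _ _ _ (measurableTypeR R) R (@lebesgue_measure R) _ _ mN mw w0)) => // X [[c' d'] _ <-] /=.
  rewrite /wpush /w integral_cst/=; last first.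
    by rewrite -[X in measurable X]setTI; apply: (mN measurableT); exact: measurable_itv.
  rewrite mul1e (_ : _ @^-1` _ = `[- d', - c'[%classic); last first.
    by apply/seteqP; split => x /=; rewrite !in_itv/=; lra.
  rewrite !lebesgue_measure_itv/= !lte_fin ltrN2; case: ifP => // _.
  by rewrite -!EFinD opprK addrC.
have [cp|cn] := ltP 0 c; first by rewrite gtr0_norm// pos.
have {}cn : 0 < - c by rewrite oppr_gt0 lt_neqAle c0.
rewrite ltr0_norm ?oppr_gt0//; last by rewrite -oppr_gt0.
rewrite -(neg g)// -(@pos (- c) (- d) (fun x => g (- x)))//.
- by apply: eq_integral => x _; congr (g _); ring.
- by mtac.
Qed.

End change_of_variables.

(** * Product measures *)
Section tensor_measure.
Local Open Scope ereal_scope.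
Context d1 d2 (T1 : measurableType d1) (T2 : measurableType d2) (R : realType).
Variables (m1 : {sigma_finite_measure set T1 -> \bar R}) (m2 : {sigma_finite_measure set T2 -> \bar R}).

(* The library gives [m1 \x m2] no sigma-finite structure, which iterating it requires. *)
Definition tensor : set (T1 * T2) -> \bar R := (m1 \x m2).

HB.instance Definition _ := Measure.on tensor.

Let tensor_sigma_finite : sigma_finite setT tensor.
Proof.
have [F TF Foo] := sigma_finiteT m1; have [G TG Goo] := sigma_finiteT m2.
exists (fun n => if unpickle n is Some (i, j) then F i `*` G j else set0).
  apply/esym; rewrite -subTset => -[x y] _; have : [set: T1] x by []; have : [set: T2] y by [].
  rewrite TF TG => -[j _ Gy] [i _ Fx]; exists (pickle (i, j)) => //=.
  by rewrite pickleK.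
move=> k; case: (unpickle k) => [[i j]|]; last by rewrite measure0; split.
have [mF Fi] := Foo i; have [mG Gj] := Goo j; split; first exact: measurableX.
by rewrite /tensor product_measure1E// lte_mul_pinfty// ge0_fin_numE.
Qed.

HB.instance Definition _ := Measure_isSigmaFinite.Build _ _ _ tensor tensor_sigma_finite.

Lemma ge0_integral_tensor (f : T1 * T2 -> \bar R) : measurable_fun setT f -> (forall x, 0 <= f x) ->
  \int[tensor]_x f x = \int[m1]_x \int[m2]_y f (x, y).
Proof. exact: fubini_tonelli1. Qed.

Lemma ge0_integral_tensor_swap (f : T1 * T2 -> \bar R) : measurable_fun setT f -> (forall x, 0 <= f x) ->
  \int[tensor]_x f x = \int[m2]_y \int[m1]_x f (x, y).
Proof. exact: fubini_tonelli2. Qed.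

Lemma integral_tensor_swap (f : T1 * T2 -> \bar R) : tensor.-integrable setT f ->
  \int[tensor]_x f x = \int[m2]_y \int[m1]_x f (x, y).
Proof. by move=> H; apply: esym; exact: integral21_prod_meas1. Qed.

Lemma integral_tensor (f : T1 * T2 -> \bar R) : tensor.-integrable setT f ->
  \int[tensor]_x f x = \int[m1]_x \int[m2]_y f (x, y).
Proof. by move=> H; apply: esym; exact: integral12_prod_meas1. Qed.

Lemma integrable_tensorP (f : T1 * T2 -> \bar R) : measurable_fun setT f ->
  tensor.-integrable setT f <-> \int[m1]_x \int[m2]_y `|f (x, y)| < +oo.
Proof. exact: integrable12ltyP. Qed.

End tensor_measure.

Section product_integral.
Context d1 d2 (Y1 : measurableType d1) (Y2 : measurableType d2) (R : realType).
Variables (m1 : {sigma_finite_measure set Y1 -> \bar R}) (m2 : {sigma_finite_measure set Y2 -> \bar R}).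
Variables (f : Y1 -> R) (g : Y2 -> R).
Hypotheses (intf : m1.-integrable setT (EFin \o f)) (intg : m2.-integrable setT (EFin \o g)).

Lemma integrable_tensor : (tensor m1 m2).-integrable setT (EFin \o (fun z => f z.1 * g z.2)).
Proof.
have mf := measurable_int _ intf; have mg := measurable_int _ intg.
move/measurable_EFinP in mf; move/measurable_EFinP in mg.
apply/integrable_tensorP; first by rewrite /comp; mtac.
have -> : (\int[m1]_x \int[m2]_y `|(EFin \o (fun z : Y1 * Y2 => (f z.1 * g z.2)%R)) (x, y)| =
   (\int[m1]_x `|(f x)%:E|) * (\int[m2]_y `|(g y)%:E|))%E.
  rewrite -ge0_integralZr//=; last 2 first.
  - by mtac.
  - exact: integral_ge0.
  apply: eq_integral => x _; rewrite -ge0_integralZl//=; last by mtac.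
  by apply: eq_integral => y _; rewrite normrM EFinM.
have /integrableP[_ If] := intf; have /integrableP[_ Ig] := intg.
by rewrite lte_mul_pinfty// ?integral_ge0// ge0_fin_numE// integral_ge0.
Qed.

Lemma Rintegral_tensor : \int[(tensor m1 m2)]_z (f z.1 * g z.2) =
  (\int[m1]_x f x) * (\int[m2]_y g y) :> R.
Proof.
have := integrable_tensor.
move=> I12; rewrite /Rintegral (integral_tensor I12)/=.
under eq_integral do under eq_integral do rewrite EFinM.
under eq_integral do rewrite (integralZl measurableT intg).
rewrite -fineM; last 2 first.
- exact: integrable_fin_num.
- exact: integrable_fin_num.
have If := integrable_fin_num measurableT intg.
rewrite -(fineK If) -integralZr//.
Qed.

End product_integral.

Section lebesgue_products.
Context (R : realType).
Notation mu := (@lebesgue_measure R).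

Definition lebR2 := tensor mu mu.
HB.instance Definition _ := SigmaFiniteMeasure.on lebR2.
Definition lebR3 := tensor lebR2 mu.
HB.instance Definition _ := SigmaFiniteMeasure.on lebR3.

Lemma ge0_integral_leb3 (f : R * R * R -> \bar R) : measurable_fun setT f -> (forall x, 0 <= f x)%E ->
  (\int[lebR3]_x f x = \int[mu]_x \int[mu]_y \int[mu]_z f (x, y, z))%E.
Proof.
move=> mf f0; rewrite ge0_integral_tensor// ge0_integral_tensor//; first by mtac.
by move=> x; exact: integral_ge0.
Qed.

Lemma ge0_integral_leb2 (f : R * R -> \bar R) : measurable_fun setT f -> (forall x, 0 <= f x)%E ->
  (\int[lebR2]_x f x = \int[mu]_x \int[mu]_y f (x, y))%E.
Proof. by move=> mf f0; rewrite ge0_integral_tensor. Qed.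

End lebesgue_products.
Arguments lebR2 {R}.
Arguments lebR3 {R}.

(** * The TT^* bound *)
Section ttstar.
Context d1 d2 (X : measurableType d1) (Y : measurableType d2) (R : realType).
Variables (mX : {sigma_finite_measure set X -> \bar R}) (mY : {sigma_finite_measure set Y -> \bar R}).
Variables (psi : X -> Y -> R) (om H : Y -> R) (B : R).
Hypothesis mpsi : measurable_fun setT (fun p : X * Y => psi p.1 p.2).
Hypothesis mom : measurable_fun setT om.
Hypothesis B0 : 0 <= B.
Hypothesis om0 : forall y, 0 <= om y.
Hypothesis intH : mY.-integrable setT (EFin \o H).
(* Makes the junk value [H y ^+ 2 / 0 = 0] harmless below. *)
Hypothesis omH : forall y, om y = 0 -> H y = 0.

Let mH : measurable_fun setT H.
Proof. exact/measurable_EFinP/(measurable_int _ intH). Qed.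

Lemma integrable_osc (u : Y -> R) : measurable_fun setT u -> (forall y, `|u y| <= 1) ->
  mY.-integrable setT (EFin \o (fun y => u y * H y)).
Proof.
move=> mfu u1; apply: (le_integrable measurableT _ _ intH) => /=; first by mtac.
by move=> y _; rewrite lee_fin normrM ler_piMl.
Qed.

(** Real and imaginary part of the oscillatory integral of [e^{i psi} H]; the pair replaces a
    complex-valued function. *)
Definition cosint x := \int[mY]_y (cos (psi x y) * H y).
Definition sinint x := \int[mY]_y (sin (psi x y) * H y).

Let mpsix x : measurable_fun setT (psi x).
Proof. by apply: (measurableT_comp mpsi (g := fun y => (x, y))); mtac. Qed.

Lemma measurable_cosint : measurable_fun setT cosint.
Proof. by rewrite /cosint; mtac. Qed.

Lemma measurable_sinint : measurable_fun setT sinint.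
Proof. by rewrite /sinint; mtac. Qed.

(** The squared modulus opens into a double integral with the difference of the phases: this is
    where the kernel of TT^* appears. *)
Lemma cos_sin_sqr_int x : cosint x ^+ 2 + sinint x ^+ 2 =
  \int[(tensor mY mY)]_z (cos (psi x z.1 - psi x z.2) * (H z.1 * H z.2)).
Proof.
have mpx := @mpsix x.
have Ic : mY.-integrable setT (EFin \o (fun y => cos (psi x y) * H y)).
  by apply: integrable_osc; [mtac|move=> y; rewrite ler_norml cos_geN1 cos_le1].
have Is : mY.-integrable setT (EFin \o (fun y => sin (psi x y) * H y)).
  by apply: integrable_osc; [mtac|move=> y; rewrite ler_norml sin_geN1 sin_le1].
rewrite !expr2 /cosint /sinint -!Rintegral_tensor// -RintegralD//; last 2 first.
- exact: (integrable_tensor Ic Ic).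
- exact: (integrable_tensor Is Is).
by apply: eq_Rintegral => z _; rewrite cosB; ring.
Qed.

(** [f] may change sign: its negative part is dropped, since only the positive part counts for an
    upper bound. *)
Lemma integral_le_ge0 d (T : measurableType d) (m : {measure set T -> \bar R}) (f g : T -> \bar R) :
  (forall x, f x <= g x)%E -> (forall x, 0 <= g x)%E -> (\int[m]_x f x <= \int[m]_x g x)%E.
Proof.
move=> fg g0; rewrite integralE; apply: (@le_trans _ _ (\int[m]_x f^\+ x)%E).
  by rewrite -[leRHS]sube0 leeB// integral_ge0.
apply: ge0_le_integral_mono => // x; rewrite funeposE ge_max fg g0//.
Qed.

(** Fubini turns the left side into the quadratic form of the kernel [kap] at [H], and the Schur
    test with weight [om] bounds it by the row sums of [kap]. The integrable damping [rho] makes the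
    triple integrand absolutely integrable, which legitimates the exchange. *)
Lemma ttstar_bound (rho : X -> R) (kap : Y -> Y -> R) :
  mX.-integrable setT (EFin \o rho) -> (forall x, 0 <= rho x) ->
  (forall y y', \int[mX]_x (rho x * cos (psi x y - psi x y')) = kap y y') ->
  (forall y y', 0 <= kap y y') ->
  (forall y, \int[mY]_y' (kap y y' * om y')%:E <= B%:E)%E ->
  (\int[mX]_x (rho x * (cosint x ^+ 2 + sinint x ^+ 2))%:E <= B%:E * \int[mY]_y (H y ^+ 2 / om y)%:E)%E.
Proof.
move=> irho rho0 kapE kap0 kapB.
have mrho : measurable_fun setT rho by exact/measurable_EFinP/(measurable_int _ irho).
have mpsi2 d (T : measurableType d) (a : T -> X) (b : T -> Y) : measurable_fun setT a -> measurable_fun setT b ->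
    measurable_fun setT (fun t => psi (a t) (b t)).
  by move=> ma mb; apply: (measurableT_comp mpsi (g := fun t => (a t, b t))); mtac.
have mkap : measurable_fun setT (fun p : Y * Y => kap p.1 p.2).
  have -> : (fun p : Y * Y => kap p.1 p.2) = (fun p => \int[mX]_x (rho x * cos (psi x p.1 - psi x p.2))).
    by apply/funext => p; rewrite kapE.
  by mtac; apply: mpsi2; mtac.
have mkap2 d (T : measurableType d) (a b : T -> Y) : measurable_fun setT a -> measurable_fun setT b ->
    measurable_fun setT (fun t => kap (a t) (b t)).
  by move=> ma mb; apply: (measurableT_comp mkap (g := fun t => (a t, b t))); mtac.
have kapC y y' : kap y y' = kap y' y.
  by rewrite -!kapE; apply: eq_Rintegral => x _; rewrite -cosN opprB.
pose F (p : X * (Y * Y)) := rho p.1 * (cos (psi p.1 p.2.1 - psi p.1 p.2.2) * (H p.2.1 * H p.2.2)).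
have mF : measurable_fun setT F by rewrite /F; mtac; apply: mpsi2; mtac.
have iHH := integrable_tensor intH intH.
have iF : (tensor mX (tensor mY mY)).-integrable setT (EFin \o F).
  apply: (le_integrable measurableT _ _ (integrable_tensor irho iHH)) => /=; first by mtac.
  move=> p _; rewrite lee_fin /F !normrM ler_wpM2l// ler_piMl ?mulr_ge0//.
  by rewrite ler_norml cos_geN1 cos_le1.
have -> : (\int[mX]_x (rho x * (cosint x ^+ 2 + sinint x ^+ 2))%:E = \int[mX]_x \int[(tensor mY mY)]_z (F (x, z))%:E)%E.
  apply: eq_integral => x _; rewrite cos_sin_sqr_int.
  have ix : (tensor mY mY).-integrable setT (EFin \o (fun z => cos (psi x z.1 - psi x z.2) * (H z.1 * H z.2))).
    apply: (le_integrable measurableT _ _ iHH) => /=; first by mtac; apply: mpsi2; mtac.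
    move=> z _; rewrite lee_fin !normrM ler_piMl ?mulr_ge0//.
    by rewrite ler_norml cos_geN1 cos_le1.
  rewrite EFinM /Rintegral fineK; last exact: integrable_fin_num.
  rewrite -integralZl//.
rewrite -(integral_tensor iF) (integral_tensor_swap iF).
have -> : (\int[(tensor mY mY)]_z \int[mX]_x (F (x, z))%:E = \int[(tensor mY mY)]_z (H z.1 * H z.2 * kap z.1 z.2)%:E)%E.
  apply: eq_integral => z _.
  have iz : mX.-integrable setT (EFin \o (fun x => rho x * cos (psi x z.1 - psi x z.2))).
    apply: (le_integrable measurableT _ _ irho) => /=; first by mtac; apply: mpsi2; mtac.
    by move=> x _; rewrite lee_fin normrM ler_piMr// ler_norml cos_geN1 cos_le1.
  rewrite -kapE EFinM /Rintegral fineK; last exact: integrable_fin_num.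
  rewrite -integralZl//; apply: eq_integral => x _; rewrite /F/= -EFinM; congr EFin; ring.
(* The two terms of the Schur test are halves of [P] with its arguments in either order; both are
   controlled by the row sums of [kap]. *)
pose P (y y' : Y) := kap y y' * (H y ^+ 2 / om y * om y').
have Q0 y : 0 <= H y ^+ 2 / om y by rewrite divr_ge0 ?sqr_ge0.
have P0 y y' : 0 <= P y y' by rewrite /P; do 2 apply: mulr_ge0 => //.
have mP : measurable_fun setT (fun z : Y * Y => P z.1 z.2) by rewrite /P; mtac; apply: mkap2; mtac.
have mP' : measurable_fun setT (fun z : Y * Y => P z.2 z.1) by rewrite /P; mtac; apply: mkap2; mtac.
have intP : (\int[mY]_y \int[mY]_y' (P y y')%:E <= B%:E * \int[mY]_y (H y ^+ 2 / om y)%:E)%E.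
  rewrite muleC -ge0_integralZr//; last 2 first.
  - by mtac.
  - by move=> y _; rewrite lee_fin.
  apply: ge0_le_integral_mono => y; first by apply: integral_ge0 => y' _; rewrite lee_fin.
  have -> : (\int[mY]_y' (P y y')%:E = (H y ^+ 2 / om y)%:E * \int[mY]_y' (kap y y' * om y')%:E)%E.
    rewrite -ge0_integralZl//.
    - by apply: eq_integral => y' _; rewrite -EFinM; congr EFin; rewrite /P; ring.
    - by mtac; apply: mkap2; mtac.
    - by move=> y' _; rewrite lee_fin mulr_ge0.
    - by rewrite lee_fin.
  by apply: lee_wpmul2l; rewrite // lee_fin.
apply: (@le_trans _ _ (\int[(tensor mY mY)]_z ((2^-1 * P z.1 z.2)%:E + (2^-1 * P z.2 z.1)%:E))%E).
  apply: integral_le_ge0 => z; last by rewrite -EFinD lee_fin addr_ge0// mulr_ge0.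
  rewrite -EFinD lee_fin /P (kapC z.2 z.1).
  have := om0 z.1; rewrite le_eqVlt => /orP[/eqP/esym o1|o1].
    by rewrite (omH o1) !(mul0r, mulr0, expr0n, add0r)/= o1 !(mul0r, mulr0).
  have := om0 z.2; rewrite le_eqVlt => /orP[/eqP/esym o2|o2].
    by rewrite (omH o2) !(mul0r, mulr0, expr0n, add0r)/= o2 !(mul0r, mulr0, addr0).
  (* Schur test: 2 H H' <= H^2 om' / om + H'^2 om / om' *)
  rewrite -subr_ge0 (_ : _ - _ = 2^-1 * kap z.1 z.2 * ((H z.1 * om z.2 - H z.2 * om z.1) ^+ 2 / (om z.1 * om z.2))).
    apply: mulr_ge0; first exact: mulr_ge0.
    by rewrite divr_ge0 ?sqr_ge0 ?mulr_ge0.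
  by field; rewrite !lt0r_neq0.
rewrite ge0_integralD//; last 4 first.
- by move=> z _; rewrite lee_fin mulr_ge0.
- by mtac.
- by move=> z _; rewrite lee_fin mulr_ge0.
- by mtac.
rewrite ge0_integral_tensor//=; last 2 first.
- by mtac.
- by move=> z; rewrite lee_fin mulr_ge0.
rewrite ge0_integral_tensor_swap//=; last 2 first.
- by mtac.
- by move=> z; rewrite lee_fin mulr_ge0.
have -> : (\int[mY]_x \int[mY]_y (2^-1 * P x y)%:E = 2^-1%:E * \int[mY]_x \int[mY]_y (P x y)%:E)%E.
  rewrite -ge0_integralZl//; last 2 first.
  - by apply: measurable_fun_integral; mtac.
  - by move=> x _; apply: integral_ge0 => y _; rewrite lee_fin.
  apply: eq_integral => x _; rewrite -ge0_integralZl//.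
  - apply: measurable_fun_EFin; apply: (measurableT_comp mP (g := fun y => (x, y))); mtac.
  - by move=> y _; rewrite lee_fin.
set J := (X in (2^-1%:E * X)%E).
have J0 : (0 <= J)%E by apply: integral_ge0 => x _; apply: integral_ge0 => y _; rewrite lee_fin.
by rewrite -ge0_muleDl// -EFinD (_ : 2^-1 + 2^-1 = 1 :> R) ?mul1e//; field.
Qed.

(** The constant [B] is uniform in [n], so Fatou's lemma removes the damping as [rho n] tends to
    1. *)
Lemma ttstar_lim (rho : nat -> X -> R) (kap : nat -> Y -> Y -> R) :
  (forall n, mX.-integrable setT (EFin \o rho n)) -> (forall n x, 0 <= rho n x) ->
  (forall n y y', \int[mX]_x (rho n x * cos (psi x y - psi x y')) = kap n y y') ->
  (forall n y y', 0 <= kap n y y') ->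
  (forall n y, \int[mY]_y' (kap n y y' * om y')%:E <= B%:E)%E ->
  (forall x, rho ^~ x @ \oo --> (1 : R)) ->
  (\int[mX]_x (cosint x ^+ 2 + sinint x ^+ 2)%:E <= B%:E * \int[mY]_y (H y ^+ 2 / om y)%:E)%E.
Proof.
move=> irho rho0 kapE kap0 kapB rho1.
have mc := measurable_cosint; have ms := measurable_sinint.
pose g n x : \bar R := (rho n x * (cosint x ^+ 2 + sinint x ^+ 2))%:E.
have g0 n x : (0 <= g n x)%E by rewrite lee_fin mulr_ge0 ?addr_ge0 ?sqr_ge0.
have mg n : measurable_fun setT (g n).
  have mr : measurable_fun setT (rho n) by exact/measurable_EFinP/(measurable_int _ (irho n)).
  by rewrite /g; mtac.
have <- : (\int[mX]_x limn_einf (g ^~ x) = \int[mX]_x (cosint x ^+ 2 + sinint x ^+ 2)%:E)%E.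
  apply: eq_integral => x _.
  have gc : g ^~ x @ \oo --> (cosint x ^+ 2 + sinint x ^+ 2)%:E.
    apply: cvg_EFin; first exact: nearW.
    rewrite -[X in _ --> X]mul1r; apply: cvgMr_tmp; exact: rho1.
  by rewrite is_cvg_limn_einfE ?(cvg_lim _ gc)//; apply/cvg_ex; exists (cosint x ^+ 2 + sinint x ^+ 2)%:E.
apply: le_trans (fatou mX measurableT mg _) _ => //.
rewrite limn_einf_lim; apply: lime_le; first exact: is_cvg_einfs.
apply: nearW => n; apply: le_trans (ttstar_bound (irho n) (rho0 n) (kapE n) (kap0 n) (kapB n)).
by apply: ereal_inf_lbound; exists n => /=.
Qed.
End ttstar.

(** * Convolution of measures on a cone over a parabola *)

Definition ind_pos (R : realType) (m : R) : \bar R := ((0 < m)%R%:R)%:E.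

Lemma ind_pos_ge0 (R : realType) (m : R) : (0 <= ind_pos m)%E. Proof. by rewrite lee_fin. Qed.

Lemma measurable_ind_pos (R : realType) d (T : measurableType d) (f : T -> R) : measurable_fun setT f ->
  measurable_fun setT (fun x => ind_pos (f x)).
Proof. by move=> mf; rewrite /ind_pos; mtac. Qed.

Ltac mtac1 := repeat (mtac; try apply: measurable_ind_pos); mtac.

Section cone_convolution.
Context (R : realType).
Notation mu := (@lebesgue_measure R).

Lemma ae_neq (c : R) : {ae mu, forall x, x != c}.
Proof.
exists [set c]; split => //; first exact: lebesgue_measure_set1.
by move=> x /= /negP; rewrite negbK => /eqP.
Qed.

Lemma ge0_integral_ln (g : R -> \bar R) : measurable_fun setT g -> (forall y, 0 <= g y)%E ->
  (\int[mu]_x (g (ln x) * ((0 < x)%R%:R * x^-1)%:E) = \int[mu]_y g y)%E.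
Proof.
move=> mg g0; apply: (@ge0_integral_change _ (fun x : R => 0 < x) (@ln R) (fun x => x^-1) (@expR R)) => //.
- by mtac.
- by mtac.
- by move=> x x0; rewrite invr_ge0 ltW.
- by move=> x y z x0 z0 /andP[xy _]; exact: lt_le_trans xy.
- by move=> y; exact: expR_gt0.
- by move=> y; rewrite expRK.
- by move=> x y x0 y0 xy; rewrite ltr_ln.
- by move=> x x0; apply: inv_continuous; exact: lt0r_neq0.
Qed.

(** The branches v > 0 and v < 0 contribute equally, each with Jacobian 1 / (2 sqrt (c y)). Both
    sides are compared in the logarithm of y, because the substitution theorem asks for a map onto
    the whole line. *)
Lemma ge0_integral_sqr (c : R) (g : R -> \bar R) : 0 < c -> measurable_fun setT g -> (forall y, 0 <= g y)%E ->
  (\int[mu]_v g (c * v ^+ 2)%R = \int[mu]_y (g y * ((0 < y)%R%:R / Num.sqrt (c * y))%:E))%E.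
Proof.
move=> c0 mg g0.
pose g1 s : \bar R := (g (expR s) * (expR s / Num.sqrt (c * expR s))%:E)%E.
have mg1 : measurable_fun setT g1 by rewrite /g1; mtac.
have g10 s : (0 <= g1 s)%E by rewrite /g1 mule_ge0// lee_fin divr_ge0 ?expR_ge0.
have sq v : 0 < v -> Num.sqrt (c * (c * v ^+ 2)) = c * v.
  by move=> v0; rewrite (_ : c * _ = (c * v) ^+ 2); [rewrite sqrtr_sqr gtr0_norm ?mulr_gt0|ring].
have E1 : (\int[mu]_y (g y * ((0 < y)%R%:R / Num.sqrt (c * y))%:E) = \int[mu]_s g1 s)%E.
  rewrite -[RHS]ge0_integral_ln//; apply: eq_integral => y _.
  case: (ltP 0 y) => y0; last by rewrite !mul0r !mule0.
  rewrite /g1 lnK// !mul1r -muleA -EFinM; congr (_ * _%:E)%E.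
  by rewrite mulrAC divff ?mul1r// lt0r_neq0.
have E2 : (\int[mu]_v (g1 (ln (c * v ^+ 2)) * ((0 < v)%R%:R * (2 / v))%:E) = \int[mu]_s g1 s)%E.
  apply: (@ge0_integral_change _ (fun x : R => 0 < x) (fun v => ln (c * v ^+ 2)) (fun v => 2 / v) (fun s => Num.sqrt (expR s / c))) => //.
  - by mtac.
  - have mcv : measurable_fun setT (fun v : R => c * v ^+ 2) by mtac.
    exact: (measurableT_comp (@measurable_ln R) mcv).
  - by mtac.
  - by move=> x x0; rewrite divr_ge0// ltW.
  - by move=> x y z x0 z0 /andP[xy _]; exact: lt_le_trans xy.
  - by move=> y; rewrite sqrtr_gt0 divr_gt0 ?expR_gt0.
  - move=> y; rewrite sqr_sqrtr ?divr_ge0 ?expR_ge0 ?(ltW c0)// mulrCA divff ?mulr1 ?expRK//; exact: lt0r_neq0.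
  - move=> x y x0 y0 xy; rewrite ltr_ln ?posrE ?mulr_gt0 ?exprn_gt0//.
    by rewrite ltr_pM2l// ltr_pXn2r// nnegrE ltW.
  - move=> x x0; have cx : 0 < c * x ^+ 2 by rewrite mulr_gt0 ?exprn_gt0.
    have := is_derive1_ln cx => H1.
    apply: is_derive_eq.
    rewrite /GRing.scale/=; field; by rewrite !lt0r_neq0.
  - move=> x x0; apply: cvgM; first exact: cvg_cst.
    by apply: inv_continuous; exact: lt0r_neq0.
rewrite E1 -E2.
have E3 v : 0 < v -> (g1 (ln (c * v ^+ 2)) * (1 * (2 / v))%:E = g (c * v ^+ 2)%R * 2%:E)%E.
  move=> v0; have cx : 0 < c * v ^+ 2 by rewrite mulr_gt0 ?exprn_gt0.
  rewrite /g1 lnK ?posrE// sq// -muleA -EFinM; congr (_ * _%:E)%E.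
  by field; rewrite !lt0r_neq0.
have mgc : measurable_fun setT (fun v : R => g (c * v ^+ 2)%R) by mtac.
pose g2 v : \bar R := (g (c * v ^+ 2)%R * (0 < v)%R%:R%:E)%E.
have mg2 : measurable_fun setT g2 by rewrite /g2; mtac.
have g20 v : (0 <= g2 v)%E by rewrite /g2 mule_ge0// lee_fin.
(* [g2] restricts to the positive branch; its mirror image is the negative one, and the point 0 is
   null. *)
transitivity (\int[mu]_v (g2 v + g2 (- v)%R))%E.
  apply: ge0_ae_eq_integral => //.
  - by apply: emeasurable_funD; mtac.
  - by move=> v _; rewrite adde_ge0.
  - have [N [mN N0 subN]] := ae_neq 0.
    exists N; split => // v /= nv; apply: subN => /= v0; apply: nv => _.
    rewrite /g2 sqrrN oppr_gt0.
    by case: (ltgtP 0 v) v0 => //= _ _; rewrite ?mule1 ?mule0 ?adde0 ?add0e.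
rewrite ge0_integralD//; last by mtac.
have -> : (\int[mu]_x g2 (- x)%R = \int[mu]_x g2 x)%E.
  transitivity (\int[mu]_x g2 (-1 * x + 0)%R)%E.
    by apply: eq_integral => x _; rewrite mulN1r addr0.
  by rewrite integral_affine// normrN1 invr1 mul1e.
rewrite -ge0_integralD//; apply: eq_integral => v _.
case: (ltP 0 v) => v0; last by rewrite /g2 ltNge v0 mul0r !mule0 adde0.
by rewrite -[(true%:R)%R]/(1%R) E3// /g2 v0 mule1 -mule2n -mule_natl muleC.
Qed.

(* Density at (M, P, E) of the convolution of two copies of the measure dm db on the points (m, m b, m b^2), m > 0, up to the factor pi. *)
Definition dens (M P E : R) : R := (0 < M)%R%:R / Num.sqrt (M * E - P ^+ 2).

Lemma integral_translate (d : R) (g : R -> \bar R) : measurable_fun setT g -> (forall y, 0 <= g y)%E ->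
  (\int[mu]_x g (x + d)%R = \int[mu]_y g y)%E.
Proof.
move=> mg g0; transitivity (\int[mu]_x g (1 * x + d)%R)%E.
  by apply: eq_integral => x _; rewrite mul1r.
by rewrite integral_affine ?oner_neq0// normr1 invr1 mul1e.
Qed.

Lemma integral_reflect (d : R) (g : R -> \bar R) : measurable_fun setT g -> (forall y, 0 <= g y)%E ->
  (\int[mu]_x g (d - x)%R = \int[mu]_y g y)%E.
Proof.
move=> mg g0; transitivity (\int[mu]_x g (-1 * x + d)%R)%E.
  by apply: eq_integral => x _; rewrite mulN1r addrC.
by rewrite integral_affine ?oppr_eq0 ?oner_neq0// normrN1 invr1 mul1e.
Qed.

(** Center of mass coordinates: with v = b1 - b2 and P the total momentum, the energy is P^2 / M + c
    v^2, where [c = m1 * m2 / M] is the reduced mass. The substitution y = c v^2 then produces the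
    inverse square root of M E - P^2. *)
Lemma integral_two_parabolas (m1 m2 : R) (K : R * R * R -> \bar R) :
  0 < m1 -> 0 < m2 -> measurable_fun setT K -> (forall q, 0 <= K q)%E ->
  (\int[mu]_b1 \int[mu]_b2 K (m1 + m2, m1 * b1 + m2 * b2, m1 * b1 ^+ 2 + m2 * b2 ^+ 2)%R =
   \int[mu]_P \int[mu]_E (K (m1 + m2, P, E)%R * ((Num.sqrt (m1 * m2))^-1 / Num.sqrt ((m1 + m2) * E - P ^+ 2))%:E))%E.
Proof.
move=> m10 m20 mK K0; set M := m1 + m2; have M0 : 0 < M by rewrite addr_gt0.
pose c := m1 * m2 / M; have c0 : 0 < c by rewrite divr_gt0 ?mulr_gt0.
rewrite ge0_integral_swap; last 2 first.
- by mtac.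
- by [].
transitivity (\int[mu]_b2 \int[mu]_v K (M, m1 * v + M * b2, m1 * (v + b2) ^+ 2 + m2 * b2 ^+ 2)%R)%E.
  apply: eq_integral => b2 _.
  rewrite -(@integral_translate b2 (fun b1 => K (M, m1 * b1 + m2 * b2, m1 * b1 ^+ 2 + m2 * b2 ^+ 2)%R)); last 2 first.
  - by mtac.
  - by [].
  by apply: eq_integral => v _; congr (K (_, _, _)); rewrite /M; ring.
rewrite ge0_integral_swap; last 2 first.
- by mtac.
- by [].
transitivity (\int[mu]_v \int[mu]_P ((M^-1)%:E * K (M, P, P ^+ 2 / M + c * v ^+ 2)%R))%E.
  apply: eq_integral => v _.
  pose h P := K (M, P, P ^+ 2 / M + c * v ^+ 2).
  have mh : measurable_fun setT h by rewrite /h; mtac.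
  rewrite ge0_intZl; last 3 first.
  - exact: mh.
  - by move=> y; exact: K0.
  - by rewrite lee_fin invr_ge0 ltW.
  transitivity ((`|M|^-1)%:E * \int[mu]_P h P)%E; last by rewrite gtr0_norm.
  rewrite -(integral_affine (m1 * v) (lt0r_neq0 M0) mh); last by move=> y; exact: K0.
  apply: eq_integral => b2 _; rewrite /h; congr (K (_, _, _)); first by rewrite addrC.
  by rewrite /c /M; field; exact: lt0r_neq0.
rewrite ge0_integral_swap; last 2 first.
- by mtac.
- by move=> v P; rewrite mule_ge0// lee_fin invr_ge0 ltW.
apply: eq_integral => P _.
rewrite ge0_intZl; last 3 first.
- by mtac.
- by move=> v; exact: K0.
- by rewrite lee_fin invr_ge0 ltW.
rewrite (@ge0_integral_sqr c (fun y => K (M, P, P ^+ 2 / M + y))); last 3 first.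
- exact: c0.
- by mtac.
- by [].
rewrite -ge0_intZl; last 3 first.
- by mtac.
- by move=> y; rewrite mule_ge0// lee_fin divr_ge0.
- by rewrite lee_fin invr_ge0 ltW.
rewrite -[RHS](@integral_translate (P ^+ 2 / M)); last 2 first.
- by mtac.
- by move=> y; rewrite mule_ge0// lee_fin divr_ge0 ?invr_ge0.
apply: eq_integral => y _; rewrite addrC muleCA -EFinM; congr (_ * _%:E)%E.
have -> : M * (y + P ^+ 2 / M) - P ^+ 2 = M * y by field; exact: lt0r_neq0.
(* For [y <= 0] the right side vanishes as well: [Num.sqrt] is 0 on nonpositive numbers and the
   inverse of 0 is 0. *)
case: (ltP 0 y) => y0; last first.
  by rewrite mul0r mulr0 [X in _ / X]ler0_sqrtr ?invr0 ?mulr0// pmulr_rle0.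
rewrite mul1r -invfM -invfM; congr (_^-1).
transitivity (Num.sqrt (M ^+ 2 * (c * y))).
  by rewrite [RHS]sqrtrM ?sqr_ge0// sqrtr_sqr gtr0_norm.
rewrite -sqrtrM ?(mulr_ge0 (ltW m10) (ltW m20))//; congr Num.sqrt.
by rewrite /c; field; exact: lt0r_neq0.
Qed.

(** The arcsine law: the primitive [asin ((2 * m - M) / M)] runs from - pi / 2 to pi / 2. *)
Lemma integral_arcsine_le (M : R) :
  (\int[mu]_m (((0 < m) && (0 < M - m))%R%:R / Num.sqrt (m * (M - m)))%:E <= (pi * (0 < M)%R%:R)%:E)%E.
Proof.
have [M0|M0] := ltP 0 M; last first.
  rewrite integral0_eq ?mulr0// => m _; case: (ltP 0 m) => m0; last by rewrite /= mul0r.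
  by rewrite (_ : (0 < M - m) = false) ?mul0r//; apply/negbTE; rewrite -leNgt; lra.
pose F m := asin ((2 * m - M) / M); pose f m := (Num.sqrt (m * (M - m)))^-1.
have H m : 0 < m < M -> -1 < (2 * m - M) / M < 1.
  by move=> /andP[m0 mM]; rewrite ltr_pdivlMr// ltr_pdivrMr//; apply/andP; split; lra.
have := @ge0_integral_derive_oo_le _ 0 M F f (- (pi / 2)) (pi / 2).
rewrite opprK -splitr mulr1 => /(_ _ _ _ _ _) K.
have -> : (\int[mu]_m (((0 < m) && (0 < M - m))%R%:R / Num.sqrt (m * (M - m)))%:E =
   \int[mu]_(m in [set m : R | (0 < m < M)%R]) (f m)%:E)%E.
  rewrite [RHS]integral_mkcond; apply: eq_integral => m _; rewrite patchE subr_gt0.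
  rewrite (_ : (m \in _) = (0 < m < M)); last by apply/idP/idP => [/set_mem//|?]; exact: mem_set.
  by case: ifP => _; rewrite ?mul1r ?mul0r.
apply: K.
- move=> m mM; have := is_derive1_asin (H _ mM) => d1.
  apply: is_derive_eq.
  have /andP[m0 mM'] := mM.
  have -> : Num.sqrt (1 - ((2 * m - M) / M) ^+ 2) = 2 / M * Num.sqrt (m * (M - m)).
    rewrite (_ : 1 - _ = (2 / M) ^+ 2 * (m * (M - m))); last by field; exact: lt0r_neq0.
    by rewrite sqrtrM ?sqr_ge0// sqrtr_sqr gtr0_norm// divr_gt0.
  rewrite /GRing.scale/= /f; field; rewrite (lt0r_neq0 M0) lt0r_neq0// sqrtr_gt0 mulr_gt0 ?subr_gt0//.
- move=> m /andP[m0 mM]; apply: continuous_comp; last first.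
    by apply: inv_continuous; rewrite lt0r_neq0 ?sqrtr_gt0 ?mulr_gt0 ?subr_gt0.
  apply: continuous_comp; last exact: sqrt_continuous.
  by apply: cvgM; [exact: cvg_id|apply: cvgB; [exact: cvg_cst|exact: cvg_id]].
- by move=> m _; rewrite invr_ge0.
- move=> m mM; have /andP[? ?] := H m mM.
  by rewrite asin_geNpi2 ?asin_lepi2// !ltW.
- by have := pi_gt0 R; lra.
Qed.

Lemma dens_ge0 M P E : 0 <= dens M P E.
Proof. by rewrite /dens divr_ge0. Qed.

(** For given masses [integral_two_parabolas] leaves the factor 1 / sqrt (m1 m2), while the rest
    sees the masses only through M = m1 + m2. The integral over the splittings of M is the arcsine
    law, whence the factor pi. *)
Lemma pair_parabola_bound (K : R * R * R -> \bar R) :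
  measurable_fun setT K -> (forall q, 0 <= K q)%E ->
  (\int[mu]_m1 \int[mu]_b1 \int[mu]_m2 \int[mu]_b2 (((0 < m1) && (0 < m2))%R%:R%:E *
     K (m1 + m2, m1 * b1 + m2 * b2, m1 * b1 ^+ 2 + m2 * b2 ^+ 2)%R) <=
   pi%:E * \int[mu]_M \int[mu]_P \int[mu]_E ((dens M P E)%:E * K (M, P, E)))%E.
Proof.
move=> mK K0.
pose J M := (\int[mu]_P \int[mu]_E (((Num.sqrt (M * E - P ^+ 2))^-1)%:E * K (M, P, E)))%E.
have J0 M : (0 <= J M)%E.
  by apply: integral_ge0 => P _; apply: integral_ge0 => E _; rewrite mule_ge0// lee_fin invr_ge0.
have mJ : measurable_fun setT J by rewrite /J; mtac.
pose phi m1 m2 : R := ((0 < m1) && (0 < m2))%R%:R / Num.sqrt (m1 * m2).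
have phi0 m1 m2 : 0 <= phi m1 m2 by rewrite /phi divr_ge0.
have mphi2 d (T : measurableType d) (a b : T -> R) : measurable_fun setT a -> measurable_fun setT b ->
    measurable_fun setT (fun t => phi (a t) (b t)).
  by move=> ma mb; rewrite /phi; mtac.
have step1 m1 : (\int[mu]_b1 \int[mu]_m2 \int[mu]_b2 (((0 < m1) && (0 < m2))%R%:R%:E *
     K (m1 + m2, m1 * b1 + m2 * b2, m1 * b1 ^+ 2 + m2 * b2 ^+ 2)%R) =
   \int[mu]_m2 ((phi m1 m2)%:E * J (m1 + m2)%R))%E.
  rewrite ge0_integral_swap; last 2 first.
  - by mtac.
  - by move=> b1 m2; apply: integral_ge0 => b2 _; rewrite mule_ge0// lee_fin.
  apply: eq_integral => m2 _.
  rewrite /phi; case: (boolP (_ && _)) => [/andP[m10 m20]|_]; last first.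
    rewrite mul0r mul0e integral0_eq// => b1 _.
    by rewrite integral0_eq// => b2 _; rewrite mul0e.
  rewrite mul1r.
  transitivity (\int[mu]_b1 \int[mu]_b2 K (m1 + m2, m1 * b1 + m2 * b2, m1 * b1 ^+ 2 + m2 * b2 ^+ 2)%R)%E.
    by apply: eq_integral => b1 _; apply: eq_integral => b2 _; rewrite mul1e.
  rewrite integral_two_parabolas// /J -ge0_intZl; last 3 first.
  - by mtac.
  - by move=> P; apply: integral_ge0 => E _; rewrite mule_ge0// lee_fin invr_ge0.
  - by rewrite lee_fin invr_ge0.
  apply: eq_integral => P _; rewrite -ge0_intZl; last 3 first.
  - by mtac.
  - by move=> E; rewrite mule_ge0// lee_fin invr_ge0.
  - by rewrite lee_fin invr_ge0.
  by apply: eq_integral => E _; rewrite EFinM muleC muleA.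
under eq_integral do rewrite step1.
have -> : (\int[mu]_m1 \int[mu]_m2 ((phi m1 m2)%:E * J (m1 + m2)%R) =
   \int[mu]_m1 \int[mu]_M (J M * (phi m1 (M - m1))%:E))%E.
  apply: eq_integral => m1 _.
  rewrite -(@integral_translate (- m1) (fun m2 => (phi m1 m2)%:E * J (m1 + m2)%R)%E); last 2 first.
  - by mtac; apply: mphi2; mtac.
  - by move=> y; rewrite mule_ge0// lee_fin.
  by apply: eq_integral => M _; rewrite [(m1 + _)%R]addrC subrK muleC.
rewrite ge0_integral_swap; last 2 first.
- by mtac; apply: mphi2; mtac.
- by move=> x y; rewrite mule_ge0// lee_fin.
rewrite -ge0_intZl; last 3 first.
- by rewrite /dens; mtac.
- move=> M; apply: integral_ge0 => P _; apply: integral_ge0 => E _.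
  by rewrite mule_ge0// lee_fin dens_ge0.
- by rewrite lee_fin pi_ge0.
apply: ge0_le_integral_mono => M.
  by apply: integral_ge0 => m _; rewrite mule_ge0// lee_fin.
rewrite ge0_intZl; last 3 first.
- by mtac; apply: mphi2; mtac.
- by move=> m; rewrite lee_fin.
- by [].
apply: (@le_trans _ _ (J M * (pi * (0 < M)%R%:R)%:E)%E).
  by apply: lee_wpmul2l => //; exact: integral_arcsine_le.
rewrite muleC EFinM -muleA lee_wpmul2l ?lee_fin ?pi_ge0// /J -ge0_intZl; last 3 first.
- by mtac.
- by move=> P; apply: integral_ge0 => E _; rewrite mule_ge0// lee_fin invr_ge0.
- by rewrite lee_fin.
apply: ge0_le_integral_mono => P.
  by rewrite mule_ge0 ?lee_fin//; apply: integral_ge0 => E _; rewrite mule_ge0// lee_fin invr_ge0.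
rewrite -ge0_intZl; last 3 first.
- by mtac.
- by move=> E; rewrite mule_ge0// lee_fin invr_ge0.
- by rewrite lee_fin.
apply: ge0_le_integral_mono => E.
  by rewrite mule_ge0 ?lee_fin// mule_ge0// lee_fin invr_ge0.
by rewrite /dens EFinM muleA.
Qed.

(** The convolution of [dens] with a third copy is a bounded function. For fixed b the discriminant
    [D - m * Q b] is affine in m, and its inverse square root integrates to 2 sqrt D / Q b. The
    discriminant of the quadratic Q is again tied to D, so the integral in b is an arctangent of
    total variation 2 pi, whatever [M], [P] and [E] are. *)
Lemma integral_dens_le (M P E : R) :
  (\int[mu]_m \int[mu]_b (ind_pos m * (dens (M - m) (P - m * b) (E - m * b ^+ 2))%:E) <= (2 * pi)%:E)%E.
Proof.
rewrite ge0_integral_swap; last 2 first.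
- by rewrite /dens; mtac1.
- by move=> m b; rewrite mule_ge0 ?ind_pos_ge0// lee_fin dens_ge0.
pose D := M * E - P ^+ 2; pose Q b := E - 2 * P * b + M * b ^+ 2.
have inside m b : (M - m) * (E - m * b ^+ 2) - (P - m * b) ^+ 2 = D - m * Q b by rewrite /D /Q; ring.
have MQ b : M * Q b = (M * b - P) ^+ 2 + D by rewrite /D /Q; ring.
(* Outside the solid cone [0 < M], [0 < D] the integrand is identically 0: a positive discriminant
   with [0 < m < M] would by [MQ] force [0 < D]. *)
have [/andP[M0 D0]|nMD] := boolP ((0 < M) && (0 < D)); last first.
  rewrite integral0_eq ?lee_fin ?mulr_ge0 ?pi_ge0// => b _; rewrite integral0_eq// => m _.
  rewrite /ind_pos; case: (ltP 0 m) => m0; last by rewrite mul0e.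
  rewrite /dens inside; case: (ltP 0 (M - m)) => Mm; last by rewrite mul0r mule0.
  rewrite [X in _ / X]ler0_sqrtr ?invr0 ?mulr0 ?mule0// leNgt; apply/negP => DQ.
  move: nMD; rewrite (_ : 0 < M) /=; last by lra.
  move/negP; apply.
  have := MQ b; have : 0 <= (M * b - P) ^+ 2 by exact: sqr_ge0.
  by nra.
have Q0 b : 0 < Q b.
  by rewrite -(pmulr_rgt0 _ M0) MQ; have : 0 <= (M * b - P) ^+ 2 by [exact: sqr_ge0]; lra.
have sD : 0 < Num.sqrt D by rewrite sqrtr_gt0.
apply: (@le_trans _ _ (\int[mu]_b (2 * Num.sqrt D / Q b)%:E)%E).
  apply: ge0_le_integral_mono => b.
    by apply: integral_ge0 => m _; rewrite mule_ge0 ?ind_pos_ge0// lee_fin dens_ge0.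
  have Qb := Q0 b.
  pose f m := (Num.sqrt (D - m * Q b))^-1; pose F m := - 2 * Num.sqrt (D - m * Q b) / Q b.
  apply: (@le_trans _ _ (\int[mu]_(m in [set m : R | (0 < m < D / Q b)%R]) (f m)%:E)%E).
    rewrite [leRHS]integral_mkcond; apply: ge0_le_integral_mono => m.
      by rewrite mule_ge0 ?ind_pos_ge0// lee_fin dens_ge0.
    rewrite patchE (_ : (m \in _) = (0 < m < D / Q b)); last by apply/idP/idP => [/set_mem//|?]; exact: mem_set.
    rewrite /ind_pos /dens inside; case: (ltP 0 m) => m0/=; last by rewrite mul0e.
    rewrite mul1e ltr_pdivlMr//; case: (ltP (m * Q b) D) => DQ; last first.
      by rewrite [X in _ / X]ler0_sqrtr ?invr0 ?mulr0// subr_le0.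
    by rewrite lee_fin /f ler_piMl ?invr_ge0//; case: ltP.
  rewrite (_ : 2 * Num.sqrt D / Q b = 0 - (- 2 * Num.sqrt D / Q b)); last by ring.
  have pos m : 0 < m < D / Q b -> 0 < D - m * Q b.
    by rewrite ltr_pdivlMr// subr_gt0 => /andP[].
  apply: (@ge0_integral_derive_oo_le _ 0 (D / Q b) F f).
  - move=> m /pos pm; have := is_derive1_sqrt pm => d1.
    apply: is_derive_eq.
    rewrite /GRing.scale/= /f; field; rewrite !lt0r_neq0// sqrtr_gt0//.
  - move=> m /pos pm; apply: continuous_comp; last first.
      by apply: inv_continuous; rewrite lt0r_neq0 ?sqrtr_gt0.
    apply: continuous_comp; last exact: sqrt_continuous.
    apply: cvgB; first exact: cvg_cst.
    by apply: cvgM; [exact: cvg_id|exact: cvg_cst].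
  - by move=> m _; rewrite invr_ge0.
  - move=> m /[dup] /pos pm /andP[m0 _]; rewrite /F; apply/andP; split; last first.
      by rewrite mulNr mulNr oppr_le0 divr_ge0 ?mulr_ge0// ltW.
    rewrite ler_pM2r ?invr_gt0// ler_nM2l ?oppr_lt0// ler_sqrt ?(ltW D0)//.
    by rewrite gerBl mulr_ge0 ?(ltW m0) ?(ltW Qb).
  - by rewrite mulNr mulNr oppr_le0 divr_ge0 ?mulr_ge0// ltW.
pose F b := 2 * atan ((M * b - P) / Num.sqrt D).
rewrite (_ : 2 * pi = pi - (- pi)); last by ring.
apply: (@ge0_integral_derive_T_le _ F).
- move=> b; apply: is_derive_eq.
  rewrite /GRing.scale/=.
  have sD2 : Num.sqrt D ^+ 2 = D by rewrite sqr_sqrtr// ltW.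
  have -> : 1 + ((M * b - P) / Num.sqrt D) ^+ 2 = M * Q b / D.
    by rewrite MQ expr_div_n sD2; field; exact: lt0r_neq0.
  rewrite -[D in X in X^-1]sD2; field; rewrite !lt0r_neq0//.
- move=> b; apply: cvgM; first exact: cvg_cst.
  apply: cvgV; first exact: lt0r_neq0.
  rewrite /Q; apply: cvgD.
    apply: cvgB; first exact: cvg_cst.
    by apply: cvgM; [exact: cvg_cst|exact: cvg_id].
  apply: cvgM; first exact: cvg_cst.
  by apply: exprn_continuous.
- by move=> b; rewrite divr_ge0 ?mulr_ge0// ltW.
- move=> b; rewrite /F.
  have := atan_gtNpi2 ((M * b - P) / Num.sqrt D); have := atan_ltpi2 ((M * b - P) / Num.sqrt D).
  by lra.
Qed.

End cone_convolution.

(** * Triple convolution on the cone *)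
Section cone_triple.
Context (R : realType).
Notation mu := (@lebesgue_measure R).

Definition nrm2 (h : R * R) : R := Num.sqrt (h.1 ^+ 2 + h.2 ^+ 2).

Lemma nrm2_ge0 h : 0 <= nrm2 h. Proof. exact: sqrtr_ge0. Qed.

(** Light-cone parameter on a hyperbola: m = x + sqrt (x^2 + l^2) sweeps the positive half-line, x
    and the square root are (m - l^2 / m) / 2 and (m + l^2 / m) / 2, and dx / sqrt (x^2 + l^2) = dm
    / m. *)
Lemma integral_cone_slice (l : R) (F : R * R * R -> \bar R) : l != 0 ->
  measurable_fun setT F -> (forall q, 0 <= F q)%E ->
  (\int[mu]_x (((nrm2 (x, l))^-1)%:E * F (x, l, nrm2 (x, l))) =
   \int[mu]_m (((0 < m)%R%:R / m)%:E * F ((m - l ^+ 2 / m) / 2, l, (m + l ^+ 2 / m) / 2)%R))%E.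
Proof.
move=> l0 mF F0.
pose g x := (((nrm2 (x, l))^-1)%:E * F (x, l, nrm2 (x, l)))%E.
have l2 : 0 < l ^+ 2 by rewrite exprn_even_gt0.
pose f m := (1 + l ^+ 2 * (m^-1 * m^-1)) / 2.
have sl y : y ^+ 2 < y ^+ 2 + l ^+ 2 by rewrite ltrDl.
have sl0 y : 0 <= y ^+ 2 + l ^+ 2 by rewrite addr_ge0// ?sqr_ge0// ltW.
have G0 y : 0 < y + Num.sqrt (y ^+ 2 + l ^+ 2).
  rewrite -ltrBlDl sub0r; apply: le_lt_trans (ler_norm _) _.
  by rewrite -sqrtr_sqr sqrrN ltr_sqrt// (le_lt_trans _ (sl y))// sqr_ge0.
rewrite -[LHS](@ge0_integral_change _ (fun m : R => 0 < m) (fun m => (m - l ^+ 2 / m) / 2) f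
  (fun y => y + Num.sqrt (y ^+ 2 + l ^+ 2)) g).
- apply: eq_integral => m _; case: (ltP 0 m) => m0; last by rewrite !mul0r mule0 mul0e.
  have E : nrm2 ((m - l ^+ 2 / m) / 2, l) = (m + l ^+ 2 / m) / 2.
    rewrite /nrm2/= (_ : _ + _ = ((m + l ^+ 2 / m) / 2) ^+ 2); last by field; exact: lt0r_neq0.
    by rewrite sqrtr_sqr ger0_norm// divr_ge0// addr_ge0 ?divr_ge0 ?(ltW m0) ?(ltW l2).
  rewrite /g E muleAC -EFinM; congr (_%:E * _)%E; rewrite /f.
  field; rewrite (lt0r_neq0 m0) ?andbT ?andTb; apply: lt0r_neq0; have := l2; have := m0; nra.
- by mtac.
- by mtac.
- by rewrite /f; mtac.
- by move=> x x0; rewrite /f divr_ge0// addr_ge0// mulr_ge0 ?(ltW l2)// mulr_ge0 ?invr_ge0 ?(ltW x0).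
- by move=> x y z x0 z0 /andP[xy _]; exact: lt_le_trans xy.
- by [].
- move=> y; have := G0 y; set G := y + _ => Gp.
  have GE : G ^+ 2 = l ^+ 2 + 2 * y * G.
    by rewrite /G sqrrD sqr_sqrtr//; ring.
  apply: (mulIf (lt0r_neq0 Gp)); apply: (mulIf (lt0r_neq0 (ltr0n _ 2 : 0 < 2 :> R))).
  rewrite (_ : _ * _ * _ = G ^+ 2 - l ^+ 2); last by field; exact: lt0r_neq0.
  by rewrite GE; ring.
- move=> x y x0 y0 xy; rewrite ltr_pM2r ?invr_gt0//; apply: ltr_leB => //.
  by rewrite ler_pM2l// lef_pV2// ltW.
- move=> x x0; have xn0 : x != 0 by exact: lt0r_neq0.
  have dV := @is_deriveV _ (@id R) x 1 1 xn0 (is_derive_id _ _).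
  have {}dV : is_derive x 1 (fun m : R => m^-1) (- x ^- 2 *: 1) by exact: dV.
  apply: is_derive_eq; rewrite /GRing.scale/= /f; field; exact: xn0.
- move=> x x0; have xn0 : x != 0 by exact: lt0r_neq0.
  apply: cvgM; last exact: cvg_cst.
  apply: cvgD; first exact: cvg_cst.
  by apply: cvgM; [exact: cvg_cst|apply: cvgM; exact: inv_continuous].
- by rewrite /g /nrm2; mtac.
- by move=> y; rewrite /g mule_ge0// lee_fin invr_ge0 nrm2_ge0.
Qed.

(* The cone l1^2 + l2^2 = l3^2 becomes a cone over a parabola in the light-cone coordinates l3 + l1 = m, l2 = m b, l3 - l1 = m b^2, and dl1 dl2 / |l| becomes dm db. *)
Lemma integral_cone (F : R * R * R -> \bar R) :
  measurable_fun setT F -> (forall q, 0 <= F q)%E ->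
  (\int[lebR2]_h (((nrm2 h)^-1)%:E * F (h.1, h.2, nrm2 h)) =
   \int[mu]_m \int[mu]_b (ind_pos m * F ((m - m * b ^+ 2) / 2, m * b, (m + m * b ^+ 2) / 2)%R))%E.
Proof.
move=> mF F0; rewrite ge0_integral_tensor_swap; last 2 first.
- by rewrite /nrm2; mtac.
- by move=> h; rewrite mule_ge0// lee_fin invr_ge0 nrm2_ge0.
transitivity (\int[mu]_l \int[mu]_m (((0 < m)%R%:R / m)%:E * F ((m - l ^+ 2 / m) / 2, l, (m + l ^+ 2 / m) / 2)%R))%E.
  have p0 (m : R) : (0 <= ((0 < m)%R%:R / m)%:E)%E.
    by case: (ltP 0 m) => m0; rewrite lee_fin ?mul0r// divr_ge0// ltW.
  apply: ge0_ae_eq_integral.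
  - by [].
  - by rewrite /nrm2/=; mtac.
  - by mtac.
  - by move=> l _; apply: integral_ge0 => x _; rewrite mule_ge0// lee_fin invr_ge0 nrm2_ge0.
  - by move=> l _; apply: integral_ge0 => x _; rewrite mule_ge0.
  (* The hyperbola degenerates for l = 0; this single slice is null. *)
  - have [N [mN N0 subN]] := @ae_neq R 0.
    exists N; split => // l /= nl; apply: subN => /= l0; apply: nl => _; exact: integral_cone_slice.
rewrite ge0_integral_swap; last 2 first.
- by mtac.
- move=> l m; rewrite mule_ge0//.
  by case: (ltP 0 m) => m0; rewrite lee_fin ?mul0r// divr_ge0// ltW.
apply: eq_integral => m _; rewrite /ind_pos; case: (ltP 0 m) => m0; last first.
  rewrite !integral0_eq// => b _; first by rewrite mul0e.
  by rewrite mul0r mul0e.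
pose h l := F ((m - l ^+ 2 / m) / 2, l, (m + l ^+ 2 / m) / 2).
have mh : measurable_fun setT h by rewrite /h; mtac.
rewrite mul1r; transitivity ((`|m|^-1)%:E * \int[mu]_l h l)%E.
  rewrite gtr0_norm// -ge0_intZl; last 3 first.
  - exact: mh.
  - by move=> l; exact: F0.
  - by rewrite lee_fin invr_ge0 ltW.
  by [].
rewrite -(integral_affine 0 (lt0r_neq0 m0) mh); last by move=> l; exact: F0.
apply: eq_integral => b _; rewrite /h mul1e addr0.
by congr (F (_, _, _)); field; exact: lt0r_neq0.
Qed.

Lemma integral_leb3_translate (a b c : R) (f : R * R * R -> \bar R) :
  measurable_fun setT f -> (forall q, 0 <= f q)%E ->
  (\int[lebR3]_q f (q.1.1 + a, q.1.2 + b, q.2 + c)%R = \int[lebR3]_q f q)%E.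
Proof.
move=> mf f0; rewrite !ge0_integral_leb3; last 4 first.
- by [].
- by [].
- by mtac.
- by [].
have mf1 : measurable_fun setT (fun x => \int[mu]_y \int[mu]_z f (x, y, z))%E by mtac.
have f10 x : (0 <= \int[mu]_y \int[mu]_z f (x, y, z))%E.
  by apply: integral_ge0 => y _; apply: integral_ge0.
rewrite -[RHS](integral_translate a mf1 f10); apply: eq_integral => x _ /=.
have mf2 : measurable_fun setT (fun y => \int[mu]_z f ((x + a)%R, y, z))%E by mtac.
have f20 y : (0 <= \int[mu]_z f ((x + a)%R, y, z))%E by apply: integral_ge0.
rewrite -[RHS](integral_translate b mf2 f20); apply: eq_integral => y _ /=.
have mf3 : measurable_fun setT (fun z => f ((x + a)%R, (y + b)%R, z))%E by mtac.
by rewrite -[RHS](integral_translate c mf3).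
Qed.

(** The 2 is the inverse of the Jacobian of the map from (m, e) to ((m - e) / 2, (m + e) / 2). *)
Lemma integral_leb3_lightcone (K : R * R * R -> \bar R) :
  measurable_fun setT K -> (forall q, 0 <= K q)%E ->
  (\int[lebR3]_q K ((q.1.1 - q.2) / 2, q.1.2, (q.1.1 + q.2) / 2)%R = 2%:E * \int[lebR3]_q K q)%E.
Proof.
move=> mK K0; rewrite !ge0_integral_leb3; last 4 first.
- by [].
- by [].
- by mtac.
- by [].
rewrite ge0_integral_swap; last 2 first.
- by mtac.
- by move=> x y; apply: integral_ge0.
rewrite [X in (_ = _ * X)%E]ge0_integral_swap; last 2 first.
- by mtac.
- by move=> x y; apply: integral_ge0.
rewrite -ge0_intZl; last 3 first.
- by mtac.
- by move=> x; apply: integral_ge0 => y _; apply: integral_ge0.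
- by rewrite lee_fin.
apply: eq_integral => p _ /=.
transitivity (\int[mu]_m \int[mu]_u (2%:E * K (u, p, m - u)%R))%E.
  apply: eq_integral => m _.
  pose h e := K ((m - e) / 2, p, (m + e) / 2).
  have mh : measurable_fun setT h by rewrite /h; mtac.
  have n2 : (- 2 : R) != 0 by rewrite oppr_eq0.
  have := @integral_affine _ (- 2) m h n2 mh (fun=> K0 _).
  rewrite normrN gtr0_norm// => H.
  rewrite ge0_intZl; last 3 first.
  - by mtac.
  - by [].
  - by rewrite lee_fin.
  transitivity (2%:E * \int[mu]_x h (- 2 * x + m)%R)%E.
    by rewrite H muleA -EFinM divff ?mul1e//.
  congr (_ * _)%E; apply: eq_integral => u _; by rewrite /h; congr (K (_, _, _)); field.
rewrite ge0_integral_swap; last 2 first.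
- by mtac.
- by move=> x y; rewrite mule_ge0// lee_fin.
rewrite -ge0_intZl; last 3 first.
- by mtac.
- by move=> x; apply: integral_ge0.
- by rewrite lee_fin.
apply: eq_integral => u _; rewrite ge0_intZl; last 3 first.
- by mtac.
- by [].
- by rewrite lee_fin.
congr (_ * _)%E.
have mg : measurable_fun setT (fun s => K (u, p, s)) by mtac.
by rewrite -[RHS](integral_translate (- u) mg).
Qed.

(** The second and third factors convolve to at most [pi] times [dens], translated by the first.
    After exchanging integrals, the first variable meets only this density, at the cost of the 2 pi
    of [integral_dens_le] for every point q. *)
Lemma parabola_triple_bound (K : R * R * R -> \bar R) :
  measurable_fun setT K -> (forall q, 0 <= K q)%E ->
  (\int[mu]_m1 \int[mu]_b1 (ind_pos m1 *
     \int[mu]_m2 \int[mu]_b2 \int[mu]_m3 \int[mu]_b3 (((0 < m2) && (0 < m3))%R%:R%:E *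
     K (m1 + (m2 + m3), m1 * b1 + (m2 * b2 + m3 * b3), m1 * b1 ^+ 2 + (m2 * b2 ^+ 2 + m3 * b3 ^+ 2))%R)) <=
   (2 * pi ^+ 2)%:E * \int[lebR3]_q K q)%E.
Proof.
move=> mK K0.
pose A m b : \bar R := (\int[lebR3]_q ((dens (q.1.1 - m) (q.1.2 - m * b) (q.2 - m * b ^+ 2))%:E * K q))%E.
have A0 m b : (0 <= A m b)%E by apply: integral_ge0 => q _; rewrite mule_ge0// lee_fin dens_ge0.
have mA : measurable_fun setT (fun p : R * R => A p.1 p.2) by rewrite /A /dens; mtac.
apply: (@le_trans _ _ (\int[mu]_m1 \int[mu]_b1 (pi%:E * (ind_pos m1 * A m1 b1)))%E).
  apply: ge0_le_integral_mono => m1.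
    apply: integral_ge0 => b1 _; rewrite mule_ge0 ?ind_pos_ge0//.
    do 4 (apply: integral_ge0 => ? _); by rewrite mule_ge0// lee_fin.
  apply: ge0_le_integral_mono => b1.
    rewrite mule_ge0 ?ind_pos_ge0//.
    do 4 (apply: integral_ge0 => ? _); by rewrite mule_ge0// lee_fin.
  rewrite muleCA lee_wpmul2l ?ind_pos_ge0//.
  pose K1 (q : R * R * R) := K (m1 + q.1.1, m1 * b1 + q.1.2, m1 * b1 ^+ 2 + q.2).
  have mK1 : measurable_fun setT K1 by rewrite /K1; mtac.
  apply: le_trans (@pair_parabola_bound _ K1 mK1 _) _; first by move=> q; exact: K0.
  rewrite lee_wpmul2l ?lee_fin ?pi_ge0//.
  have -> : (\int[mu]_M \int[mu]_P \int[mu]_E ((dens M P E)%:E * K1 (M, P, E)) =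
     \int[lebR3]_q ((dens q.1.1 q.1.2 q.2)%:E * K1 q))%E.
    rewrite ge0_integral_leb3; last 2 first.
    - by rewrite /dens; mtac.
    - by move=> q; rewrite mule_ge0 ?lee_fin ?dens_ge0//; exact: K0.
    by [].
  rewrite /A -(@integral_leb3_translate m1 (m1 * b1) (m1 * b1 ^+ 2)
    (fun q => (dens (q.1.1 - m1) (q.1.2 - m1 * b1) (q.2 - m1 * b1 ^+ 2))%:E * K q)%E); last 2 first.
  - by rewrite /dens; mtac.
  - by move=> q; rewrite mule_ge0// lee_fin dens_ge0.
  apply: ge0_le_integral_mono => q; first by rewrite mule_ge0 ?lee_fin ?dens_ge0//; exact: K0.
  by rewrite /= !addrK /K1 [m1 + _]addrC [m1 * b1 + _]addrC [m1 * b1 ^+ 2 + _]addrC.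
have -> : (\int[mu]_m1 \int[mu]_b1 (pi%:E * (ind_pos m1 * A m1 b1)) =
   pi%:E * \int[lebR2]_z (ind_pos z.1 * A z.1 z.2))%E.
  rewrite -ge0_intZl; last 3 first.
  - by mtac1.
  - by move=> z; rewrite mule_ge0// ind_pos_ge0.
  - by rewrite lee_fin pi_ge0.
  rewrite ge0_integral_leb2; last 2 first.
  - by mtac1.
  - by move=> z; rewrite mule_ge0 ?lee_fin ?pi_ge0// mule_ge0// ind_pos_ge0.
  by [].
have -> : (\int[lebR2]_z (ind_pos z.1 * A z.1 z.2) = \int[lebR2]_z \int[lebR3]_q
    (K q * (ind_pos z.1 * (dens (q.1.1 - z.1) (q.1.2 - z.1 * z.2) (q.2 - z.1 * z.2 ^+ 2))%:E)))%E.
  apply: eq_integral => z _; rewrite /A -ge0_intZl; last 3 first.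
  - by rewrite /dens; mtac.
  - by move=> q; rewrite mule_ge0// lee_fin dens_ge0.
  - exact: ind_pos_ge0.
  by apply: eq_integral => q _; rewrite muleA muleC.
rewrite ge0_integral_swap; last 2 first.
- by rewrite /dens; mtac1.
- by move=> z q; rewrite mule_ge0// mule_ge0 ?ind_pos_ge0// lee_fin dens_ge0.
rewrite (_ : 2 * pi ^+ 2 = pi * (2 * pi)); last by ring.
rewrite EFinM -muleA lee_wpmul2l ?lee_fin ?pi_ge0//.
rewrite -ge0_intZl; last 3 first.
- exact: mK.
- by [].
- by rewrite lee_fin mulr_ge0// pi_ge0.
apply: ge0_le_integral_mono => q.
  by apply: integral_ge0 => z _; rewrite mule_ge0// mule_ge0 ?ind_pos_ge0// lee_fin dens_ge0.
rewrite ge0_intZl; last 3 first.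
- by rewrite /dens; mtac1.
- by move=> z; rewrite mule_ge0 ?ind_pos_ge0// lee_fin dens_ge0.
- by [].
rewrite muleC lee_wpmul2r// ge0_integral_leb2; last 2 first.
- by rewrite /dens; mtac1.
- by move=> z; rewrite mule_ge0 ?ind_pos_ge0// lee_fin dens_ge0.
exact: integral_dens_le.
Qed.

(** Testing against an arbitrary [K] expresses that the triple convolution is a function bounded by
    4 pi^2. The constant is the 2 pi^2 of the parabola times the 2 of the light-cone Jacobian; [K']
    is [K] read in light-cone coordinates. *)
Lemma cone_triple_bound (K : R * R * R -> \bar R) :
  measurable_fun setT K -> (forall q, 0 <= K q)%E ->
  (\int[lebR2]_h1 (((nrm2 h1)^-1)%:E * \int[lebR2]_h2 (((nrm2 h2)^-1)%:E * \int[lebR2]_h3 (((nrm2 h3)^-1)%:E *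
     K (h1.1 + (h2.1 + h3.1), h1.2 + (h2.2 + h3.2), nrm2 h1 + (nrm2 h2 + nrm2 h3))%R))) <=
   (4 * pi ^+ 2)%:E * \int[lebR3]_q K q)%E.
Proof.
move=> mK K0.
pose X (m b : R) := (m - m * b ^+ 2) / 2; pose Z (m b : R) := (m + m * b ^+ 2) / 2.
pose F3 (p1 p2 p3 : R * R * R) := K (p1.1.1 + (p2.1.1 + p3.1.1), p1.1.2 + (p2.1.2 + p3.1.2), p1.2 + (p2.2 + p3.2)).
pose F2 p1 p2 := (\int[mu]_m3 \int[mu]_b3 (ind_pos m3 * F3 p1 p2 (X m3 b3, m3 * b3, Z m3 b3)%R))%E.
pose F1 p1 := (\int[mu]_m2 \int[mu]_b2 (ind_pos m2 * F2 p1 (X m2 b2, m2 * b2, Z m2 b2)%R))%E.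
have i0 := @ind_pos_ge0 R.
have F20 p1 p2 : (0 <= F2 p1 p2)%E.
  by do 2 (apply: integral_ge0 => ? _); rewrite mule_ge0//; exact: K0.
have F10 p1 : (0 <= F1 p1)%E by do 2 (apply: integral_ge0 => ? _); rewrite mule_ge0.
have mF2 p1 : measurable_fun setT (F2 p1) by rewrite /F2 /F3 /X /Z/=; mtac1.
have mF1 : measurable_fun setT F1 by rewrite /F1 /F2 /F3 /X /Z/=; mtac1.
have E : (\int[lebR2]_h1 (((nrm2 h1)^-1)%:E * \int[lebR2]_h2 (((nrm2 h2)^-1)%:E * \int[lebR2]_h3 (((nrm2 h3)^-1)%:E *
     K (h1.1 + (h2.1 + h3.1), h1.2 + (h2.2 + h3.2), nrm2 h1 + (nrm2 h2 + nrm2 h3))%R))) =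
   \int[mu]_m1 \int[mu]_b1 (ind_pos m1 * F1 (X m1 b1, m1 * b1, Z m1 b1)%R))%E.
  have mF3 p1 p2 : measurable_fun setT (F3 p1 p2) by rewrite /F3; mtac.
  have F30 p1 p2 q : (0 <= F3 p1 p2 q)%E by exact: K0.
  rewrite -(integral_cone mF1 F10); apply: eq_integral => h1 _; congr (_ * _)%E.
  rewrite /F1 -(integral_cone (mF2 _) (F20 _)); apply: eq_integral => h2 _; congr (_ * _)%E.
  by rewrite /F2 -(integral_cone (mF3 _ _) (F30 _ _)).
rewrite E.
pose K' (q : R * R * R) := K ((q.1.1 - q.2) / 2, q.1.2, (q.1.1 + q.2) / 2).
have mK' : measurable_fun setT K' by rewrite /K'; mtac.
have K'0 q : (0 <= K' q)%E by exact: K0.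
have := parabola_triple_bound mK' K'0.
rewrite integral_leb3_lightcone; last 2 first.
- exact: mK.
- exact: K0.
rewrite muleA -EFinM (_ : 2 * pi ^+ 2 * 2 = 4 * pi ^+ 2); last by ring.
apply: le_trans; apply: ge0_le_integral_mono => m1.
  by apply: integral_ge0 => b1 _; rewrite mule_ge0.
apply: ge0_le_integral_mono => b1; first by rewrite mule_ge0.
rewrite lee_wpmul2l// /F1; apply: ge0_le_integral_mono => m2.
  by apply: integral_ge0 => b2 _; rewrite mule_ge0.
apply: ge0_le_integral_mono => b2; first by rewrite mule_ge0.
rewrite /F2 -ge0_intZl; last 3 first.
- by rewrite /F3 /X /Z/=; mtac1.
- by move=> m3; apply: integral_ge0 => b3 _; rewrite mule_ge0//; exact: K0.
- by [].
apply: ge0_le_integral_mono => m3.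
  by rewrite mule_ge0//; apply: integral_ge0 => b3 _; rewrite mule_ge0//; exact: K0.
rewrite -ge0_intZl; last 3 first.
- by rewrite /F3 /X /Z/=; mtac1.
- by move=> b3; rewrite mule_ge0//; exact: K0.
- by [].
apply: ge0_le_integral_mono => b3; first by rewrite mule_ge0// mule_ge0//; exact: K0.
rewrite muleA /ind_pos -EFinM -natrM mulnb /F3 /K' /X /Z/=.
by rewrite le_eqVlt; apply/orP; left; apply/eqP; congr (_ * K (_, _, _))%E; field.
Qed.

End cone_triple.

(** * Plancherel bounds *)
Section poisson.
Context (R : realType).
Notation mu := (@lebesgue_measure R).

(** A damping and its cosine transform, which is 2 pi times the Poisson kernel. The Schur test uses
    the positivity and the total mass of the latter. *)
Definition expd (d x : R) : R := expR (- d * `|x|).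
Definition pker (d v : R) : R := 2 * d / (d ^+ 2 + v ^+ 2).

Lemma expd_ge0 d x : 0 <= expd d x. Proof. exact: expR_ge0. Qed.

Lemma pker_ge0 d v : 0 <= d -> 0 <= pker d v.
Proof. by move=> d0; rewrite /pker divr_ge0 ?mulr_ge0 ?addr_ge0 ?sqr_ge0. Qed.

Lemma integral_symmetrize (p : R -> R) : measurable_fun setT p -> (forall x, 0 <= p x) ->
  (\int[mu]_x (p x)%:E = \int[mu]_(x in `[0%R, +oo[) (p x + p (- x))%:E)%E.
Proof.
move=> mp p0.
pose q x : \bar R := ((0 < x)%R%:R * p x)%:E; pose q' x : \bar R := ((x < 0)%R%:R * p x)%:E.
have mq : measurable_fun setT q by rewrite /q; mtac.
have mq' : measurable_fun setT q' by rewrite /q'; mtac.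
have q0 x : (0 <= q x)%E by rewrite lee_fin mulr_ge0.
have q'0 x : (0 <= q' x)%E by rewrite lee_fin mulr_ge0.
transitivity (\int[mu]_x (q x + q' x))%E.
  apply: ge0_ae_eq_integral => //.
  - by mtac.
  - by apply: emeasurable_funD; mtac.
  - by move=> x _; rewrite lee_fin.
  - by move=> x _; rewrite adde_ge0.
  - have [N [mN N0 subN]] := @ae_neq R 0.
    exists N; split => // v /= nv; apply: subN => /= v0; apply: nv => _.
    by rewrite /q /q' -EFinD; case: (ltgtP 0 v) v0 => //= _ _; rewrite !mul1r !mul0r ?addr0 ?add0r.
rewrite ge0_integralD//.
rewrite -(integral_reflect 0 mq' q'0) -ge0_integralD//; last first.
  by rewrite /q'; mtac.
rewrite -integral_itv_obnd_cbnd; last by apply: measurable_funTS; mtac.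
rewrite [RHS]integral_mkcond; apply: eq_integral => x _; rewrite patchE mem_setE in_itv/= andbT.
rewrite /q /q' sub0r oppr_lt0 -EFinD; case: ifP => _; last by rewrite !mul0r addr0.
by rewrite !mul1r.
Qed.

Lemma cvg_expRN (d : R) : 0 < d -> expR (- d * x) @[x --> +oo] --> (0 : R).
Proof.
move=> d0; apply/cvgrPdist_le => e e0; near=> x.
have x0 : 0 < x by near: x; exact: nbhs_pinfty_gt.
rewrite sub0r normrN ger0_norm ?expR_ge0// mulNr expRN -[leRHS]invrK.
rewrite lef_pV2 ?posrE ?expR_gt0 ?invr_gt0//.
apply: le_trans (ltW (expR_gt1Dx _)); last by rewrite lt0r_neq0// mulr_gt0.
have : e^-1 / d < x by near: x; apply: nbhs_pinfty_gt; exact: num_real.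
by rewrite ltr_pdivrMr// mulrC => /ltW H; rewrite (le_trans H)// lerDr.
Unshelve. all: by end_near. Qed.

(* Adding 1 makes the integrand nonnegative, as the fundamental theorem of calculus on a half-line requires. *)
Lemma integral_expd_cos_ge0 (d v c s : R) : 0 < d -> 0 <= s <= 1 ->
  (\int[mu]_x (expd d x * (1 + s * cos (v * x + c)))%:E = (2 / d + s * cos c * pker d v)%:E)%E.
Proof.
move=> d0 /andP[s0 s1].
have D0 : 0 < d ^+ 2 + v ^+ 2 by rewrite ltr_wpDr ?sqr_ge0// exprn_gt0.
have bnd y : 0 <= 1 + s * cos y.
  have /andP[c1 _] : -1 <= cos y <= 1 by rewrite cos_geN1 cos_le1.
  have : - s <= s * cos y by rewrite -mulrN1 ler_wpM2l.
  by lra.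
rewrite integral_symmetrize; last 2 first.
- by rewrite /expd; mtac.
- by move=> x; rewrite mulr_ge0 ?expd_ge0.
(* Folding at 0 removes the absolute value: cos (v x + c) + cos (c - v x) = 2 cos c cos (v x). [F]
   is an explicit primitive of [f] that tends to 0 at infinity. *)
pose f x := expR (- d * x) * (2 + 2 * s * cos c * cos (v * x)).
pose F x := expR (- d * x) * (- 2 / d + 2 * s * cos c / (d ^+ 2 + v ^+ 2) * (- d * cos (v * x) + v * sin (v * x))).
have -> : (\int[mu]_(x in `[0%R, +oo[) (expd d x * (1 + s * cos (v * x + c)) + expd d (- x) * (1 + s * cos (v * - x + c)))%:E =
  \int[mu]_(x in `[0%R, +oo[) (f x)%:E)%E.
  apply: eq_integral => x; rewrite inE/= in_itv/= andbT => x0; congr EFin.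
  rewrite /expd normrN ger0_norm// /f mulrN !cosD cosN sinN; ring.
have dF (x : R) : is_derive x 1 F (f x).
  apply: is_derive_eq; rewrite /GRing.scale/= /f; field.
  by rewrite (lt0r_neq0 D0) lt0r_neq0.
have cf : continuous f.
  move=> x; apply: cvgM.
    apply: continuous_comp; last exact: continuous_expR.
    by apply: cvgM; [exact: cvg_cst|exact: cvg_id].
  apply: cvgD; first exact: cvg_cst.
  apply: cvgM; first exact: cvg_cst.
  apply: continuous_comp; last exact: continuous_cos.
  by apply: cvgM; [exact: cvg_cst|exact: cvg_id].
rewrite (@ge0_continuous_FTC2y _ f F 0 0).
- rewrite -EFinB; congr EFin; rewrite /F !mulr0 expR0 cos0 sin0 /pker; field.
  by rewrite (lt0r_neq0 D0) lt0r_neq0.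
- move=> x _; rewrite /f mulr_ge0 ?expR_ge0//.
  have /andP[c1 c2] : -1 <= cos c <= 1 by rewrite cos_geN1 cos_le1.
  have /andP[c3 c4] : -1 <= cos (v * x) <= 1 by rewrite cos_geN1 cos_le1.
  have : `|s * cos c * cos (v * x)| <= 1.
    rewrite !normrM mulr_ile1 ?mulr_ge0 ?mulr_ile1// ?ler_norml ?cos_geN1 ?cos_le1//.
    by rewrite s1 andbT; lra.
  by rewrite ler_norml => /andP[H _]; lra.
- by apply: continuous_subspaceT.
- rewrite -[X in _ --> X](mul0r (2 / d + `|2 * s * cos c / (d ^+ 2 + v ^+ 2)| * (d + `|v|))).
  apply/cvgrPdist_le => e e0.
  pose C := 2 / d + `|2 * s * cos c / (d ^+ 2 + v ^+ 2)| * (d + `|v|).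
  have C0 : 0 < C by rewrite /C ltr_pwDl ?divr_gt0// mulr_ge0// addr_ge0// ltW.
  have FC x : `|F x| <= expR (- d * x) * C.
    rewrite /F normrM ger0_norm ?expR_ge0// ler_wpM2l ?expR_ge0//.
    rewrite (le_trans (ler_normD _ _))// /C mulNr normrN gtr0_norm ?divr_gt0// lerD2l normrM ler_wpM2l//.
    rewrite (le_trans (ler_normD _ _))// !normrM normrN (gtr0_norm d0); apply: lerD.
      by rewrite ler_piMr ?(ltW d0)// ler_norml cos_geN1 cos_le1.
    by rewrite ler_piMr// ler_norml sin_geN1 sin_le1.
  have := cvg_expRN d0 => /cvgrPdist_le /(_ (e / C)).
  rewrite divr_gt0// => /(_ isT); apply: filterS => x.
  rewrite mul0r !sub0r !normrN ger0_norm ?expR_ge0// ler_pdivlMr//; exact: le_trans (FC x).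
- by move=> x _; case: (dF x).
- apply: cvg_at_right_filter; have [dF0 _] := dF 0.
  by move/derivable1_diffP/differentiable_continuous : dF0.
- by move=> x _; rewrite derive1E; case: (dF x).
Qed.

Lemma integrable_expd (d : R) : 0 < d -> mu.-integrable setT (EFin \o expd d).
Proof.
move=> d0; apply/integrableP; split; first by rewrite /comp /expd; mtac.
rewrite [X in (X < _)%E](_ : _ = \int[mu]_x (expd d x * (1 + 0 * cos (0 * x + 0)))%:E)%E; last first.
  by apply: eq_integral => x _; rewrite /= ger0_norm ?expd_ge0// mul0r addr0 mulr1.
by rewrite integral_expd_cos_ge0 ?lexx ?ler01// ltry.
Qed.

Lemma integrable_expd_cos (d : R) (p : R -> R) : 0 < d -> measurable_fun setT p ->
  mu.-integrable setT (EFin \o (fun x => expd d x * cos (p x))).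
Proof.
move=> d0 mp; apply: (le_integrable measurableT _ _ (integrable_expd d0)) => /=.
  by rewrite /expd; mtac.
move=> x _; rewrite lee_fin normrM ler_piMr// ler_norml cos_geN1 cos_le1//.
Qed.

(** The instances s = 1 and s = 0 of [integral_expd_cos_ge0] differ by this integral. The phase
    constant [c] later carries the variables not yet integrated. *)
Lemma Rintegral_expd_cos (d v c : R) : 0 < d ->
  \int[mu]_x (expd d x * cos (v * x + c)) = cos c * pker d v.
Proof.
move=> d0.
have i1 := integrable_expd d0.
have i2 : mu.-integrable setT (EFin \o (fun x => expd d x * cos (v * x + c))).
  by apply: integrable_expd_cos => //; mtac.
have H0 : \int[mu]_x (expd d x) = 2 / d.
  rewrite /Rintegral (_ : (\int[mu]_x (expd d x)%:E = (2 / d)%:E)%E)//.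
  transitivity (\int[mu]_x (expd d x * (1 + 0 * cos (0 * x + 0)))%:E)%E.
    by apply: eq_integral => x _; rewrite mul0r addr0 mulr1.
  by rewrite integral_expd_cos_ge0 ?lexx ?ler01// !mul0r addr0.
have H1 : \int[mu]_x (expd d x + expd d x * cos (v * x + c)) = 2 / d + cos c * pker d v.
  rewrite /Rintegral (_ : (\int[mu]_x (expd d x + expd d x * cos (v * x + c))%:E = (2 / d + cos c * pker d v)%:E)%E)//.
  transitivity (\int[mu]_x (expd d x * (1 + 1 * cos (v * x + c)))%:E)%E.
    by apply: eq_integral => x _; congr EFin; ring.
  by rewrite integral_expd_cos_ge0 ?lexx ?ler01// mul1r.
move: H1; rewrite RintegralD// H0 => /addrI; exact.
Qed.

Lemma Rintegral_tensor_iter d1 d2 (Y1 : measurableType d1) (Y2 : measurableType d2)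
   (m1 : {sigma_finite_measure set Y1 -> \bar R}) (m2 : {sigma_finite_measure set Y2 -> \bar R}) (f : Y1 * Y2 -> R) :
  (tensor m1 m2).-integrable setT (EFin \o f) ->
  (forall x, m2.-integrable setT (EFin \o (fun y => f (x, y)))) ->
  \int[tensor m1 m2]_z f z = \int[m1]_x \int[m2]_y f (x, y).
Proof.
move=> intf intfx; rewrite /Rintegral (integral_tensor intf); congr fine.
apply: eq_integral => x _; have H := integrable_fin_num measurableT (intfx x).
by rewrite /= fineK//; exact: H.
Qed.

Definition expd3 (d : R) (x : R * R * R) : R := expd d x.1.1 * expd d x.1.2 * expd d x.2.

Lemma integrable_expd3 (d : R) : 0 < d -> lebR3.-integrable setT (EFin \o expd3 d).
Proof.
move=> d0; have i1 := integrable_expd d0.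
exact: (integrable_tensor (integrable_tensor i1 i1) i1).
Qed.

(** One variable at a time: the phase in the remaining variables takes the place of [c] in the
    one-dimensional formula, which returns its cosine times a Poisson factor. *)
Lemma Rintegral_expd3_cos (d v1 v2 v3 : R) : 0 < d ->
  \int[lebR3]_x (expd3 d x * cos (v1 * x.1.1 + v2 * x.1.2 + v3 * x.2)) =
  pker d v1 * pker d v2 * pker d v3.
Proof.
move=> d0; have i1 := integrable_expd d0; have i3 := integrable_expd3 d0.
have bcos (y : R) : `|cos y| <= 1 by rewrite ler_norml cos_geN1 cos_le1.
rewrite /lebR3 Rintegral_tensor_iter; last 2 first.
- apply: (le_integrable measurableT _ _ i3) => /=; first by rewrite /expd3 /expd; mtac.
  by move=> x _; rewrite lee_fin normrM ler_piMr.
- move=> x; have -> : (fun y => expd3 d (x, y) * cos (v1 * (x, y).1.1 + v2 * (x, y).1.2 + v3 * (x, y).2)) =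
     (fun y => expd d x.1 * expd d x.2 * (expd d y * cos (v3 * y + (v1 * x.1 + v2 * x.2)))).
    by apply/funext => y; rewrite /expd3/= addrC; ring.
  have := integrableZl measurableT (expd d x.1 * expd d x.2) (integrable_expd_cos (p := fun y => v3 * y + (v1 * x.1 + v2 * x.2)) d0 _).
  by apply; mtac.
have -> : \int[lebR2]_x \int[mu]_y (expd3 d (x, y) * cos (v1 * (x, y).1.1 + v2 * (x, y).1.2 + v3 * (x, y).2)) =
   \int[lebR2]_x (pker d v3 * ((expd d x.1 * expd d x.2) * cos (v1 * x.1 + v2 * x.2))).
  apply: eq_Rintegral => x _.
  transitivity (\int[mu]_y (expd d x.1 * expd d x.2 * (expd d y * cos (v3 * y + (v1 * x.1 + v2 * x.2))))).
    by apply: eq_Rintegral => y _; rewrite /expd3/= addrC; ring.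
  rewrite RintegralZl//; last by apply: integrable_expd_cos => //; mtac.
  by rewrite Rintegral_expd_cos//; ring.
have i2 : lebR2.-integrable setT (EFin \o (fun x : R * R => (expd d x.1 * expd d x.2) * cos (v1 * x.1 + v2 * x.2))).
  apply: (le_integrable measurableT _ _ (integrable_tensor i1 i1)) => /=; first by rewrite /expd; mtac.
  by move=> x _; rewrite lee_fin normrM ler_piMr.
rewrite RintegralZl// Rintegral_tensor_iter; last 2 first.
- exact: i2.
- move=> x; have -> : (fun y => expd d (x, y).1 * expd d (x, y).2 * cos (v1 * (x, y).1 + v2 * (x, y).2)) =
     (fun y => expd d x * (expd d y * cos (v2 * y + v1 * x))).
    by apply/funext => y; rewrite /= addrC; ring.
  have := integrableZl measurableT (expd d x) (integrable_expd_cos (p := fun y => v2 * y + v1 * x) d0 _).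
  by apply; mtac.
have -> : \int[mu]_x \int[mu]_y (expd d (x, y).1 * expd d (x, y).2 * cos (v1 * (x, y).1 + v2 * (x, y).2)) =
   \int[mu]_x (pker d v2 * (expd d x * cos (v1 * x + 0))).
  apply: eq_Rintegral => x _.
  transitivity (\int[mu]_y (expd d x * (expd d y * cos (v2 * y + v1 * x)))).
    by apply: eq_Rintegral => y _; rewrite /= addrC; ring.
  rewrite RintegralZl//; last by apply: integrable_expd_cos => //; mtac.
  by rewrite Rintegral_expd_cos// addr0; ring.
rewrite RintegralZl//; last by apply: integrable_expd_cos => //; mtac.
by rewrite Rintegral_expd_cos// cos0; ring.
Qed.

Definition del (n : nat) : R := n.+1%:R^-1.

Lemma del_gt0 n : 0 < del n. Proof. by rewrite invr_gt0. Qed.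

Lemma cvg_expd x : expd (del n) x @[n --> \oo] --> (1 : R).
Proof.
rewrite -expR0; apply: continuous_cvg; first exact: continuous_expR.
suff : (- del n * `|x|) @[n --> \oo] --> - 0 * `|x| by rewrite oppr0 mul0r.
apply: cvgMr_tmp; apply: cvgN.
exact: cvg_harmonic.
Qed.

Lemma cvg_expd3 x : expd3 (del n) x @[n --> \oo] --> (1 : R).
Proof.
suff : expd3 (del n) x @[n --> \oo] --> (1 * 1 * 1 : R) by rewrite !mulr1.
by apply: cvgM; [apply: cvgM|]; exact: cvg_expd.
Qed.

Lemma integral_pker_le (d : R) : 0 < d -> (\int[mu]_v (pker d v)%:E <= (2 * pi)%:E)%E.
Proof.
move=> d0; pose F v := 2 * atan (v / d).
have D0 v : 0 < d ^+ 2 + v ^+ 2 by rewrite ltr_wpDr ?sqr_ge0// exprn_gt0.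
rewrite (_ : 2 * pi = pi - (- pi)); last by ring.
apply: (@ge0_integral_derive_T_le _ F).
- move=> b; apply: is_derive_eq; rewrite /GRing.scale/= /pker.
  field; rewrite (lt0r_neq0 d0) andbT; apply: lt0r_neq0; have := D0 b; nra.
- move=> b; apply: cvgM; first exact: cvg_cst.
  apply: cvgV; first exact: lt0r_neq0.
  apply: cvgD; first exact: cvg_cst.
  by apply: exprn_continuous.
- by move=> b; rewrite pker_ge0// ltW.
- move=> b; rewrite /F; have := atan_gtNpi2 (b / d); have := atan_ltpi2 (b / d); lra.
Qed.

Lemma integral_pker_affine_le (d a b : R) : 0 < d -> a != 0 ->
  (\int[mu]_v (pker d (b - a * v))%:E <= (2 * pi / `|a|)%:E)%E.
Proof.
move=> d0 a0; have mp : measurable_fun setT (fun v => (pker d v)%:E) by rewrite /pker; mtac.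
have p0 v : (0 <= (pker d v)%:E)%E by rewrite lee_fin pker_ge0// ltW.
have := @integral_affine R (- a) b _ _ mp p0; rewrite oppr_eq0 normrN => /(_ a0) H.
rewrite (_ : \int[mu]_v _ = \int[mu]_x (pker d (- a * x + b))%:E)%E; last first.
  by apply: eq_integral => v _; rewrite mulNr addrC.
rewrite H mulrC EFinM lee_wpmul2l ?lee_fin ?invr_ge0//; exact: integral_pker_le.
Qed.

Lemma integral_pker3_le (d a b1 b2 b3 : R) : 0 < d -> a != 0 ->
  (\int[lebR3]_q (pker d (b1 - q.1.1) * pker d (b2 - q.1.2) * pker d (b3 - a * q.2))%:E <=
   ((2 * pi) ^+ 3 / `|a|)%:E)%E.
Proof.
move=> d0 a0; have pk v := pker_ge0 v (ltW d0).
rewrite ge0_integral_leb3; last 2 first.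
- by rewrite /pker; mtac.
- by move=> q; rewrite lee_fin; apply: mulr_ge0; first apply: mulr_ge0; exact: pk.
have mp b (c : R) : measurable_fun setT (fun v => (pker d (b - c * v))%:E) by rewrite /pker; mtac.
have mp1 b : measurable_fun setT (fun v : R => (pker d (b - v))%:E) by rewrite /pker; mtac.
have p1 b : (\int[mu]_v (pker d (b - v))%:E <= (2 * pi)%:E)%E.
  have := @integral_pker_affine_le d 1 b d0 (oner_neq0 _); rewrite normr1 divr1; apply: le_trans.
  by under [leRHS]eq_integral do rewrite mul1r.
have pi0 : 0 <= 2 * pi :> R by rewrite mulr_ge0// pi_ge0.
apply: (@le_trans _ _ (\int[mu]_x ((2 * pi) * (2 * pi / `|a|) * pker d (b1 - x))%:E)%E).
  apply: ge0_le_integral_mono => x.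
    by apply: integral_ge0 => y _; apply: integral_ge0 => z _; rewrite lee_fin; apply: mulr_ge0; first apply: mulr_ge0; exact: pk.
  apply: (@le_trans _ _ (\int[mu]_y (pker d (b1 - x) * (2 * pi / `|a|) * pker d (b2 - y))%:E)%E).
    apply: ge0_le_integral_mono => y; first by apply: integral_ge0 => z _; rewrite lee_fin; apply: mulr_ge0; first apply: mulr_ge0; exact: pk.
    rewrite /=; under eq_integral do rewrite EFinM.
    rewrite ge0_intZl; last 3 first.
    - exact: mp.
    - by move=> z; rewrite lee_fin.
    - by rewrite lee_fin mulr_ge0.
    rewrite [leRHS](_ : _ = ((pker d (b1 - x) * pker d (b2 - y))%:E * (2 * pi / `|a|)%:E)%E); last by rewrite -EFinM; congr EFin; ring.
    apply: lee_wpmul2l; first by rewrite lee_fin; apply: mulr_ge0; exact: pk.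
    exact: integral_pker_affine_le.
  under eq_integral do rewrite EFinM.
  rewrite ge0_intZl; last 3 first.
  - exact: mp1.
  - by move=> z; rewrite lee_fin.
  - by rewrite lee_fin mulr_ge0// divr_ge0.
  apply: (@le_trans _ _ ((pker d (b1 - x) * (2 * pi / `|a|))%:E * (2 * pi)%:E)%E).
    by apply: lee_wpmul2l; rewrite // lee_fin mulr_ge0// divr_ge0.
  by rewrite -EFinM lee_fin le_eqVlt; apply/orP; left; apply/eqP; ring.
under eq_integral do rewrite EFinM.
rewrite ge0_intZl; last 3 first.
- exact: mp1.
- by move=> z; rewrite lee_fin.
- by rewrite lee_fin mulr_ge0// divr_ge0.
rewrite (_ : (2 * pi) ^+ 3 / `|a| = (2 * pi) * (2 * pi / `|a|) * (2 * pi)); last by ring.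
rewrite [leRHS]EFinM; apply: lee_wpmul2l; last exact: p1.
by rewrite lee_fin mulr_ge0// divr_ge0.
Qed.

(* [slope a] is xi_3 / |xi| on the cone xi_3 = a |(xi_1, xi_2)|. *)
Definition slope (a : R) : R := a / Num.sqrt (1 + a ^+ 2).
Definition dslope (a : R) : R := (Num.sqrt (1 + a ^+ 2)) ^- 3.

Lemma is_derive_slope (a : R) : is_derive a 1 slope (dslope a).
Proof.
have H : 0 < 1 + a ^+ 2 by rewrite ltr_pwDl ?sqr_ge0.
have S0 : 0 < Num.sqrt (1 + a ^+ 2) by rewrite sqrtr_gt0.
have Sn : Num.sqrt (1 + a ^+ 2) != 0 by exact: lt0r_neq0.
have d1 := is_derive1_sqrt H.
have d2 : is_derive a 1 (fun a : R => 1 + a ^+ 2) (2 * a).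
  by apply: is_derive_eq; rewrite /GRing.scale/=; ring.
have d3 : is_derive a 1 (fun a : R => Num.sqrt (1 + a ^+ 2)) ((2 * Num.sqrt (1 + a ^+ 2))^-1 * (2 * a)).
  exact: is_derive1_comp.
have d4 := @is_deriveV _ (fun a : R => Num.sqrt (1 + a ^+ 2)) a _ 1 Sn d3.
apply: is_derive_eq; rewrite /GRing.scale/= /dslope.
have S2 : Num.sqrt (1 + a ^+ 2) ^+ 2 = 1 + a ^+ 2 by rewrite sqr_sqrtr// ltW.
set S := Num.sqrt _ in Sn S2 *.
transitivity ((S ^+ 2 - a ^+ 2) / S ^+ 3); first by field.
by rewrite S2 addrK div1r.
Qed.

Lemma measurable_slope d (T : measurableType d) (f : T -> R) : measurable_fun setT f ->
  measurable_fun setT (fun x => slope (f x)).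
Proof. by move=> mf; rewrite /slope; mtac. Qed.

Lemma dslope_gt0 a : 0 < dslope a.
Proof. by rewrite invr_gt0 exprn_gt0// sqrtr_gt0 ltr_pwDl ?sqr_ge0. Qed.

Lemma continuous_slope : continuous slope.
Proof.
by move=> a; have [+ _] := is_derive_slope a; move=> /derivable1_diffP/differentiable_continuous.
Qed.

Lemma continuous_dslope : continuous dslope.
Proof.
move=> a; apply: cvgV; first by rewrite expf_neq0// lt0r_neq0// sqrtr_gt0 ltr_pwDl ?sqr_ge0.
apply: (@continuous_comp _ _ _ (fun a : R => Num.sqrt (1 + a ^+ 2)) (fun x => x ^+ 3)); last exact: exprn_continuous.
apply: continuous_comp; last exact: sqrt_continuous.
apply: cvgD; first exact: cvg_cst.
exact: exprn_continuous.
Qed.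

(** [dslope] is the Jacobian of [slope], so the primitive is an arctangent of an affine function of
    [slope b]; its range gives a bound uniform in [d] and [a]. *)
Lemma integral_pker_slope_le (d k a : R) : 0 < d -> k != 0 ->
  (\int[mu]_b (pker d (k * (slope a - slope b)) * dslope b)%:E <= (2 * pi / `|k|)%:E)%E.
Proof.
move=> d0 k0; pose F b := 2 / k * atan (k * (slope b - slope a) / d).
have D0 v : 0 < d ^+ 2 + v ^+ 2 by rewrite ltr_wpDr ?sqr_ge0// exprn_gt0.
pose f b := pker d (k * (slope a - slope b)) * dslope b.
rewrite (_ : 2 * pi / `|k| = pi / `|k| - (- (pi / `|k|))); last by ring.
apply: (@ge0_integral_derive_T_le _ F f).
- move=> b; have ds := is_derive_slope b.
  apply: is_derive_eq; rewrite /GRing.scale/= /f /pker.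
  have := D0 (k * (slope b - slope a)); set u := slope b - slope a => Du.
  rewrite -(opprB (slope b)) -/u mulrN sqrrN.
  field; rewrite (lt0r_neq0 d0) k0 ?andbT/=; apply: lt0r_neq0; have := Du; nra.
- move=> b; apply: cvgM; last exact: continuous_dslope.
  apply: cvgM; first exact: cvg_cst.
  apply: cvgV; first exact: lt0r_neq0.
  apply: cvgD; first exact: cvg_cst.
  apply: (@continuous_comp _ _ _ (fun b : R => k * (slope a - slope b)) (fun x => x ^+ 2)); last exact: exprn_continuous.
  apply: cvgM; first exact: cvg_cst.
  by apply: cvgB; [exact: cvg_cst|exact: continuous_slope].
- by move=> b; rewrite mulr_ge0 ?pker_ge0// ltW// dslope_gt0.
- move=> b; rewrite -ler_norml /F normrM.
  rewrite (_ : pi / `|k| = `|2 / k| * (pi / 2)); last first.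
    by rewrite normrM normfV gtr0_norm//; field; rewrite normr_eq0.
  rewrite ler_wpM2l// ler_norml ltW ?atan_gtNpi2// ltW ?atan_ltpi2//.
Qed.

(** In the frequency variable tau = slope a this is Plancherel for the density V / dslope, whose
    square integrates to the right side. Taking [dslope] as Schur weight builds this change of
    variable into the TT^* bound; the constant 2 pi / |k| bounds the row sums of the Poisson
    kernel. *)
Lemma plancherel_time (k c : R) (V : R -> R) : k != 0 -> mu.-integrable setT (EFin \o V) ->
  (\int[mu]_t (cosint mu (fun t a : R => t * (k * slope a) + c) V t ^+ 2 +
     sinint mu (fun t a : R => t * (k * slope a) + c) V t ^+ 2)%:E <=
   (2 * pi / `|k|)%:E * \int[mu]_a (V a ^+ 2 / dslope a)%:E)%E.
Proof.
move=> k0 iV.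
apply: (@ttstar_lim _ _ _ _ R (@lebesgue_measure R) (@lebesgue_measure R) (fun t a : R => t * (k * slope a) + c) dslope V _ _ _ _ _ _ _ (fun n => expd (del n)) (fun n a b => pker (del n) (k * (slope a - slope b)))).
- by mtac; apply: measurable_slope; mtac.
- by rewrite /dslope; mtac.
- by rewrite divr_ge0// mulr_ge0// pi_ge0.
- by move=> a; rewrite ltW// dslope_gt0.
- exact: iV.
- by move=> a; have := dslope_gt0 a => /lt0r_neq0/eqP.
- by move=> n; exact: integrable_expd (del_gt0 n).
- by move=> n x; exact: expd_ge0.
- move=> n a b; rewrite -[RHS]mul1r -cos0 -Rintegral_expd_cos ?del_gt0//.
  apply: eq_Rintegral => t _; congr (_ * cos _); ring.
- by move=> n a b; rewrite pker_ge0// ltW// del_gt0.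
- by move=> n a; apply: integral_pker_slope_le => //; exact: del_gt0.
- exact: cvg_expd.
Qed.

(** The Schur weight is 1 here, and the row sums are those of a product of three Poisson kernels,
    whence (2 pi)^3. *)
Lemma plancherel_space (c : R) (H : R * R * R -> R) : lebR3.-integrable setT (EFin \o H) ->
  (\int[lebR3]_x (cosint lebR3 (fun x y : R * R * R => x.1.1 * y.1.1 + x.1.2 * y.1.2 + x.2 * y.2 + c) H x ^+ 2 +
     sinint lebR3 (fun x y : R * R * R => x.1.1 * y.1.1 + x.1.2 * y.1.2 + x.2 * y.2 + c) H x ^+ 2)%:E <=
   ((2 * pi) ^+ 3)%:E * \int[lebR3]_y (H y ^+ 2)%:E)%E.
Proof.
move=> iH; have -> : (\int[lebR3]_y (H y ^+ 2)%:E = \int[lebR3]_y (H y ^+ 2 / 1)%:E)%E.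
  by apply: eq_integral => y _; rewrite divr1.
apply: (@ttstar_lim _ _ _ _ R lebR3 lebR3 _ (fun=> 1) H _ _ _ _ _ _ _ (fun n => expd3 (del n))
   (fun n a b => pker (del n) (a.1.1 - b.1.1) * pker (del n) (a.1.2 - b.1.2) * pker (del n) (a.2 - 1 * b.2))).
- by mtac.
- by mtac.
- by rewrite exprn_ge0// mulr_ge0// pi_ge0.
- by [].
- exact: iH.
- by move=> a /eqP; rewrite oner_eq0.
- by move=> n; exact: integrable_expd3 (del_gt0 n).
- by move=> n x; rewrite /expd3 !mulr_ge0// expd_ge0.
- move=> n a b; rewrite mul1r -Rintegral_expd3_cos ?del_gt0//.
  apply: eq_Rintegral => t _; congr (_ * cos _); ring.
- move=> n a b; have pk v := pker_ge0 v (ltW (del_gt0 n)); apply: mulr_ge0; first apply: mulr_ge0; exact: pk.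
- move=> n a; under eq_integral do rewrite mulr1.
  have := @integral_pker3_le (del n) 1 a.1.1 a.1.2 a.2 (del_gt0 n) (oner_neq0 _).
  by rewrite normr1 divr1.
- exact: cvg_expd3.
Qed.

End poisson.

(** * Cube integrals in time *)
Section level_sets.
Context (R : realType).
Notation mu := (@lebesgue_measure R).

Lemma integral_boolM d (T : measurableType d) (m : {measure set T -> \bar R}) (P : T -> bool) (f : T -> R) :
  (\int[m]_x ((P x)%:R * f x)%:E = \int[m]_(x in [set x | P x]) (f x)%:E)%E.
Proof.
rewrite [RHS]integral_mkcond; apply: eq_integral => x _; rewrite patchE.
case: ifPn => [|/negP xP]; first by rewrite inE => /= ->; rewrite mul1r.
by case Px: (P x); [case: xP; rewrite inE|rewrite mul0r].
Qed.

Lemma integral_powR_head (r T : R) : 0 < r -> 0 < T ->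
  (\int[mu]_x ((0 < x < T)%R%:R * x `^ (r - 1))%:E <= (T `^ r / r)%:E)%E.
Proof.
move=> r0 T0; rewrite integral_boolM -[leRHS]sube0.
apply: (@ge0_integral_derive_oo_le _ 0 T (fun x => x `^ r / r) (fun x => x `^ (r - 1)) 0) => /=.
- move=> x /andP[x0 xT]; have d1 := is_derive1_powR r x0.
  by apply: is_derive_eq; rewrite /GRing.scale/=; field; exact: lt0r_neq0.
- move=> x /andP[x0 xT]; have d1 := is_derive1_powR (r - 1) x0.
  by apply: differentiable_continuous; apply/derivable1_diffP; apply: ex_derive.
- by move=> x _; exact: powR_ge0.
- move=> x /andP[x0 xT]; rewrite divr_ge0 ?powR_ge0 ?(ltW r0)//=.
  by rewrite ler_pM2r ?invr_gt0// ge0_ler_powR// ?nnegrE ltW.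
- by rewrite divr_ge0 ?powR_ge0 ?(ltW r0).
Qed.

Lemma integral_powR_tail (r T : R) : 0 < r -> 0 < T ->
  (\int[mu]_x ((T < x)%R%:R * x `^ (- r - 1))%:E <= (T `^ (- r) / r)%:E)%E.
Proof.
move=> r0 T0; rewrite integral_boolM (_ : T `^ (- r) / r = 0 - (- (T `^ (- r) / r))); last by rewrite sub0r opprK.
apply: (@ge0_integral_derive_le _ (fun x => T < x) (fun n => T + n.+1%:R^-1) (fun n => T + 1 + n%:R)
   (fun x => - (x `^ (- r) / r)) (fun x => x `^ (- r - 1))) => /=.
- by move=> n k nk; rewrite lerD2l lef_pV2 ?posrE// ler_nat.
- by move=> n k nk; rewrite lerD2l ler_nat.
- move=> n; rewrite -addrA lerD2l; apply: (@le_trans _ _ 1); last by rewrite lerDl.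
  by rewrite invf_le1// ler1n.
- by move=> n x /andP[+ _]; apply: lt_le_trans; rewrite ltrDl invr_gt0.
- move=> x Tx; pose m := maxn (Num.bound (x - T)^-1) (Num.bound (x - T)); exists m.
  have xT0 : 0 < x - T by rewrite subr_gt0.
  have h1 : (x - T)^-1 < m.+1%:R.
    apply: (lt_le_trans (archi_boundP _)); first by rewrite invr_ge0 ltW.
    by rewrite ler_nat; lia.
  have h2 : x - T < m%:R.
    apply: (lt_le_trans (archi_boundP _)); first exact: ltW.
    by rewrite ler_nat; lia.
  have h3 : m.+1%:R^-1 < x - T by rewrite invf_plt ?posrE.
  rewrite -lerBrDl (ltW h3)/= -addrA -lerBlDl; apply: (le_trans (ltW h2)); by rewrite lerDr.
- move=> x Tx; have x0 : 0 < x by exact: lt_trans Tx.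
  have d1 := is_derive1_powR (- r) x0.
  by apply: is_derive_eq; rewrite /GRing.scale/=; field; exact: lt0r_neq0.
- move=> x Tx; have x0 : 0 < x by exact: lt_trans Tx.
  have d1 := is_derive1_powR (- r - 1) x0.
  by apply: differentiable_continuous; apply/derivable1_diffP; apply: ex_derive.
- by move=> x _; exact: powR_ge0.
- move=> x Tx; have x0 : 0 < x by exact: lt_trans Tx.
  rewrite oppr_le0 divr_ge0 ?powR_ge0 ?(ltW r0)//= andbT lerN2 ler_pM2r ?invr_gt0//.
  by rewrite !powRN lef_pV2 ?posrE ?powR_gt0// ge0_ler_powR// ?nnegrE ltW.
Qed.

(* [wgt] is the weight for which the sixth power of the cone estimate, of constant 1 / |a|, integrates to the homogeneous H^1 norm; [lev = wgt * dslope] then balances it against Plancherel in time. *)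
Definition lev (a : R) : R := `|a| `^ 3^-1 / Num.sqrt (1 + a ^+ 2).
Definition wgt (a : R) : R := `|a| `^ 3^-1 * (1 + a ^+ 2).

Lemma lev_ge0 a : 0 <= lev a. Proof. by rewrite /lev divr_ge0// powR_ge0. Qed.
Lemma wgt_ge0 a : 0 <= wgt a. Proof. by rewrite /wgt mulr_ge0// ?powR_ge0// addr_ge0// sqr_ge0. Qed.
Lemma wgt_gt0 a : a != 0 -> 0 < wgt a.
Proof. by move=> a0; rewrite /wgt mulr_gt0// ?powR_gt0 ?normr_gt0// ltr_pwDl// sqr_ge0. Qed.

Lemma measurable_lev : measurable_fun setT lev. Proof. by rewrite /lev; mtac. Qed.
Lemma measurable_wgt : measurable_fun setT wgt. Proof. by rewrite /wgt; mtac. Qed.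

Lemma lev_dslope a : lev a / dslope a = wgt a.
Proof.
rewrite /lev /dslope /wgt; have H : 0 <= 1 + a ^+ 2 by rewrite addr_ge0// sqr_ge0.
have S0 : Num.sqrt (1 + a ^+ 2) != 0 by rewrite sqrtr_eq0 -ltNge ltr_pwDl// sqr_ge0.
rewrite -{3}(sqr_sqrtr H); field; exact: S0.
Qed.

Ltac pos1 := match goal with
 | |- is_true (_ <= _ * _)%E => apply: mule_ge0
 | |- is_true (_ <= _ + _)%E => apply: adde_ge0
 | |- is_true (_ <= `|_|)%E => exact: abse_ge0
 | |- is_true (_ <= _%:E)%E => rewrite lee_fin
 | |- is_true (_ <= _ ^+ 2) => exact: sqr_ge0
 | |- is_true (_ <= `|_|) => exact: normr_ge0
 | |- is_true (_ <= `|_| ^+ _) => apply: exprn_ge0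
 | |- is_true (_ <= wgt _) => exact: wgt_ge0
 | |- is_true (_ <= lev _) => exact: lev_ge0
 | |- is_true (_ <= dslope _) => apply: ltW; exact: dslope_gt0
 | |- is_true (_ <= pi) => exact: pi_ge0
 | |- is_true (_ <= _%:R) => exact: ler0n
 | |- is_true (_ <= _ + _) => apply: addr_ge0
 | |- is_true (_ <= _ * _) => apply: mulr_ge0
 | |- is_true (_ <= _ ^-1) => rewrite invr_ge0
 | |- is_true (_ <= _) => first [by [] | apply: ltW; by []]
 end.
Ltac pos := repeat pos1.

(** [lev] is of order |a|^(1/3) near 0 and |a|^(-2/3) near infinity, so the set lies in |a| < T or
    |a| > T' with T of order s^3 and T' of order s^(-3/2). There 1 / wgt is at most |a|^(-1/3),
    respectively |a|^(-7/3), and both pieces have mass of order s^2. *)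
Lemma integral_level_le (s : R) : 0 < s ->
  (\int[mu]_a ((lev a < s)%R%:R / wgt a)%:E <= (9 * s ^+ 2)%:E)%E.
Proof.
move=> s0; rewrite integral_symmetrize; last 2 first.
- by have := measurable_lev; have := measurable_wgt => mw ml; mtac.
- by move=> x; rewrite divr_ge0 ?wgt_ge0.
(* The 2 comes from bounding 1 + x^2 by 2 below 1 and by 2 x^2 above 1. The thresholds are chosen so
   that T^(2/3) and T'^(-4/3) both equal [z]; the two halves of the line then give 2 z (3/2 + 3/4) =
   9 s^2. *)
pose z := 2 * s ^+ 2; have z0 : 0 < z by rewrite mulr_gt0// exprn_gt0.
pose T := z `^ (3 / 2); pose T' := z `^ (- (3 / 4)).
have T0 : 0 < T by rewrite powR_gt0.
have T'0 : 0 < T' by rewrite powR_gt0.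
pose p1 x : \bar R := (2%:E * ((0 < x < T)%R%:R * x `^ (2 / 3 - 1))%:E)%E.
pose p2 x : \bar R := (2%:E * ((T' < x)%R%:R * x `^ (- (4 / 3) - 1))%:E)%E.
have p10 x : (0 <= p1 x)%E by rewrite mule_ge0// lee_fin mulr_ge0// powR_ge0.
have p20 x : (0 <= p2 x)%E by rewrite mule_ge0// lee_fin mulr_ge0// powR_ge0.
have mp1 : measurable_fun setT p1 by rewrite /p1; mtac.
have mp2 : measurable_fun setT p2 by rewrite /p2; mtac.
apply: (@le_trans _ _ (\int[mu]_x (p1 x + p2 x))%E).
  rewrite integral_mkcond; apply: ge0_le_integral_mono => x.
    by rewrite patchE; case: ifP => // _; rewrite lee_fin addr_ge0// divr_ge0 ?wgt_ge0.
  rewrite patchE; case: ifPn => [|_]; last by rewrite adde_ge0.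
  rewrite inE/= in_itv/= andbT => x0.
  have -> : lev (- x) = lev x by rewrite /lev normrN sqrrN.
  have -> : wgt (- x) = wgt x by rewrite /wgt normrN sqrrN.
  have [lx|] := ltP (lev x) s; last by rewrite !mul0r addr0 adde_ge0.
  have [->|xn0] := eqVneq x 0.
    by rewrite /wgt normr0 powR0 ?invr_neq0// !mul0r invr0 !mulr0 addr0 adde_ge0.
  have xp : 0 < x by rewrite lt_neqAle eq_sym xn0.
  pose p := x `^ 3^-1; have pp : 0 < p by rewrite powR_gt0.
  have px : p ^+ 3 = x by rewrite -powR_mulrn ?powR_ge0// -powRrM mulVf// powRr1.
  have pq (r : R) : x `^ r = p `^ (3 * r) by rewrite /p -powRrM; congr powR; field.
  have S0 : 0 < 1 + x ^+ 2 by rewrite ltr_pwDl// sqr_ge0.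
  have lx2 : p ^+ 2 < s ^+ 2 * (1 + x ^+ 2).
    have : lev x ^+ 2 < s ^+ 2 by rewrite ltr_pXn2r// nnegrE ?lev_ge0 ?ltW.
    by rewrite /lev (ger0_norm x0) expr_div_n sqr_sqrtr ?ltW// ltr_pdivrMr.
  rewrite /wgt (ger0_norm x0) -/p -mulr2n -mulr_natl mul1r.
  have [x1|x1] := leP x 1.
    have pz : p ^+ 2 < z.
      apply: (lt_le_trans lx2); rewrite /z mulrC ler_pM2r ?exprn_gt0//.
      by rewrite -natr1 addrC lerD2r exprn_ile1.
    have xT : x < T.
      have -> : x = (p ^+ 2) `^ (3 / 2).
        by rewrite -powR_mulrn ?powR_ge0// -!powRrM (_ : 3^-1 * (2 * (3 / 2)) = 1 :> R) ?powRr1//; field.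
      by rewrite gt0_ltr_powR// ?nnegrE ?exprn_ge0 ?ltW.
    rewrite -[leLHS]adde0; apply: leeD => //.
    rewrite /p1 xp xT mul1r -EFinM lee_fin (_ : 2 / 3 - 1 = - 3^-1 :> R); last by field.
    rewrite powRN -/p /= !mul1r -[leLHS]mulr_natl ler_pM2l// lef_pV2 ?posrE ?mulr_gt0//.
    by rewrite ler_pMr// lerDl sqr_ge0.
  have x2 : 1 <= x ^+ 2 by rewrite exprn_ege1// ltW.
  have p4 : z^-1 < p ^+ 4.
    have : p ^+ 2 * 1 < p ^+ 2 * (z * p ^+ 4).
      rewrite mulr1 (_ : _ * _ = s ^+ 2 * (2 * x ^+ 2)); last by rewrite -px /z; ring.
      apply: (lt_le_trans lx2); rewrite ler_pM2l ?exprn_gt0//; lra.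
    by rewrite ltr_pM2l ?exprn_gt0// -[z^-1]mul1r ltr_pdivrMr// mulrC.
  have xT : T' < x.
    have -> : x = (p ^+ 4) `^ (3 / 4).
      by rewrite -powR_mulrn ?powR_ge0// -!powRrM (_ : 3^-1 * (4 * (3 / 4)) = 1 :> R) ?powRr1//; field.
    rewrite /T' -mulN1r powRrM powR_inv1 ?(ltW z0)//.
    by rewrite gt0_ltr_powR// ?nnegrE ?exprn_ge0 ?invr_ge0 ?ltW.
  rewrite -[leLHS]add0e; apply: leeD => //.
  rewrite /p2 xT mul1r -EFinM lee_fin pq (_ : 3 * (- (4 / 3) - 1) = - 7%:R :> R); last by field.
  rewrite powRN powR_mulrn ?(ltW pp)// /= ?mul1r -[leLHS]mulr_natl ler_pM2l// lef_pV2 ?posrE ?mulr_gt0 ?exprn_gt0//.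
  by rewrite (_ : p ^+ 7 = p * x ^+ 2) ?ler_pM2l ?lerDr// -px; ring.
rewrite ge0_integralD; last 5 first.
- exact: measurableT.
- by move=> x _.
- exact: mp1.
- by move=> x _.
- exact: mp2.
rewrite /p1 /p2 !ge0_intZl; last 6 first.
- by mtac.
- by move=> x; rewrite lee_fin mulr_ge0// powR_ge0.
- by [].
- by mtac.
- by move=> x; rewrite lee_fin mulr_ge0// powR_ge0.
- by [].
have r1 : 0 < 2 / 3 :> R by rewrite divr_gt0.
have r2 : 0 < 4 / 3 :> R by rewrite divr_gt0.
have B1 := integral_powR_head r1 T0; have B2 := integral_powR_tail r2 T'0.
apply: (@le_trans _ _ (2%:E * (T `^ (2 / 3) / (2 / 3))%:E + 2%:E * (T' `^ (- (4 / 3)) / (4 / 3))%:E)%E).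
  by apply: leeD; apply: lee_wpmul2l.
have -> : T `^ (2 / 3) = z by rewrite /T -powRrM (_ : 3 / 2 * (2 / 3) = 1 :> R) ?powRr1 ?(ltW z0)//; field.
have -> : T' `^ (- (4 / 3)) = z by rewrite /T' -powRrM (_ : - (3 / 4) * - (4 / 3) = 1 :> R) ?powRr1 ?(ltW z0)//; field.
rewrite -!EFinM -EFinD lee_fin le_eqVlt; apply/orP; left; apply/eqP; rewrite /z; by field.
Qed.

Lemma integral_cube (v : R) : 0 <= v -> (\int[mu]_l ((0 <= l <= v)%R%:R * (3 * l ^+ 2))%:E = (v ^+ 3)%:E)%E.
Proof.
move=> v0; rewrite integral_boolM.
have -> : [set x : R | 0 <= x <= v] = `[0, v]%classic by apply/seteqP; split => x /=; rewrite in_itv.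
have := @integral_derive_itv R (fun x => x ^+ 3) (fun x => 3 * x ^+ 2) 0 v v0.
rewrite expr0n/= subr0; apply.
- by move=> x _; apply: is_derive_eq; rewrite /GRing.scale/=; ring.
- move=> x _; apply: continuousM; first exact: cst_continuous.
  exact: exprn_continuous.
Qed.

Lemma integral_length (v : R) : 0 <= v -> (\int[mu]_l ((0 <= l <= v)%R%:R)%:E = v%:E)%E.
Proof.
move=> v0; under eq_integral do rewrite -[_%:R]mulr1; rewrite integral_boolM.
have -> : [set x : R | 0 <= x <= v] = `[0, v]%classic by apply/seteqP; split => x /=; rewrite in_itv.
have := @integral_derive_itv R (fun x => x) (fun x => 1) 0 v v0.
by rewrite subr0; apply=> x _; exact: cst_continuous.
Qed.

(** Cauchy-Schwarz in additive form: |V| <= th wgt V^2 + 1 / (4 th wgt). With th = l / (4 N^2) the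
    first term contributes l / 4; the threshold l / (6 N) makes the second l / 4 as well, by the
    bound 9 s^2. At a = 0 the weight vanishes and [V 0 = 0] takes over. *)
Lemma integral_level_V_le (V : R -> R) (N l : R) : measurable_fun setT V -> V 0 = 0 -> 0 < N -> 0 < l ->
  (\int[mu]_a (wgt a * V a ^+ 2)%:E <= (N ^+ 2)%:E)%E ->
  (\int[mu]_a ((lev a < l / (6 * N))%R%:R * `|V a|)%:E <= (l / 2)%:E)%E.
Proof.
move=> mV V0 N0 l0 VN; have mw := measurable_wgt; have ml := measurable_lev.
pose s := l / (6 * N); have s0 : 0 < s by rewrite divr_gt0// mulr_gt0.
pose th := l / (4 * N ^+ 2); have th0 : 0 < th by rewrite divr_gt0// mulr_gt0// exprn_gt0.
apply: (@le_trans _ _ (\int[mu]_a (th%:E * (wgt a * V a ^+ 2)%:E + (4 * th)^-1%:E * ((lev a < s)%R%:R / wgt a)%:E))%E).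
  apply: ge0_le_integral_mono => a; first by rewrite lee_fin mulr_ge0.
  rewrite -!EFinM -EFinD lee_fin -/s.
  have [la|_] := ltP (lev a) s; last by rewrite !mul0r mulr0 addr0 (mulr_ge0 (ltW th0))// mulr_ge0 ?sqr_ge0 ?wgt_ge0.
  have [->|a0] := eqVneq a 0; first by rewrite V0 normr0 mulr0 expr0n/= !mulr0 add0r mulr_ge0 ?divr_ge0 ?wgt_ge0// invr_ge0 mulr_ge0// ltW.
  have w0 := wgt_gt0 a0; rewrite !mul1r -subr_ge0.
  rewrite -(real_normK (num_real (V a))); set v := `|V a|.
  have -> : th * (wgt a * v ^+ 2) + (4 * th)^-1 * (wgt a)^-1 - v = (2 * th * wgt a * v - 1) ^+ 2 / (4 * th * wgt a).
    field; by apply/andP; split; apply: lt0r_neq0.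
  have D0 : 0 < 4 * th * wgt a by apply: mulr_gt0 => //; apply: mulr_gt0.
  by apply: divr_ge0; [exact: sqr_ge0|exact: ltW].
have mA : measurable_fun setT (fun a : R => (wgt a * V a ^+ 2)%:E) by mtac.
have mB : measurable_fun setT (fun a : R => ((lev a < s)%R%:R / wgt a)%:E) by mtac.
have A0 a : (0 <= (wgt a * V a ^+ 2)%:E)%E by rewrite lee_fin mulr_ge0 ?sqr_ge0 ?wgt_ge0.
have B0 a : (0 <= ((lev a < s)%R%:R / wgt a)%:E)%E by rewrite lee_fin divr_ge0 ?wgt_ge0.
have th4 : 0 <= (4 * th)^-1 by rewrite invr_ge0 mulr_ge0 ?ltW.
rewrite ge0_integralD; last 5 first.
- exact: measurableT.
- by move=> x _; rewrite mule_ge0 ?lee_fin ?(ltW th0)//; exact: A0.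
- by mtac.
- by move=> x _; rewrite mule_ge0//; exact: B0.
- by mtac.
rewrite !ge0_intZl; last 6 first.
- exact: mB.
- exact: B0.
- exact: th4.
- exact: mA.
- exact: A0.
- by rewrite lee_fin ltW.
apply: (@le_trans _ _ (th%:E * (N ^+ 2)%:E + (4 * th)^-1%:E * (9 * s ^+ 2)%:E)%E).
  apply: leeD; apply: lee_wpmul2l.
  - by rewrite lee_fin ltW.
  - exact: VN.
  - exact: th4.
  - exact: integral_level_le.
rewrite -!EFinM -EFinD lee_fin le_eqVlt; apply/orP; left; apply/eqP; rewrite /th /s; field.
by rewrite !lt0r_neq0.
Qed.

(* At level [l] the part of [V] where [lev a < l / (6 N)] contributes at most [l / 2], so the level set is controlled by the L^2 norm of the other part. *)
Lemma cosint_cube_le (k c N : R) (V : R -> R) : k != 0 -> mu.-integrable setT (EFin \o V) ->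
  V 0 = 0 -> 0 < N -> (\int[mu]_a (wgt a * V a ^+ 2)%:E <= (N ^+ 2)%:E)%E ->
  (\int[mu]_t (`|cosint mu (fun t a : R => t * (k * slope a) + c) V t| ^+ 3)%:E <= (144 * pi / `|k| * N ^+ 3)%:E)%E.
Proof.
move=> k0 iV V0 N0 VN.
have mw := measurable_wgt; have ml := measurable_lev; have ms : measurable_fun setT (@slope R) by apply: measurable_slope; mtac.
have md : measurable_fun setT (@dslope R) by rewrite /dslope; mtac.
have mV := measurable_int _ iV; move/measurable_EFinP in mV.
pose psi (t a : R) := t * (k * slope a) + c.
have mpsi : measurable_fun setT (fun p : R * R => psi p.1 p.2) by rewrite /psi; mtac.
have mpsi1 t : measurable_fun setT (psi t) by rewrite /psi; mtac.
pose Vh (l a : R) := (l / (6 * N) <= lev a)%R%:R * V a.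
have mVh : measurable_fun setT (fun p : R * R => Vh p.1 p.2) by rewrite /Vh; mtac.
have mVhl l : measurable_fun setT (Vh l) by rewrite /Vh; mtac.
have iVh l : mu.-integrable setT (EFin \o Vh l).
  apply: (le_integrable measurableT _ _ iV) => /=; first by mtac.
  by move=> a _; rewrite lee_fin normrM ler_piMl// normr_nat lern1 leq_b1.
pose Vl (l a : R) := (lev a < l / (6 * N))%R%:R * V a.
have mVl l : measurable_fun setT (Vl l) by rewrite /Vl; mtac.
have iVl l : mu.-integrable setT (EFin \o Vl l).
  apply: (le_integrable measurableT _ _ iV) => /=; first by mtac.
  by move=> a _; rewrite lee_fin normrM ler_piMl// normr_nat lern1 leq_b1.
pose F := cosint mu psi V; pose G (l : R) := cosint mu psi (Vh l).
pose S (l : R) := sinint mu psi (Vh l).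
have mF : measurable_fun setT F by rewrite /F; exact: measurable_cosint.
have mG : measurable_fun setT (fun p : R * R => G p.1 p.2).
  by rewrite /G /cosint /psi /Vh; mtac.
have mS : measurable_fun setT (fun p : R * R => S p.1 p.2).
  by rewrite /S /sinint /psi /Vh; mtac.
have cos1 t a : `|cos (psi t a)| <= 1 by rewrite ler_norml cos_geN1 cos_le1.
have key l t : 0 <= l -> l <= `|F t| -> l ^+ 2 <= 4 * (G l t ^+ 2 + S l t ^+ 2).
  rewrite le_eqVlt => /orP[/eqP <- _|l0 lF]; first by rewrite expr0n/=; pos.
  have FG : F t - G l t = \int[mu]_a (cos (psi t a) * Vl l a).
    rewrite /F /G /cosint -RintegralB//; last 2 first.
    - exact: (integrable_osc iV (measurable_fun_cos (mpsi1 t)) (cos1 t)).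
    - exact: (integrable_osc (iVh l) (measurable_fun_cos (mpsi1 t)) (cos1 t)).
    by apply: eq_Rintegral => a _; rewrite /Vh /Vl leNgt; case: ltP => _ /=; ring.
  have FGl : `|F t - G l t| <= l / 2.
    have iO := integrable_osc (iVl l) (measurable_fun_cos (mpsi1 t)) (cos1 t).
    rewrite FG -lee_fin EFin_normr_Rintegral//.
    apply: (le_trans (le_abse_integral _ measurableT (measurable_int _ iO))).
    apply: le_trans (integral_level_V_le mV V0 N0 l0 VN); apply: ge0_le_integral_mono => a.
      exact: abse_ge0.
    rewrite lee_fin normrM /Vl normrM (ger0_norm (ler0n _ _)).
    by rewrite ler_piMl ?mulr_ge0// ler_norml cos_geN1 cos_le1.
  have Gl : l / 2 <= `|G l t|.
    have := ler_normD (F t - G l t) (G l t); rewrite subrK; lra.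
  have : (l / 2) ^+ 2 <= G l t ^+ 2.
    by rewrite -(real_normK (num_real (G l t))) ler_pXn2r// nnegrE// divr_ge0// ltW.
  have := sqr_ge0 (S l t); rewrite expr_div_n; lra.
(* Layer cake: |F|^3 is the integral of 3 l^2 over 0 <= l <= |F|, and on this range [key] bounds 3
   l^2 by 12 (G^2 + S^2). The restriction l <= |F| is then dropped, so that Plancherel in time
   applies at each level. *)
apply: (@le_trans _ _ (\int[mu]_t \int[mu]_l (12%:E * ((0 <= l)%R%:R * (G l t ^+ 2 + S l t ^+ 2))%:E))%E).
  apply: ge0_le_integral_mono => t; first by rewrite lee_fin exprn_ge0.
  rewrite -integral_cube; last exact: normr_ge0.
  apply: ge0_le_integral_mono => l.
    rewrite lee_fin.
    apply: mulr_ge0.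
    by [].
    by pos.
  rewrite -EFinM lee_fin; have [l0|_] := leP 0 l; last by rewrite !mul0r mulr0.
  have [lF|_] := leP l `|_|; last by rewrite !mul1r mul0r; pos.
  by rewrite /= !mul1r; have := key l t l0 lF; lra.
rewrite ge0_integral_swap; last 2 first.
- by mtac; [apply: (measurableT_comp mG (g := fun p : R * R => (p.2, p.1))); mtac|apply: (measurableT_comp mS (g := fun p : R * R => (p.2, p.1))); mtac].
- by move=> t l; pos.
apply: (@le_trans _ _ (\int[mu]_l \int[mu]_a ((24 * pi / `|k|)%:E * ((0 <= l <= 6 * N * lev a)%R%:R * (V a ^+ 2 / dslope a))%:E))%E).
  apply: ge0_le_integral_mono => l; first by apply: integral_ge0 => t _; pos.
  have [l0|_] := leP 0 l; last first.
    rewrite integral0_eq => [|t _]; last by rewrite mul0r mule0.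
    by apply: integral_ge0 => a _; pos.
  under eq_integral do rewrite mul1r.
  have mGl : measurable_fun setT (G l) by apply: (measurableT_comp mG (g := fun t : R => (l, t))); mtac.
  have mV1 := mVhl l.
  have mSl : measurable_fun setT (S l) by apply: (measurableT_comp mS (g := fun t : R => (l, t))); mtac.
  rewrite ge0_intZl; last 3 first.
  - by mtac.
  - by move=> t; pos.
  - by [].
  apply: (@le_trans _ _ (12%:E * ((2 * pi / `|k|)%:E * \int[mu]_a (Vh l a ^+ 2 / dslope a)%:E))%E).
    by apply: lee_wpmul2l => //; exact: (plancherel_time c k0 (iVh l)).
  rewrite muleA -EFinM -ge0_intZl; last 3 first.
  - by mtac.
  - by move=> a; pos.
  - by pos.
  apply: ge0_le_integral_mono => a.
    by pos.
  rewrite -!EFinM lee_fin /Vh ler_pdivrMr ?mulr_gt0// (mulrC (lev a)).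
  have -> : 12 * (2 * pi / `|k|) = 24 * pi / `|k| by ring.
  rewrite le_eqVlt; apply/orP; left; apply/eqP.
  by case: (l <= _) => /=; rewrite ?mul1r ?mul0r ?expr0n/= ?mul0r ?mulr0.
rewrite ge0_integral_swap; last 2 first.
- by mtac.
- by move=> l a; pos.
(* For fixed a, the levels with l <= 6 N lev a form an interval of length 6 N lev a, and lev /
   dslope = wgt turns the density of Plancherel into the weighted one; 144 = 24 * 6. *)
apply: (@le_trans _ _ (\int[mu]_a ((144 * pi * N / `|k|)%:E * (wgt a * V a ^+ 2)%:E))%E).
  apply: ge0_le_integral_mono => a.
    by apply: integral_ge0 => l _; pos.
  have E (b : bool) : ((24 * pi / `|k|)%:E * (b%:R * (V a ^+ 2 / dslope a))%:E = (24 * pi / `|k| * (V a ^+ 2 / dslope a))%:E * b%:R%:E)%E.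
    by rewrite -!EFinM; congr EFin; ring.
  under eq_integral do rewrite E.
  rewrite ge0_intZl; last 3 first.
  - by mtac.
  - by move=> l; rewrite lee_fin.
  - by pos.
  rewrite integral_length; last by pos.
  rewrite -!EFinM lee_fin -lev_dslope le_eqVlt; apply/orP; left; apply/eqP; ring.
rewrite ge0_intZl; last 3 first.
- by mtac.
- by move=> a; pos.
- by pos.
apply: (@le_trans _ _ ((144 * pi * N / `|k|)%:E * (N ^+ 2)%:E)%E).
  by apply: lee_wpmul2l => //; pos.
rewrite -!EFinM lee_fin le_eqVlt; apply/orP; left; apply/eqP; ring.
Qed.

(** The previous bound with N the square root of the weighted integral, squared so that only integer
    powers occur. When that integral is 0, every N > 0 is admissible and the time integral is 0. *)
Lemma cosint_cube_sqr_le (k c : R) (V : R -> R) : k != 0 -> mu.-integrable setT (EFin \o V) ->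
  V 0 = 0 ->
  ((\int[mu]_t (`|cosint mu (fun t a : R => t * (k * slope a) + c) V t| ^+ 3)%:E) ^+ 2 <=
    ((144 * pi / k) ^+ 2)%:E * (\int[mu]_a (wgt a * V a ^+ 2)%:E) ^+ 3)%E.
Proof.
move=> k0 iV V0; set J := (\int[mu]_t _)%E; set M := (\int[mu]_a _)%E.
have J0 : (0 <= J)%E by apply: integral_ge0 => t _; pos.
have M0 : (0 <= M)%E by apply: integral_ge0 => t _; pos.
have k1 : 0 < `|k| by rewrite normr_gt0.
have pik : 0 < 144 * pi / `|k| by rewrite divr_gt0// mulr_gt0// pi_gt0.
have pk2 : (144 * pi / k) ^+ 2 = (144 * pi / `|k|) ^+ 2 by rewrite !exprMn !exprVn real_normK ?num_real.
have B (N : R) : 0 < N -> (M <= (N ^+ 2)%:E -> J <= (144 * pi / `|k| * N ^+ 3)%:E)%E.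
  by move=> N0; exact: cosint_cube_le.
case: M M0 B => [m| |//] + B.
- rewrite lee_fin le_eqVlt => /orP[/eqP m0|m0].
    suff -> : J = 0%E by rewrite -m0 !expeS !mul0e mule0.
    apply/eqP; rewrite eq_le J0 andbT; apply/lee_addgt0Pr => e e0; rewrite add0e.
    pose N := Num.min 1 (e / (144 * pi / `|k|)).
    have N0 : 0 < N by rewrite lt_min ltr01 divr_gt0.
    have N1 : N <= 1 by rewrite ge_min lexx.
    have Ne : N <= e / (144 * pi / `|k|) by rewrite ge_min lexx orbT.
    apply: (le_trans (B N N0 _)); first by rewrite -m0 lee_fin sqr_ge0.
    rewrite lee_fin mulrC -ler_pdivlMr//; apply: le_trans Ne.
    by rewrite exprS ler_piMr ?(ltW N0)// exprn_ile1 ?(ltW N0).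
  have S0 : 0 < Num.sqrt m by rewrite sqrtr_gt0.
  have := B _ S0; rewrite sqr_sqrtr ?(ltW m0)// => /(_ (lexx _)) JB.
  have <- : (((144 * pi / `|k| * Num.sqrt m ^+ 3)%:E) ^+ 2 = ((144 * pi / k) ^+ 2)%:E * (m%:E) ^+ 3)%E.
    rewrite pk2 -!EFin_expe -EFinM; congr EFin; rewrite -{2}(sqr_sqrtr (ltW m0)); ring.
  by rewrite !expe2; apply: lee_pmul.
- move=> _; rewrite pk2 (_ : (+oo ^+ 3 = +oo :> \bar R)%E) ?gt0_muley ?leey// ?lte_fin ?exprn_gt0//.
Qed.
End level_sets.

(** * Strichartz estimate on the cone *)
Section osc_tensor.
Context dx d1 d2 (X : measurableType dx) (Y1 : measurableType d1) (Y2 : measurableType d2) (R : realType).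
Variables (m1 : {sigma_finite_measure set Y1 -> \bar R}) (m2 : {sigma_finite_measure set Y2 -> \bar R}).
Variables (psi1 : X -> Y1 -> R) (psi2 : X -> Y2 -> R) (H1 : Y1 -> R) (H2 : Y2 -> R).
Hypothesis mpsi1 : forall x, measurable_fun setT (psi1 x).
Hypothesis mpsi2 : forall x, measurable_fun setT (psi2 x).
Hypothesis iH1 : m1.-integrable setT (EFin \o H1).
Hypothesis iH2 : m2.-integrable setT (EFin \o H2).

(** The product of two complex oscillatory integrals is the oscillatory integral on the product
    space with the phases added, and moduli multiply; the addition formulas spell this out in real
    terms. *)
Lemma osc_tensor_sqr x :
  cosint (tensor m1 m2) (fun x z => psi1 x z.1 + psi2 x z.2) (fun z => H1 z.1 * H2 z.2) x ^+ 2 +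
  sinint (tensor m1 m2) (fun x z => psi1 x z.1 + psi2 x z.2) (fun z => H1 z.1 * H2 z.2) x ^+ 2 =
  (cosint m1 psi1 H1 x ^+ 2 + sinint m1 psi1 H1 x ^+ 2) * (cosint m2 psi2 H2 x ^+ 2 + sinint m2 psi2 H2 x ^+ 2).
Proof.
have c1 t : `|cos t| <= 1 :> R by rewrite ler_norml cos_geN1 cos_le1.
have s1 t : `|sin t| <= 1 :> R by rewrite ler_norml sin_geN1 sin_le1.
have ic1 := integrable_osc iH1 (measurable_fun_cos (mpsi1 x)) (fun y => c1 _).
have is1 := integrable_osc iH1 (measurable_fun_sin (mpsi1 x)) (fun y => s1 _).
have ic2 := integrable_osc iH2 (measurable_fun_cos (mpsi2 x)) (fun y => c1 _).
have is2 := integrable_osc iH2 (measurable_fun_sin (mpsi2 x)) (fun y => s1 _).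
have -> : cosint (tensor m1 m2) (fun x z => psi1 x z.1 + psi2 x z.2) (fun z => H1 z.1 * H2 z.2) x =
    cosint m1 psi1 H1 x * cosint m2 psi2 H2 x - sinint m1 psi1 H1 x * sinint m2 psi2 H2 x.
  rewrite /cosint /sinint -!Rintegral_tensor// -RintegralB//; last 2 first.
  - exact: (integrable_tensor ic1 ic2).
  - exact: (integrable_tensor is1 is2).
  by apply: eq_Rintegral => z _; rewrite cosD; ring.
have -> : sinint (tensor m1 m2) (fun x z => psi1 x z.1 + psi2 x z.2) (fun z => H1 z.1 * H2 z.2) x =
    sinint m1 psi1 H1 x * cosint m2 psi2 H2 x + cosint m1 psi1 H1 x * sinint m2 psi2 H2 x.
  rewrite /cosint /sinint -!Rintegral_tensor// -RintegralD//; last 2 first.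
  - exact: (integrable_tensor is1 ic2).
  - exact: (integrable_tensor ic1 is2).
  by apply: eq_Rintegral => z _; rewrite sinD; ring.
ring.
Qed.

Lemma ge0_integral_tensorM (f1 : Y1 -> R) (f2 : Y2 -> R) :
  measurable_fun setT f1 -> measurable_fun setT f2 -> (forall y, 0 <= f1 y) -> (forall y, 0 <= f2 y) ->
  (\int[tensor m1 m2]_z (f1 z.1 * f2 z.2)%:E = (\int[m1]_y (f1 y)%:E) * \int[m2]_y (f2 y)%:E)%E.
Proof.
move=> mf1 mf2 f10 f20; rewrite ge0_integral_tensor; last 2 first.
- by mtac.
- by move=> z; rewrite lee_fin mulr_ge0.
have I0 : (0 <= \int[m2]_y (f2 y)%:E)%E by apply: integral_ge0 => y _; rewrite lee_fin.
transitivity (\int[m1]_y (\int[m2]_y (f2 y)%:E * (f1 y)%:E))%E.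
  apply: eq_integral => y _; rewrite muleC -ge0_intZl; last 3 first.
  - by mtac.
  - by move=> t; rewrite lee_fin.
  - by rewrite lee_fin.
  by apply: eq_integral => t _; rewrite EFinM.
rewrite ge0_intZl; last 3 first.
- by mtac.
- by move=> t; rewrite lee_fin.
- exact: I0.
by rewrite muleC.
Qed.
End osc_tensor.

Section cone_strichartz.
Context (R : realType).
Notation mu := (@lebesgue_measure R).
Notation lebR2 := (@lebR2 R).
Notation lebR3 := (@lebR3 R).

(* The constant [c] turns cosines into sines. *)
Definition cone_phase (a c : R) (x : R * R * R) (h : R * R) : R :=
  x.1.1 * h.1 + x.1.2 * h.2 + x.2 * (a * nrm2 h) + c.

(** The sixth power of the modulus is the squared modulus of the tensor cube [H3], to which the TT^*
    bound applies with Schur weight [om3], the product of the densities 1 / |h|. Its row sums are a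
    product of Poisson kernels integrated against the triple convolution of the cone. Dividing by
    [om3] is what puts |h| on the right side. *)
Lemma cone_strichartz (a c : R) (f : R * R -> R) : a != 0 ->
  lebR2.-integrable setT (EFin \o f) -> (forall h, nrm2 h = 0 -> f h = 0) ->
  (\int[lebR3]_x ((cosint lebR2 (cone_phase a c) f x ^+ 2 + sinint lebR2 (cone_phase a c) f x ^+ 2) ^+ 3)%:E <=
   ((2 * pi) ^+ 5 / `|a|)%:E * (\int[lebR2]_h (f h ^+ 2 * nrm2 h)%:E) ^+ 3)%E.
Proof.
move=> a0 iF F0.
have mf := measurable_int _ iF; move/measurable_EFinP in mf.
have mn : measurable_fun setT (@nrm2 R) by rewrite /nrm2; mtac.
pose p (x : R * R * R) (h : R * R) := cone_phase a c x h.
have mp : measurable_fun setT (fun z : (R * R * R) * (R * R) => p z.1 z.2) by rewrite /p /cone_phase; mtac.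
have mp1 x : measurable_fun setT (p x) by rewrite /p /cone_phase; mtac.
pose m3 := tensor lebR2 (tensor lebR2 lebR2).
pose p2 x (z : (R * R) * (R * R)) := p x z.1 + p x z.2.
pose p3 x (z : (R * R) * ((R * R) * (R * R))) := p x z.1 + p2 x z.2.
pose H2 (z : (R * R) * (R * R)) := f z.1 * f z.2.
pose H3 (z : (R * R) * ((R * R) * (R * R))) := f z.1 * H2 z.2.
pose om3 (z : (R * R) * ((R * R) * (R * R))) := (nrm2 z.1)^-1 * ((nrm2 z.2.1)^-1 * (nrm2 z.2.2)^-1).
have iH2 : (tensor lebR2 lebR2).-integrable setT (EFin \o H2) := integrable_tensor iF iF.
have iH3 : m3.-integrable setT (EFin \o H3) := integrable_tensor iF iH2.
have mp2 x : measurable_fun setT (p2 x) by have := mp1 x => mpx; rewrite /p2; mtac.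
have cubeE x : (cosint lebR2 (cone_phase a c) f x ^+ 2 + sinint lebR2 (cone_phase a c) f x ^+ 2) ^+ 3 =
    cosint m3 p3 H3 x ^+ 2 + sinint m3 p3 H3 x ^+ 2.
  have E2 := @osc_tensor_sqr _ _ _ _ _ _ R lebR2 lebR2 p p f f mp1 mp1 iF iF x.
  have E3 := @osc_tensor_sqr _ _ _ _ _ _ R lebR2 (tensor lebR2 lebR2) p p2 f H2 mp1 mp2 iF iH2 x.
  rewrite exprS expr2; apply: esym; apply: etrans E3 _; congr (_ * _); exact: E2.
under eq_integral do rewrite cubeE.
have B0 : 0 <= (2 * pi) ^+ 5 / `|a| by rewrite divr_ge0// exprn_ge0// mulr_ge0// pi_ge0.
have -> : ((\int[lebR2]_h (f h ^+ 2 * nrm2 h)%:E) ^+ 3 = \int[m3]_z (H3 z ^+ 2 / om3 z)%:E)%E.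
  have -> : (\int[m3]_z (H3 z ^+ 2 / om3 z)%:E = \int[m3]_z ((f z.1 ^+ 2 * nrm2 z.1) *
      ((f z.2.1 ^+ 2 * nrm2 z.2.1) * (f z.2.2 ^+ 2 * nrm2 z.2.2)))%:E)%E.
    by apply: eq_integral => z _; congr EFin; rewrite /H3 /H2 /om3 !invfM !invrK; ring.
  have q0 h : 0 <= f h ^+ 2 * nrm2 h by rewrite mulr_ge0 ?sqr_ge0 ?nrm2_ge0.
  rewrite (@ge0_integral_tensorM _ _ _ _ _ lebR2 (tensor lebR2 lebR2) (fun h => f h ^+ 2 * nrm2 h)
     (fun z => (f z.1 ^+ 2 * nrm2 z.1) * (f z.2 ^+ 2 * nrm2 z.2))); last 4 first.
  - by mtac.
  - by mtac.
  - by [].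
  - by move=> y; rewrite mulr_ge0.
  rewrite (@ge0_integral_tensorM _ _ _ _ _ lebR2 lebR2 (fun h => f h ^+ 2 * nrm2 h) (fun h => f h ^+ 2 * nrm2 h)); last 4 first.
  - by mtac.
  - by mtac.
  - by [].
  - by [].
  by rewrite !expeS expe0 mule1.
apply: (@ttstar_lim _ _ _ _ R lebR3 m3 p3 om3 H3 _ _ _ _ _ _ _ (fun n => expd3 (del R n))
   (fun n z z' => pker (del R n) (z.1.1 + (z.2.1.1 + z.2.2.1) - (z'.1.1 + (z'.2.1.1 + z'.2.2.1))) *
       pker (del R n) (z.1.2 + (z.2.1.2 + z.2.2.2) - (z'.1.2 + (z'.2.1.2 + z'.2.2.2))) *
       pker (del R n) (a * (nrm2 z.1 + (nrm2 z.2.1 + nrm2 z.2.2)) - a * (nrm2 z'.1 + (nrm2 z'.2.1 + nrm2 z'.2.2))))).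
- by rewrite /p3 /p2 /p /cone_phase; mtac.
- by rewrite /om3; mtac.
- exact: B0.
- by move=> z; rewrite /om3 !mulr_ge0// invr_ge0 nrm2_ge0.
- exact: iH3.
- move=> z /eqP; rewrite /om3 /H3 /H2 !mulf_eq0 !invr_eq0.
  by move=> /orP[/eqP/F0->|/orP[/eqP/F0->|/eqP/F0->]]; rewrite ?mul0r ?mulr0.
- by move=> n; exact: integrable_expd3 (del_gt0 R n).
- by move=> n x; rewrite /expd3 !mulr_ge0// expd_ge0.
- move=> n z z'; rewrite -Rintegral_expd3_cos ?del_gt0//.
  apply: eq_Rintegral => t _; congr (_ * cos _); rewrite /p3 /p2 /p /cone_phase; ring.
- move=> n z z'; have pk v := pker_ge0 v (ltW (del_gt0 R n)); apply: mulr_ge0; first apply: mulr_ge0; exact: pk.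
- move=> n z; set b1 := z.1.1 + _; set b2 := z.1.2 + _; set b3 := a * _.
  pose K (q : R * R * R) : \bar R := (pker (del R n) (b1 - q.1.1) * pker (del R n) (b2 - q.1.2) * pker (del R n) (b3 - a * q.2))%:E.
  have mK : measurable_fun setT K by rewrite /K /pker; mtac.
  have pk v := pker_ge0 v (ltW (del_gt0 R n)).
  have K0 q : (0 <= K q)%E by rewrite /K lee_fin; apply: mulr_ge0; first apply: mulr_ge0; exact: pk.
  have ni h : 0 <= (nrm2 h)^-1 :> R by rewrite invr_ge0 nrm2_ge0.
  rewrite ge0_integral_tensor; last 2 first.
  - by rewrite /om3 /pker; mtac.
  - by move=> y; rewrite lee_fin; apply: mulr_ge0; [apply: mulr_ge0; first apply: mulr_ge0; exact: pk|rewrite /om3 !mulr_ge0].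
  (* The factor 1 / |a| arises from the third Poisson kernel, whose argument is scaled by [a];
     altogether 4 pi^2 (2 pi)^3 / |a| = (2 pi)^5 / |a|. *)
  apply: (@le_trans _ _ ((4 * pi ^+ 2)%:E * \int[lebR3]_q K q)%E).
    apply: le_trans (cone_triple_bound mK K0).
    rewrite le_eqVlt; apply/orP; left; apply/eqP; apply: eq_integral => h1 _.
    rewrite ge0_integral_tensor; last 2 first.
    - by rewrite /om3 /pker; mtac.
    - by move=> y; rewrite lee_fin; apply: mulr_ge0; [apply: mulr_ge0; first apply: mulr_ge0; exact: pk|rewrite /om3 !mulr_ge0].
    rewrite -ge0_intZl; last 3 first.
    - by rewrite /K /pker; mtac.
    - by move=> y; rewrite mule_ge0 ?lee_fin//; apply: integral_ge0 => h3 _; rewrite mule_ge0// lee_fin.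
    - by rewrite lee_fin.
    apply: eq_integral => h2 _; rewrite -!ge0_intZl; last 6 first.
    - by rewrite /K /pker; mtac.
    - move=> y; apply: mule_ge0; first by rewrite lee_fin.
      by apply: mule_ge0; [rewrite lee_fin|exact: K0].
    - by rewrite lee_fin.
    - by rewrite /K /pker; mtac.
    - by move=> y; apply: mule_ge0; [rewrite lee_fin|exact: K0].
    - by rewrite lee_fin.
    apply: eq_integral => h3 _; rewrite /K /om3/= -!EFinM; congr EFin; ring.
  apply: (@le_trans _ _ ((4 * pi ^+ 2)%:E * ((2 * pi) ^+ 3 / `|a|)%:E)%E).
    apply: lee_wpmul2l; first by rewrite lee_fin mulr_ge0 ?sqr_ge0.
    exact: integral_pker3_le (del_gt0 R n) a0.
  rewrite -EFinM lee_fin le_eqVlt; apply/orP; left; apply/eqP; ring.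
- exact: cvg_expd3.
Qed.
End cone_strichartz.

(** * The estimate for integrable amplitudes *)
Section minkowski.
Context dx (X : measurableType dx) (R : realType) (m : {sigma_finite_measure set X -> \bar R}).

(** Pointwise inequality of arithmetic and geometric means for the normalized functions f_i / b_i,
    each of which has cube integral at most 1. *)
Lemma holder3_pos (f1 f2 f3 : X -> R) (b1 b2 b3 : R) :
  measurable_fun setT f1 -> measurable_fun setT f2 -> measurable_fun setT f3 ->
  (forall x, 0 <= f1 x) -> (forall x, 0 <= f2 x) -> (forall x, 0 <= f3 x) ->
  0 < b1 -> 0 < b2 -> 0 < b3 ->
  (\int[m]_x (f1 x ^+ 3)%:E <= (b1 ^+ 3)%:E)%E -> (\int[m]_x (f2 x ^+ 3)%:E <= (b2 ^+ 3)%:E)%E ->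
  (\int[m]_x (f3 x ^+ 3)%:E <= (b3 ^+ 3)%:E)%E ->
  (\int[m]_x (f1 x * (f2 x * f3 x))%:E <= (b1 * (b2 * b3))%:E)%E.
Proof.
move=> mf1 mf2 mf3 f10 f20 f30 b10 b20 b30 I1 I2 I3.
pose C := b1 * (b2 * b3) / 3.
have C0 : 0 < C by rewrite divr_gt0// !mulr_gt0.
pose g (f : X -> R) (b : R) x : \bar R := ((C / b ^+ 3)%:E * (f x ^+ 3)%:E)%E.
have g0 f b x : 0 < b -> (forall x, 0 <= f x) -> (0 <= g f b x)%E.
  by move=> b0 f0; rewrite /g mule_ge0// lee_fin ?exprn_ge0// divr_ge0 ?exprn_ge0// ltW.
have mg f b : measurable_fun setT f -> measurable_fun setT (g f b).
  by move=> mf; rewrite /g; mtac.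
apply: (@le_trans _ _ (\int[m]_x (g f1 b1 x + (g f2 b2 x + g f3 b3 x)))%E).
  apply: ge0_le_integral_mono => x; first by rewrite lee_fin !mulr_ge0.
  rewrite /g -!EFinM -!EFinD lee_fin.
  pose y1 := f1 x / b1; pose y2 := f2 x / b2; pose y3 := f3 x / b3.
  have y10 : 0 <= y1 by rewrite divr_ge0// ltW.
  have y20 : 0 <= y2 by rewrite divr_ge0// ltW.
  have y30 : 0 <= y3 by rewrite divr_ge0// ltW.
  have amgm : 3 * (y1 * y2 * y3) <= y1 ^+ 3 + y2 ^+ 3 + y3 ^+ 3.
    rewrite -subr_ge0 (_ : _ - _ = (y1 + y2 + y3) * ((y1 - y2) ^+ 2 + (y2 - y3) ^+ 2 + (y1 - y3) ^+ 2) / 2); last by field.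
    by rewrite divr_ge0// mulr_ge0 ?addr_ge0 ?sqr_ge0.
  have -> : f1 x * (f2 x * f3 x) = C * (3 * (y1 * y2 * y3)).
    by rewrite /C /y1 /y2 /y3; field; rewrite !lt0r_neq0.
  have -> : C / b1 ^+ 3 * f1 x ^+ 3 + (C / b2 ^+ 3 * f2 x ^+ 3 + C / b3 ^+ 3 * f3 x ^+ 3) = C * (y1 ^+ 3 + y2 ^+ 3 + y3 ^+ 3).
    by rewrite /y1 /y2 /y3; field; rewrite !lt0r_neq0.
  by rewrite ler_pM2l.
have gi (f : X -> R) (b : R) : measurable_fun setT f -> (forall x, 0 <= f x) -> 0 < b -> (\int[m]_x (f x ^+ 3)%:E <= (b ^+ 3)%:E)%E ->
   (\int[m]_x g f b x <= C%:E)%E.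
  move=> mf f0 b0 If; rewrite /g ge0_intZl; last 3 first.
  - by mtac.
  - by move=> x; rewrite lee_fin exprn_ge0.
  - by rewrite lee_fin divr_ge0 ?exprn_ge0// ltW.
  apply: (@le_trans _ _ ((C / b ^+ 3)%:E * (b ^+ 3)%:E)%E).
    by apply: lee_wpmul2l => //; rewrite lee_fin divr_ge0 ?exprn_ge0// ltW.
  by rewrite -EFinM divfK// expf_neq0// lt0r_neq0.
rewrite ge0_integralD; last 5 first.
- exact: measurableT.
- by move=> x _; exact: g0.
- exact: mg.
- by move=> x _; apply: adde_ge0; exact: g0.
- by apply: emeasurable_funD; exact: mg.
rewrite ge0_integralD; last 5 first.
- exact: measurableT.
- by move=> x _; exact: g0.
- exact: mg.
- by move=> x _; exact: g0.
- exact: mg.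
apply: (@le_trans _ _ (C%:E + (C%:E + C%:E))%E).
  by apply: leeD; [exact: gi|apply: leeD; exact: gi].
rewrite -!EFinD lee_fin le_eqVlt; apply/orP; left; apply/eqP; rewrite /C; by field.
Qed.

(** Vanishing bounds are reached by enlarging each b_i by a small [r]. The constant [C] dominates
    the coefficients in the expansion of the product, since r^2 and r^3 are at most r. *)
Lemma holder3 (f1 f2 f3 : X -> R) (b1 b2 b3 : R) :
  measurable_fun setT f1 -> measurable_fun setT f2 -> measurable_fun setT f3 ->
  (forall x, 0 <= f1 x) -> (forall x, 0 <= f2 x) -> (forall x, 0 <= f3 x) ->
  0 <= b1 -> 0 <= b2 -> 0 <= b3 ->
  (\int[m]_x (f1 x ^+ 3)%:E <= (b1 ^+ 3)%:E)%E -> (\int[m]_x (f2 x ^+ 3)%:E <= (b2 ^+ 3)%:E)%E ->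
  (\int[m]_x (f3 x ^+ 3)%:E <= (b3 ^+ 3)%:E)%E ->
  (\int[m]_x (f1 x * (f2 x * f3 x))%:E <= (b1 * (b2 * b3))%:E)%E.
Proof.
move=> mf1 mf2 mf3 f10 f20 f30 b10 b20 b30 I1 I2 I3.
apply/lee_addgt0Pr => e e0; rewrite -EFinD.
pose C := b1 * b2 + b1 * b3 + b2 * b3 + (b1 + b2 + b3) + 1.
have C1 : 1 <= C by rewrite lerDr !addr_ge0// mulr_ge0.
have C0 : 0 < C by exact: lt_le_trans C1.
pose r := Num.min 1 (e / C).
have r0 : 0 < r by rewrite lt_min ltr01 divr_gt0.
have r1 : r <= 1 by rewrite ge_min lexx.
have re : r * C <= e by rewrite -ler_pdivlMr// ge_min lexx orbT.
have Br b : 0 <= b -> ((b ^+ 3)%:E <= ((b + r) ^+ 3)%:E)%E.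
  by move=> b0; rewrite lee_fin lerXn2r ?nnegrE ?addr_ge0 ?lerDl// ltW.
have bp b : 0 <= b -> 0 < b + r by move=> b0; rewrite ltr_wpDl.
apply: (le_trans (holder3_pos mf1 mf2 mf3 f10 f20 f30 (bp _ b10) (bp _ b20) (bp _ b30)
   (le_trans I1 (Br _ b10)) (le_trans I2 (Br _ b20)) (le_trans I3 (Br _ b30)))).
rewrite lee_fin; apply: (@le_trans _ _ (b1 * (b2 * b3) + r * C)); last by rewrite lerD2l.
have r2 : r ^+ 2 <= r by rewrite expr2 ler_piMr// ltW.
have r3 : r ^+ 3 <= r by rewrite exprS ler_piMr ?exprn_ile1// ltW.
rewrite -subr_ge0 /C (_ : _ - _ = (r - r ^+ 2) * (b1 + b2 + b3) + (r - r ^+ 3)); last by ring.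
by rewrite addr_ge0 ?mulr_ge0 ?subr_ge0// !addr_ge0.
Qed.

(** The cube of the inner integral is an integral over triples in A^3. After Tonelli, each triple
    gives a product of three functions of x, handled by [holder3]; the resulting bounds factor again
    into a cube. *)
Lemma minkowski3 da (A : measurableType da) (n : {sigma_finite_measure set A -> \bar R}) (F : A -> X -> R) (b : A -> R) :
  measurable_fun setT (fun p : A * X => F p.1 p.2) -> (forall a x, 0 <= F a x) ->
  measurable_fun setT b -> (forall a, 0 <= b a) ->
  (forall a, \int[m]_x (F a x ^+ 3)%:E <= (b a ^+ 3)%:E)%E ->
  (\int[m]_x (\int[n]_a (F a x)%:E) ^+ 3 <= (\int[n]_a (b a)%:E) ^+ 3)%E.
Proof.
move=> mF F0 mb b0 Fb; pose n3 := tensor n (tensor n n).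
have mF2 d (T : measurableType d) (u : T -> A) (v : T -> X) : measurable_fun setT u -> measurable_fun setT v ->
    measurable_fun setT (fun t => F (u t) (v t)).
  by move=> mu' mv; apply: (measurableT_comp mF (g := fun t => (u t, v t))); mtac.
have mFx x : measurable_fun setT (F^~ x) by apply: mF2; mtac.
have mFa a : measurable_fun setT (F a) by apply: mF2; mtac.
have cube (g : A -> R) : measurable_fun setT g -> (forall a, 0 <= g a) ->
   ((\int[n]_a (g a)%:E) ^+ 3 = \int[n3]_z (g z.1 * (g z.2.1 * g z.2.2))%:E)%E.
  move=> mg g0.
  rewrite (@ge0_integral_tensorM _ _ _ _ _ n (tensor n n) g (fun z => g z.1 * g z.2)); last 4 first.
  - exact: mg.
  - by mtac.
  - exact: g0.
  - by move=> y; rewrite mulr_ge0.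
  rewrite (@ge0_integral_tensorM _ _ _ _ _ n n g g); last 4 first.
  - exact: mg.
  - exact: mg.
  - exact: g0.
  - exact: g0.
  by rewrite !expeS expe0 mule1.
rewrite cube; last 2 first.
- exact: mb.
- exact: b0.
have -> : (\int[m]_x (\int[n]_a (F a x)%:E) ^+ 3 = \int[m]_x \int[n3]_z (F z.1 x * (F z.2.1 x * F z.2.2 x))%:E)%E.
  by apply: eq_integral => x _; apply: cube.
rewrite (@ge0_integral_swap _ _ _ _ _ m n3 (fun x z => (F z.1 x * (F z.2.1 x * F z.2.2 x))%:E)); last 2 first.
- by mtac; apply: mF2; mtac.
- by move=> x z; rewrite lee_fin !mulr_ge0.
apply: ge0_le_integral_mono => z; first by apply: integral_ge0 => x _; rewrite lee_fin !mulr_ge0.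
by apply: holder3.
Qed.
End minkowski.

(** * Slicing frequency space by the cones xi_3 = a |h| *)

Section cone_coordinates.
Context (R : realType).
Notation mu := (@lebesgue_measure R).
Notation lebR2 := (@lebR2 R).
Notation lebR3 := (@lebR3 R).

Definition conept (a : R) (h : R * R) : R * R * R := (h.1, h.2, a * nrm2 h).

(** At fixed h the substitution xi_3 = a |h| has Jacobian |h|. The axis h = 0 is not covered by
    these coordinates, hence the vanishing of [F] on it. *)
Lemma ge0_integral_cone_coord (F : R * R * R -> \bar R) : measurable_fun setT F -> (forall q, 0 <= F q)%E ->
  (forall q : R * R * R, nrm2 q.1 = 0%R -> F q = 0%E) ->
  (\int[lebR3]_q F q = \int[mu]_a \int[lebR2]_h (F (conept a h) * (nrm2 h)%:E))%E.
Proof.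
move=> mF F0 Fn.
have mn : measurable_fun setT (@nrm2 R) by rewrite /nrm2; mtac.
rewrite (@ge0_integral_swap _ _ _ _ _ mu lebR2 (fun a h => F (conept a h) * (nrm2 h)%:E)%E); last 2 first.
- by rewrite /conept; mtac.
- by move=> a h; rewrite mule_ge0// lee_fin nrm2_ge0.
rewrite ge0_integral_tensor; last 2 first.
- exact: mF.
- exact: F0.
apply: eq_integral => h _.
have [h0|hn] := eqVneq (nrm2 h) 0.
  rewrite integral0_eq; last by move=> z _; exact: Fn.
  by rewrite integral0_eq// => a _; rewrite h0 mule0.
have mFh : measurable_fun setT (fun z : R => F (h, z)) by mtac.
rewrite -[LHS]mul1e -(mulfV hn) EFinM -muleA -{2}(ger0_norm (nrm2_ge0 h)).
rewrite -(@integral_affine R (nrm2 h) 0 (fun z => F (h, z)))//.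
rewrite -ge0_intZl; last 3 first.
- by mtac.
- by move=> z.
- by rewrite lee_fin nrm2_ge0.
by apply: eq_integral => a _; rewrite /conept addr0 muleC mulrC -surjective_pairing.
Qed.

Variable G : R * R * R -> R.
Hypothesis iG : lebR3.-integrable setT (EFin \o G).
Hypothesis G0 : forall q, nrm2 q.1 = 0 -> G q = 0.

Lemma integrable_cone_coord :
  (tensor mu lebR2).-integrable setT (EFin \o (fun p : R * (R * R) => G (conept p.1 p.2) * nrm2 p.2)).
Proof.
have mn : measurable_fun setT (@nrm2 R) by rewrite /nrm2; mtac.
have mG := measurable_int _ iG; move/measurable_EFinP in mG.
have mGc : measurable_fun setT (fun p : R * (R * R) => G (conept p.1 p.2) * nrm2 p.2) by rewrite /conept; mtac.
apply/integrable_tensorP; first exact/measurable_EFinP.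
have -> : (\int[mu]_a \int[lebR2]_h `|(EFin \o (fun p : R * (R * R) => (G (conept p.1 p.2) * nrm2 p.2)%R)) (a, h)| =
    \int[mu]_a \int[lebR2]_h (`|G (conept a h)|%:E * (nrm2 h)%:E))%E.
  apply: eq_integral => a _; apply: eq_integral => h _ /=.
  by rewrite normrM EFinM (ger0_norm (nrm2_ge0 h)).
rewrite -(@ge0_integral_cone_coord (fun q => `|G q|%:E)); last 3 first.
- by mtac.
- by move=> q; rewrite lee_fin.
- by move=> q q0; rewrite G0// normr0.
by have /integrableP[_] := iG.
Qed.

(** For signed functions the inner integral is a real number, possibly a default value on slices
    that are not integrable. Restricting to [good] slices, almost all of them, makes every inner
    integral genuine. *)
Lemma Rintegral_cone_coord (good : R -> bool) : measurable_fun setT good ->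
  {ae mu, forall a, good a} ->
  (forall a, good a -> lebR2.-integrable setT (EFin \o (fun h => G (conept a h) * nrm2 h))) ->
  \int[lebR3]_q G q = \int[mu]_a \int[lebR2]_h ((good a)%:R * (G (conept a h) * nrm2 h)) :> R.
Proof.
move=> mgood gae gint.
have mn : measurable_fun setT (@nrm2 R) by rewrite /nrm2; mtac.
have mG := measurable_int _ iG; move/measurable_EFinP in mG.
have iC := integrable_cone_coord.
pose g (p : R * (R * R)) : \bar R := (G (conept p.1 p.2) * nrm2 p.2)%:E.
have mg : measurable_fun setT g by rewrite /g /conept; mtac.
have E : (\int[lebR3]_q (G q)%:E = \int[mu]_a \int[lebR2]_h g (a, h))%E.
  transitivity (\int[tensor mu lebR2]_p g p)%E; last exact: integral_tensor.
  rewrite [LHS]integralE [RHS]integralE; congr (_ - _)%E.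
    rewrite ge0_integral_cone_coord; last 3 first.
    - by apply: measurable_funepos; mtac.
    - by move=> q; exact: funepos_ge0.
    - by move=> q q0; rewrite funeposE G0// maxxx.
    rewrite ge0_integral_tensor; last 2 first.
    - exact: measurable_funepos.
    - by move=> q; exact: funepos_ge0.
    apply: eq_integral => a _; apply: eq_integral => h _.
    by rewrite !funeposE /g muleC maxe_pMr ?lee_fin ?nrm2_ge0// mule0 -EFinM mulrC.
  rewrite ge0_integral_cone_coord; last 3 first.
  - by apply: measurable_funeneg; mtac.
  - by move=> q; exact: funeneg_ge0.
  - by move=> q q0; rewrite funenegE G0// oppe0 maxxx.
  rewrite ge0_integral_tensor; last 2 first.
  - exact: measurable_funeneg.
  - by move=> q; exact: funeneg_ge0.
  apply: eq_integral => a _; apply: eq_integral => h _.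
  by rewrite !funenegE /g muleC maxe_pMr ?lee_fin ?nrm2_ge0// mule0 -EFinN -EFinM mulrN -EFinN mulrC.
rewrite [LHS]/Rintegral E; apply: (congr1 fine); apply: ae_eq_integral.
- exact: measurableT.
- by mtac.
- apply: measurable_fun_EFin.
  apply: (@measurable_fun_Rintegral _ R R _ _ lebR2 (fun x h => (good x)%:R * (G (conept x h) * nrm2 h))).
  by rewrite /conept; mtac.
- have [N [mN N0 subN]] := gae; exists N; split => // a /= na; apply: subN => /= ga; apply: na => _.
  under eq_Rintegral do rewrite ga mul1r.
  by rewrite /Rintegral fineK//; apply: integrable_fin_num => //; exact: gint.
Qed.
End cone_coordinates.

Section core.
Context (R : realType).
Notation mu := (@lebesgue_measure R).
Notation lebR2 := (@lebR2 R).
Notation lebR3 := (@lebR3 R).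

Lemma measurable_funlty d (T : measurableType d) (f : T -> \bar R) : measurable_fun setT f ->
  measurable_fun setT (fun x => (f x < +oo)%E).
Proof.
move=> mf; apply: (measurable_fun_bool true); rewrite setTI.
have -> : (fun x => (f x < +oo)%E) @^-1` [set true] = setT `&` f @^-1` [set x | (x < +oo)%E].
  by apply/seteqP; split => x /=; [move=> ->|case].
by apply: mf => //; rewrite -set_itvNyo; exact: emeasurable_itv.
Qed.

Lemma measurable_neqr d (T : measurableType d) (f : T -> R) (c : R) : measurable_fun setT f ->
  measurable_fun setT (fun x => f x != c).
Proof.
move=> mf; have -> : (fun x => f x != c) = (fun x => if f x == c then false else true).
  by apply/funext => x; case: eqP.
by apply: measurable_fun_ifT; [apply: measurable_fun_eqr; mtac|mtac|mtac].
Qed.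

Lemma ge0_integral_lty_ae d (T : measurableType d) (m : {measure set T -> \bar R}) (f : T -> \bar R) :
  measurable_fun setT f -> (forall x, 0 <= f x)%E -> (\int[m]_x f x < +oo)%E -> {ae m, forall x, (f x < +oo)%E}.
Proof.
move=> mf f0 If; have i : m.-integrable setT f.
  by apply/integrableP; split => //; under eq_integral do rewrite gee0_abs//.
have [N [mN N0 subN]] := integrable_ae measurableT i; exists N; split => // x /= nx.
by apply: subN => /= H; apply: nx; rewrite -ge0_fin_numE//; exact: H.
Qed.

(** [k] will be the signed reciprocal of eps; a shift [c] by a quarter period gives sines. *)
Definition sphase (k c t : R) (x xi : R * R * R) : R := dot x xi + t * (k * (xi.2 / enorm xi)) + c.

Definition amp (k c : R) (h : R * R * R -> R) (t : R) (x : R * R * R) : R :=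
  \int[lebR3]_xi (cos (sphase k c t x xi) * h xi).

Lemma measurable_amp (k c : R) (h : R * R * R -> R) : measurable_fun setT h ->
  measurable_fun setT (fun p : R * (R * R * R) => amp k c h p.1 p.2).
Proof.
move=> mh; apply: (@measurable_fun_Rintegral _ _ R _ _ lebR3 (fun p xi => cos (sphase k c p.1 p.2 xi) * h xi)).
by rewrite /sphase /enorm /dot; mtac.
Qed.

Lemma enorm_conept a (h : R * R) : enorm (conept a h) = nrm2 h * Num.sqrt (1 + a ^+ 2).
Proof.
rewrite -[nrm2 h in RHS]/(Num.sqrt _) -sqrtrM ?addr_ge0 ?sqr_ge0// /enorm; congr Num.sqrt.
rewrite /dot /conept/= -[X in _ = X * _](sqr_sqrtr (addr_ge0 (sqr_ge0 h.1) (sqr_ge0 h.2))) -/(nrm2 h).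
have : nrm2 h ^+ 2 = h.1 ^+ 2 + h.2 ^+ 2 by rewrite sqr_sqrtr// addr_ge0 ?sqr_ge0.
by move=> E; rewrite -!expr2 -E; ring.
Qed.

Lemma sphase_conept k c t x a h : nrm2 h != 0 ->
  sphase k c t x (conept a h) = t * (k * slope a) + cone_phase a c x h.
Proof.
move=> n0; rewrite /sphase enorm_conept /cone_phase /dot /slope/=.
have S0 : Num.sqrt (1 + a ^+ 2) != 0 by rewrite sqrtr_eq0 -ltNge ltr_pwDl ?sqr_ge0.
by field; rewrite S0 n0.
Qed.

Lemma cube_add_le (u v : R) : 0 <= u -> 0 <= v -> (u + v) ^+ 3 <= 4 * (u ^+ 3 + v ^+ 3).
Proof.
move=> u0 v0; rewrite -subr_ge0 (_ : _ - _ = 3 * (u + v) * (u - v) ^+ 2); last by ring.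
by rewrite mulr_ge0 ?sqr_ge0// mulr_ge0// addr_ge0.
Qed.

(** J is at most 8 times the larger of J1 and J2, and 64 = 8^2. *)
Lemma sqe_add_le (J J1 J2 K : \bar R) : (0 <= J)%E -> (0 <= J1)%E -> (0 <= J2)%E ->
  (J <= 4%:E * (J1 + J2))%E -> (J1 ^+ 2 <= K)%E -> (J2 ^+ 2 <= K)%E -> (J ^+ 2 <= 64%:E * K)%E.
Proof.
move=> J0 J10 J20 JJ K1 K2.
have fin_ (u : \bar R) : (0 <= u)%E -> (J <= 8%:E * u)%E -> (u ^+ 2 <= K)%E -> (J ^+ 2 <= 64%:E * K)%E.
  move=> u0 Ju uK; apply: (@le_trans _ _ (64%:E * u ^+ 2)%E); last exact: lee_wpmul2l.
  have -> : (64%:E * u ^+ 2 = (8%:E * u) * (8%:E * u))%E.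
    by rewrite expe2 muleACA -EFinM; congr (_%:E * _)%E; ring.
  by rewrite expe2; apply: lee_pmul.
have d8 (u : \bar R) : (4%:E * (u + u) = 8%:E * u)%E.
  by rewrite -[(u + u)%E]mule2n -mule_natl muleA -EFinM; congr (_%:E * _)%E; ring.
have [J12|/ltW J21] := leP J1 J2.
  by apply: (fin_ J2) => //; apply: (le_trans JJ); rewrite -d8; apply: lee_wpmul2l => //; exact: leeD.
by apply: (fin_ J1) => //; apply: (le_trans JJ); rewrite -d8; apply: lee_wpmul2l => //; exact: leeD.
Qed.

Section hyps.
Variables (k c : R) (hh : R * R * R -> R).
Hypothesis k0 : k != 0.
Hypothesis ih : lebR3.-integrable setT (EFin \o hh).
Hypothesis h0 : forall q, nrm2 q.1 = 0 -> hh q = 0.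
Let W := (\int[lebR3]_xi (hh xi ^+ 2 * enorm xi ^+ 2)%:E)%E.
Hypothesis Wfin : (W < +oo)%E.

Let mh : measurable_fun setT hh.
Proof. by have := measurable_int _ ih => /measurable_EFinP. Qed.
Let mn : measurable_fun setT (@nrm2 R).
Proof. by rewrite /nrm2; mtac. Qed.

Let f0 (a : R) (h : R * R) : R := hh (conept a h) * nrm2 h.
Let Nn (a : R) : \bar R := (\int[lebR2]_h `|f0 a h|%:E)%E.
Let Ma (a : R) : \bar R := (\int[lebR2]_h (f0 a h ^+ 2 * nrm2 h)%:E)%E.
(* [good] excludes a null set of slices, on which the integrals below could be junk. *)
Let good (a : R) : bool := (a != 0) && ((Nn a < +oo)%E && (Ma a < +oo)%E).
Let f (a : R) (h : R * R) : R := (good a)%:R * f0 a h.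
Let P (a : R) x := cosint lebR2 (cone_phase a c) (f a) x.
Let Q (a : R) x := sinint lebR2 (cone_phase a c) (f a) x.
Let F (a : R) x := wgt a * (P a x ^+ 2 + Q a x ^+ 2).

Let mf0 d (T : measurableType d) (u : T -> R) (v : T -> R * R) : measurable_fun setT u -> measurable_fun setT v ->
  measurable_fun setT (fun t => f0 (u t) (v t)).
Proof. by move=> mu' mv; rewrite /f0 /conept; mtac. Qed.

Let mNn : measurable_fun setT Nn.
Proof. by rewrite /Nn; mtac; apply: mf0; mtac. Qed.

Let mMa : measurable_fun setT Ma.
Proof. by rewrite /Ma; mtac; apply: mf0; mtac. Qed.

Let mgood : measurable_fun setT good.
Proof.
rewrite /good; apply: measurable_and; first by apply: measurable_neqr; mtac.
by apply: measurable_and; exact: measurable_funlty.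
Qed.

Let mf d (T : measurableType d) (u : T -> R) (v : T -> R * R) : measurable_fun setT u -> measurable_fun setT v ->
  measurable_fun setT (fun t => f (u t) (v t)).
Proof. by move=> mu' mv; rewrite /f; mtac; apply: mf0; mtac. Qed.

Let mP d (T : measurableType d) (u : T -> R) (v : T -> R * R * R) : measurable_fun setT u -> measurable_fun setT v ->
  measurable_fun setT (fun t => P (u t) (v t)).
Proof.
move=> mu' mv; rewrite /P /cosint.
apply: (@measurable_fun_Rintegral _ _ R _ _ lebR2 (fun t h => cos (cone_phase (u t) c (v t) h) * f (u t) h)).
by rewrite /cone_phase; mtac; apply: mf; mtac.
Qed.

Let mQ d (T : measurableType d) (u : T -> R) (v : T -> R * R * R) : measurable_fun setT u -> measurable_fun setT v ->
  measurable_fun setT (fun t => Q (u t) (v t)).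
Proof.
move=> mu' mv; rewrite /Q /sinint.
apply: (@measurable_fun_Rintegral _ _ R _ _ lebR2 (fun t h => sin (cone_phase (u t) c (v t) h) * f (u t) h)).
by rewrite /cone_phase; mtac; apply: mf; mtac.
Qed.

Let Nn0 a : (0 <= Nn a)%E. Proof. by apply: integral_ge0 => h _; rewrite lee_fin. Qed.
Let Ma0 a : (0 <= Ma a)%E.
Proof. by apply: integral_ge0 => h _; rewrite lee_fin mulr_ge0 ?sqr_ge0 ?nrm2_ge0. Qed.

(** On the slice |xi|^2 = |h|^2 (1 + a^2), and with the Jacobian this leaves |h|^3: two powers go
    into the square of [f0] and one remains in [Ma]. *)
Let WE : W = (\int[mu]_a ((1 + a ^+ 2)%:E * Ma a))%E.
Proof.
rewrite /W ge0_integral_cone_coord; last 3 first.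
- by rewrite /enorm /dot; mtac.
- by move=> q; rewrite lee_fin mulr_ge0 ?sqr_ge0.
- by move=> q q0; rewrite h0// expr0n/= mul0r.
apply: eq_integral => a _; rewrite /Ma -ge0_intZl; last 3 first.
- by mtac; apply: mf0; mtac.
- by move=> h; rewrite lee_fin mulr_ge0 ?sqr_ge0 ?nrm2_ge0.
- by rewrite lee_fin addr_ge0 ?sqr_ge0.
apply: eq_integral => h _; rewrite -!EFinM; congr EFin.
have S : Num.sqrt (1 + a ^+ 2) ^+ 2 = 1 + a ^+ 2 by rewrite sqr_sqrtr// addr_ge0 ?sqr_ge0.
rewrite enorm_conept exprMn S /f0; ring.
Qed.

Let iNn : (\int[mu]_a Nn a < +oo)%E.
Proof.
have iC := integrable_cone_coord ih h0.
have mC := measurable_int _ iC.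
have /integrable_tensorP := iC; move=> /(_ mC) => H.
apply: le_lt_trans H; rewrite le_eqVlt; apply/orP; left; apply/eqP.
by apply: eq_integral => a _; apply: eq_integral => h _.
Qed.

Let good_ae : {ae mu, forall a, good a}.
Proof.
have A1 := @ge0_integral_lty_ae _ _ (@lebesgue_measure R) _ mNn Nn0 iNn.
have A2 : {ae mu, forall a, (Ma a < +oo)%E}.
  apply: (@ge0_integral_lty_ae _ _ (@lebesgue_measure R) _ mMa Ma0); apply: le_lt_trans Wfin; rewrite WE.
  apply: ge0_le_integral_mono => // a; rewrite -[leLHS]mul1e lee_wpmul2r// lee_fin lerDl sqr_ge0//.
have [N1 [mN1 N10 s1]] := A1; have [N2 [mN2 N20 s2]] := A2; have [N3 [mN3 N30 s3]] := @ae_neq R 0.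
exists (N1 `|` N2 `|` N3); split; first by apply: measurableU => //; apply: measurableU.
  by rewrite !measureU0//; exact: measurableU.
move=> a /= na; apply: contrapT => /not_orP[/not_orP[n1 n2] n3]; apply: na; rewrite /good.
apply/andP; split; first by apply: contrapT => H; apply: n3; apply: s3.
by apply/andP; split; apply: contrapT => H; [apply: n1; apply: s1|apply: n2; apply: s2].
Qed.

Let if_ a : lebR2.-integrable setT (EFin \o f a).
Proof.
have mfa : measurable_fun setT (f a) by apply: mf; mtac.
apply/integrableP; split; first exact/measurable_EFinP.
rewrite (_ : (\int[lebR2]_x `|(EFin \o f a) x| = (good a)%:R%:E * Nn a)%E); last first.
  rewrite /Nn -ge0_intZl; last 3 first.
  - by mtac; apply: mf0; mtac.
  - by move=> h; rewrite lee_fin.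
  - by rewrite lee_fin.
  by apply: eq_integral => h _; rewrite /= /f normrM EFinM (ger0_norm (ler0n _ _)).
case G: (good a); last by rewrite mul0e ltry.
by rewrite mul1e; move: G => /andP[_ /andP[]].
Qed.

Let f_n0 a h : nrm2 h = 0 -> f a h = 0.
Proof. by rewrite /f /f0 => ->; rewrite !mulr0. Qed.

Let le_trig (u : R * R -> R) a : measurable_fun setT u -> (forall h, `|u h| <= 1) ->
  (`|\int[lebR2]_h (u h * f a h)|%:E <= Nn a)%E.
Proof.
move=> mu1 u1; have iO := integrable_osc (if_ a) mu1 u1.
rewrite EFin_normr_Rintegral//.
apply: (le_trans (le_abse_integral _ measurableT (measurable_int _ iO))).
apply: ge0_le_integral_mono => h; first exact: abse_ge0.
rewrite lee_fin !normrM (ger0_norm (ler0n _ _)) -[leRHS]mul1r ler_pM//.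
by rewrite ler_piMl// lern1 leq_b1.
Qed.

Let iP x : mu.-integrable setT (EFin \o (P^~ x)).
Proof.
have mPx : measurable_fun setT (P^~ x) by apply: mP; mtac.
apply/integrableP; split; first exact/measurable_EFinP.
apply: le_lt_trans iNn; apply: ge0_le_integral_mono => a; first exact: abse_ge0.
by apply: le_trig; [rewrite /cone_phase; mtac|move=> h; rewrite ler_norml cos_geN1 cos_le1].
Qed.

Let iQ x : mu.-integrable setT (EFin \o (Q^~ x)).
Proof.
have mQx : measurable_fun setT (Q^~ x) by apply: mQ; mtac.
apply/integrableP; split; first exact/measurable_EFinP.
apply: le_lt_trans iNn; apply: ge0_le_integral_mono => a; first exact: abse_ge0.
by apply: le_trig; [rewrite /cone_phase; mtac|move=> h; rewrite ler_norml sin_geN1 sin_le1].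
Qed.

Let bad_zero a x : good a = false -> P a x = 0 /\ Q a x = 0.
Proof.
by move=> ga; split; rewrite /P /Q /cosint /sinint /Rintegral integral0_eq// => h _; rewrite /f ga mul0r mulr0.
Qed.

(** Makes [P] and [Q] vanish at a = 0, as the estimate in time requires of its density. *)
Let good0 : good 0 = false. Proof. by rewrite /good eqxx. Qed.

(** On the slice the phase is t k slope a plus the phase of the cone. The addition formula separates
    the two, and - sin u = cos (u + pi / 2) makes both terms cosine integrals in a, with densities
    [P] and [Q] at the point x. *)
Let ampE t x : amp k c hh t x =
  cosint mu (fun t a : R => t * (k * slope a) + 0) (P^~ x) t +
  cosint mu (fun t a : R => t * (k * slope a) + pi / 2) (Q^~ x) t.
Proof.
pose G xi := cos (sphase k c t x xi) * hh xi.
have msp : measurable_fun setT (sphase k c t x) by rewrite /sphase /enorm /dot; mtac.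
have iG : lebR3.-integrable setT (EFin \o G).
  by apply: (integrable_osc ih); [mtac|move=> y; rewrite ler_norml cos_geN1 cos_le1].
have G0 q : nrm2 q.1 = 0 -> G q = 0 by move=> q0; rewrite /G h0// mulr0.
have Ge a h : (good a)%:R * (G (conept a h) * nrm2 h) =
    cos (t * (k * slope a)) * (cos (cone_phase a c x h) * f a h) -
    sin (t * (k * slope a)) * (sin (cone_phase a c x h) * f a h).
  have [n0|n0] := eqVneq (nrm2 h) 0; first by rewrite f_n0// n0 !mulr0 subrr.
  by rewrite /G sphase_conept// cosD /f /f0; ring.
have mcp a : measurable_fun setT (cone_phase a c x) by rewrite /cone_phase; mtac.
have ic a : lebR2.-integrable setT (EFin \o (fun h => cos (cone_phase a c x h) * f a h)).
  by apply: (integrable_osc (if_ a)); [have := mcp a => m; mtac|move=> y; rewrite ler_norml cos_geN1 cos_le1].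
have is_ a : lebR2.-integrable setT (EFin \o (fun h => sin (cone_phase a c x h) * f a h)).
  by apply: (integrable_osc (if_ a)); [have := mcp a => m; mtac|move=> y; rewrite ler_norml sin_geN1 sin_le1].
rewrite /amp -/(G _).
rewrite (@Rintegral_cone_coord _ G iG G0 good mgood good_ae); last first.
  move=> a ga; have -> : (fun h => G (conept a h) * nrm2 h) = (fun h => cos (sphase k c t x (conept a h)) * f a h).
    by apply/funext => h; rewrite /f ga mul1r /G /f0; ring.
  apply: (integrable_osc (if_ a)); last by move=> y; rewrite ler_norml cos_geN1 cos_le1.
  by rewrite /sphase /enorm /dot /conept; mtac.
rewrite /cosint -RintegralD//; last 2 first.
- apply: (integrable_osc (iP x)); last by move=> y; rewrite ler_norml cos_geN1 cos_le1.
  by mtac; apply: measurable_slope; mtac.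
- apply: (integrable_osc (iQ x)); last by move=> y; rewrite ler_norml cos_geN1 cos_le1.
  by mtac; apply: measurable_slope; mtac.
apply: eq_Rintegral => a _; under eq_Rintegral do rewrite Ge.
rewrite RintegralB//; last 2 first.
- exact: (integrableZl measurableT _ (ic a)).
- exact: (integrableZl measurableT _ (is_ a)).
by rewrite !RintegralZl// addr0 cosDpihalf mulNr.
Qed.

(** Bound for the L^3 norm of [F a]. The cone estimate gives (2 pi)^(5/3); the exponent is rounded
    up to 2 to avoid a cube root. *)
Let b (a : R) : R := (2 * pi) ^+ 2 * ((1 + a ^+ 2) * ((good a)%:R * fine (Ma a))).

Let b0 a : 0 <= b a.
Proof.
rewrite /b; apply: mulr_ge0; first exact: sqr_ge0.
apply: mulr_ge0; first by rewrite addr_ge0 ?sqr_ge0.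
by rewrite mulr_ge0// fine_ge0.
Qed.

Let F0 a x : 0 <= F a x.
Proof. by rewrite /F mulr_ge0 ?wgt_ge0 ?addr_ge0 ?sqr_ge0. Qed.

(** The cube of the weight is |a| (1 + a^2)^3, whose |a| cancels the 1 / |a| of the cone estimate:
    this determines the exponent 1/3 in [wgt]. *)
Let F_cube a : (\int[lebR3]_x (F a x ^+ 3)%:E <= (b a ^+ 3)%:E)%E.
Proof.
case ga: (good a); last first.
  rewrite integral0_eq ?lee_fin ?exprn_ge0// => x _.
  by rewrite /F; have [-> ->] := bad_zero x ga; rewrite expr0n/= addr0 mulr0 expr0n.
have a0 : a != 0 by move: ga => /andP[].
have Mfin : Ma a \is a fin_num by rewrite ge0_fin_numE//; move: ga => /andP[_ /andP[]].
have Fe x : ((F a x ^+ 3)%:E = (wgt a ^+ 3)%:E * ((P a x ^+ 2 + Q a x ^+ 2) ^+ 3)%:E)%E.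
  by rewrite -EFinM; congr EFin; rewrite /F exprMn.
under eq_integral do rewrite Fe.
rewrite ge0_intZl; last 3 first.
- by mtac; [apply: mP; mtac|apply: mQ; mtac].
- by move=> x; rewrite lee_fin exprn_ge0// addr_ge0 ?sqr_ge0.
- by rewrite lee_fin exprn_ge0// wgt_ge0.
have CS := @cone_strichartz R a c (f a) a0 (if_ a) (f_n0 a).
apply: (@le_trans _ _ ((wgt a ^+ 3)%:E * (((2 * pi) ^+ 5 / `|a|)%:E * (Ma a) ^+ 3))%E).
  apply: lee_wpmul2l; first by rewrite lee_fin exprn_ge0// wgt_ge0.
  apply: (le_trans CS); rewrite le_eqVlt; apply/orP; left; apply/eqP; congr (_ * _ ^+ 3)%E.
  by apply: eq_integral => h _; rewrite /f ga mul1r.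
rewrite -(fineK Mfin) -EFin_expe -!EFinM lee_fin /b ga mul1r.
have p1 : 1 <= 2 * pi :> R by have := pi_ge2 R; lra.
have E : wgt a ^+ 3 = `|a| * (1 + a ^+ 2) ^+ 3.
  rewrite /wgt exprMn; congr (_ * _).
  by rewrite -powR_mulrn ?powR_ge0// -powRrM mulVf// powRr1.
rewrite E (_ : `|a| * (1 + a ^+ 2) ^+ 3 * ((2 * pi) ^+ 5 / `|a| * fine (Ma a) ^+ 3) =
   (2 * pi) ^+ 5 * ((1 + a ^+ 2) * fine (Ma a)) ^+ 3); last by field; rewrite normr_eq0.
rewrite [leRHS]exprMn -exprM; apply: ler_wpM2r.
  by rewrite exprn_ge0// mulr_ge0 ?fine_ge0// addr_ge0 ?sqr_ge0.
by rewrite (exprS _ 5) ler_peMl// exprn_ge0//; lra.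
Qed.

Let Fint : (\int[lebR3]_x (\int[mu]_a (F a x)%:E) ^+ 3 <= (((2 * pi) ^+ 2)%:E * W) ^+ 3)%E.
Proof.
apply: (@le_trans _ _ ((\int[mu]_a (b a)%:E) ^+ 3)%E).
  apply: (@minkowski3 _ _ R lebR3 _ _ (@lebesgue_measure R) F b) => //.
  - by rewrite /F /wgt; mtac; [apply: mP; mtac|apply: mQ; mtac].
  - rewrite /b; mtac; apply: (measurableT_comp (@fine_measurable R setT measurableT)); exact: mMa.
have I0 : (0 <= \int[mu]_a (b a)%:E)%E by apply: integral_ge0 => a _; rewrite lee_fin.
suff L : (\int[mu]_a (b a)%:E <= ((2 * pi) ^+ 2)%:E * W)%E.
  by rewrite !expeS expe0 !mule1; apply: lee_pmul => //; [exact: mule_ge0|apply: lee_pmul].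
rewrite WE -ge0_intZl; last 3 first.
- by mtac.
- by move=> a; rewrite mule_ge0// lee_fin addr_ge0 ?sqr_ge0.
- by rewrite lee_fin sqr_ge0.
apply: ge0_le_integral_mono => a; first by rewrite lee_fin.
rewrite /b EFinM; apply: lee_wpmul2l; first by rewrite lee_fin sqr_ge0.
rewrite EFinM; apply: lee_wpmul2l; first by rewrite lee_fin addr_ge0 ?sqr_ge0.
case ga: (good a); last by rewrite mul0r.
by rewrite mul1r fineK// ge0_fin_numE//; move: ga => /andP[_ /andP[]].
Qed.

(** The constant collects 64 from splitting the amplitude into two cosine integrals, (144 pi / k)^2
    from the time estimate at each x, and (2 pi)^6 from the cube of the bound in [Fint]. *)
Lemma amp_bound_fin :
  (\int[lebR3]_x (\int[mu]_t (`|amp k c hh t x| ^+ 3)%:E) ^+ 2 <=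
   (64 * (144 * pi / k) ^+ 2 * (2 * pi) ^+ 6)%:E * W ^+ 3)%E.
Proof.
pose C := 64 * (144 * pi / k) ^+ 2.
have C0 : 0 <= C by rewrite mulr_ge0 ?sqr_ge0.
apply: (@le_trans _ _ (\int[lebR3]_x (C%:E * (\int[mu]_a (F a x)%:E) ^+ 3))%E).
  apply: ge0_le_integral_mono => x; first by apply: expe_ge0; apply: integral_ge0 => t _; rewrite lee_fin exprn_ge0.
  pose A1 t := cosint mu (fun t a : R => t * (k * slope a) + 0) (P^~ x) t.
  pose A2 t := cosint mu (fun t a : R => t * (k * slope a) + pi / 2) (Q^~ x) t.
  have mA1 : measurable_fun setT A1.
    by rewrite /A1 /cosint; mtac; [apply: measurable_slope; mtac|apply: mP; mtac].
  have mA2 : measurable_fun setT A2.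
    by rewrite /A2 /cosint; mtac; [apply: measurable_slope; mtac|apply: mQ; mtac].
  pose J1 := (\int[mu]_t (`|A1 t| ^+ 3)%:E)%E; pose J2 := (\int[mu]_t (`|A2 t| ^+ 3)%:E)%E.
  have J10 : (0 <= J1)%E by apply: integral_ge0 => t _; rewrite lee_fin exprn_ge0.
  have J20 : (0 <= J2)%E by apply: integral_ge0 => t _; rewrite lee_fin exprn_ge0.
  pose M := (\int[mu]_a (F a x)%:E)%E.
  have M0 : (0 <= M)%E by apply: integral_ge0 => a _; rewrite lee_fin.
  have mono3 (u v : \bar R) : (0 <= u)%E -> (u <= v)%E -> (u ^+ 3 <= v ^+ 3)%E.
    move=> u0 uv; have v0 := le_trans u0 uv.
    by rewrite !expeS expe0 !mule1; apply: lee_pmul => //; [exact: mule_ge0|apply: lee_pmul].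
  have K1 : (J1 ^+ 2 <= ((144 * pi / k) ^+ 2)%:E * M ^+ 3)%E.
    apply: (le_trans (cosint_cube_sqr_le 0 k0 (iP x) (bad_zero x good0).1)).
    apply: lee_wpmul2l; first by rewrite lee_fin sqr_ge0.
    apply: mono3; first by apply: integral_ge0 => a _; rewrite lee_fin mulr_ge0 ?wgt_ge0 ?sqr_ge0.
    apply: ge0_le_integral_mono => a; first by rewrite lee_fin mulr_ge0 ?wgt_ge0 ?sqr_ge0.
    by rewrite lee_fin /F ler_wpM2l ?wgt_ge0// lerDl sqr_ge0.
  have K2 : (J2 ^+ 2 <= ((144 * pi / k) ^+ 2)%:E * M ^+ 3)%E.
    apply: (le_trans (cosint_cube_sqr_le (pi / 2) k0 (iQ x) (bad_zero x good0).2)).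
    apply: lee_wpmul2l; first by rewrite lee_fin sqr_ge0.
    apply: mono3; first by apply: integral_ge0 => a _; rewrite lee_fin mulr_ge0 ?wgt_ge0 ?sqr_ge0.
    apply: ge0_le_integral_mono => a; first by rewrite lee_fin mulr_ge0 ?wgt_ge0 ?sqr_ge0.
    by rewrite lee_fin /F ler_wpM2l ?wgt_ge0// lerDr sqr_ge0.
  pose J := (\int[mu]_t (`|amp k c hh t x| ^+ 3)%:E)%E.
  have J0 : (0 <= J)%E by apply: integral_ge0 => t _; rewrite lee_fin exprn_ge0.
  have JJ : (J <= 4%:E * (J1 + J2))%E.
    rewrite /J1 /J2 -ge0_integralD; last 5 first.
    - exact: measurableT.
    - by move=> t _; rewrite lee_fin exprn_ge0.
    - by mtac.
    - by move=> t _; rewrite lee_fin exprn_ge0.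
    - by mtac.
    rewrite -ge0_intZl; last 3 first.
    - by apply: emeasurable_funD; mtac.
    - by move=> t; rewrite adde_ge0// lee_fin exprn_ge0.
    - by [].
    apply: ge0_le_integral_mono => t; first by rewrite lee_fin exprn_ge0.
    rewrite -EFinD -EFinM lee_fin ampE -/(A1 t) -/(A2 t).
    apply: (@le_trans _ _ ((`|A1 t| + `|A2 t|) ^+ 3)).
      by rewrite lerXn2r ?nnegrE// ?ler_normD// addr_ge0.
    exact: cube_add_le.
  rewrite /C EFinM -muleA; exact: (sqe_add_le J0 J10 J20 JJ K1 K2).
have mF : measurable_fun setT (fun x => \int[mu]_a (F a x)%:E)%E.
  by rewrite /F /wgt; mtac; [apply: mP; mtac|apply: mQ; mtac].
rewrite ge0_intZl; last 3 first.
- exact: (measurable_fun_expe 3 mF).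
- by move=> x; apply: expe_ge0; apply: integral_ge0 => a _; rewrite lee_fin.
- by rewrite lee_fin.
rewrite (EFinM C) -muleA; apply: lee_wpmul2l; first by rewrite lee_fin.
apply: (le_trans Fint).
have Wf : W \is a fin_num.
  by rewrite ge0_fin_numE//; apply: integral_ge0 => xi _; rewrite lee_fin mulr_ge0 ?sqr_ge0.
rewrite -(fineK Wf) -EFinM -!EFin_expe -EFinM lee_fin le_eqVlt; apply/orP; left; apply/eqP; ring.
Qed.

End hyps.

Lemma amp_bound (k c : R) (hh : R * R * R -> R) : k != 0 -> lebR3.-integrable setT (EFin \o hh) ->
  (forall q, nrm2 q.1 = 0 -> hh q = 0) ->
  (\int[lebR3]_x (\int[mu]_t (`|amp k c hh t x| ^+ 3)%:E) ^+ 2 <=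
   (64 * (144 * pi / k) ^+ 2 * (2 * pi) ^+ 6)%:E * (\int[lebR3]_xi (hh xi ^+ 2 * enorm xi ^+ 2)%:E) ^+ 3)%E.
Proof.
move=> k0 ih h0; set W := (\int[lebR3]_xi (hh xi ^+ 2 * enorm xi ^+ 2)%:E)%E.
have [Wfin|] := ltP W +oo%E; first exact: amp_bound_fin.
rewrite leye_eq => /eqP ->; rewrite (_ : (+oo ^+ 3 = +oo :> \bar R)%E) ?gt0_muley ?leey// ?lte_fin.
have k2 : 0 < (144 * pi / k) ^+ 2.
  by rewrite exprn_even_gt0//= mulf_neq0 ?invr_neq0// lt0r_neq0// mulr_gt0// pi_gt0.
by apply: mulr_gt0; [apply: mulr_gt0|rewrite exprn_gt0// mulr_gt0// pi_gt0].
Qed.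
End core.

(** * Test functions and uniqueness *)
Section test_functions.
Context (R : realType).
Notation R3 := (R * R * R)%type.

Lemma differentiable_comp1 (f : R3 -> R) (g : R -> R) (dg : R) (x : R3) :
  differentiable f x -> is_derive (f x) 1 g dg ->
  differentiable (g \o f) x /\ forall v, 'D_v (g \o f) x = dg * 'D_v f x.
Proof.
move=> df [/derivable1_diffP dgf dgE].
have dc : differentiable (g \o f) x by apply: differentiable_comp.
split => // v; rewrite !deriveE// diff_comp//= -dgE deriveE//.
rewrite -[in LHS](mulr1 ('d f x v)) -[X in 'd g _ X = _]/('d f x v *: (1 : R)).
by rewrite linearZ /= mulrC.
Qed.

Definition coord (j : 'I_3) (x : R3) : R :=
  if j == 0 :> nat then x.1.1 else if j == 1 :> nat then x.1.2 else x.2.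

Lemma coord_linear j : linear (coord j).
Proof. by move=> a x y; rewrite /coord; case: ifP => // _; case: ifP. Qed.

Lemma coord_continuous j : continuous (coord j).
Proof.
have [E0|E0] := boolP (j == 0 :> nat); last have [E1|E1] := boolP (j == 1 :> nat).
- rewrite (_ : coord j = fst \o (fst : R3 -> R * R)); last by apply/funext => x; rewrite /coord E0.
  by move=> x; apply: continuous_comp; exact: cvg_fst.
- rewrite (_ : coord j = snd \o (fst : R3 -> R * R)); last by apply/funext => x; rewrite /coord (negbTE E0) E1.
  by move=> x; apply: continuous_comp; [exact: cvg_fst|exact: cvg_snd].
- rewrite (_ : coord j = snd); last by apply/funext => x; rewrite /coord (negbTE E0) (negbTE E1).
  by move=> x; exact: cvg_snd.
Qed.

HB.instance Definition _ j := GRing.isLinear.Build R R3 R *:%R (coord j) (coord_linear j).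

Lemma differentiable_coord j x : differentiable (coord j) x.
Proof. by apply: linear_differentiable; exact: coord_continuous. Qed.

Lemma derive_coord j x v : 'D_v (coord j) x = coord j v.
Proof. rewrite deriveE; last exact: differentiable_coord. by rewrite diff_lin//; exact: coord_continuous. Qed.

(** A smooth step with s' = s (1 - s): its derivatives are polynomials in itself, so adjoining it to
    the polynomials keeps the class of test functions closed under differentiation. *)
Definition sigmoid (u : R) : R := (1 + expR (- u))^-1.

Lemma is_derive_sigmoid (u : R) : is_derive u 1 sigmoid (sigmoid u * (1 - sigmoid u)).
Proof.
have E0 : 0 < 1 + expR (- u) by rewrite addr_gt0// expR_gt0.
have d1 : is_derive u 1 (fun u : R => 1 + expR (- u)) (- expR (- u)).
  by apply: is_derive_eq; rewrite /GRing.scale/=; ring.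
have d2 := @is_deriveV _ (fun u : R => 1 + expR (- u)) u _ 1 (lt0r_neq0 E0) d1.
apply: is_derive_eq; rewrite /GRing.scale/= /sigmoid; field; exact: lt0r_neq0.
Qed.

Lemma sigmoid_gt0 u : 0 < sigmoid u.
Proof. by rewrite invr_gt0 addr_gt0// expR_gt0. Qed.

Lemma sigmoid_le1 u : sigmoid u <= 1.
Proof. by rewrite invf_le1 ?lerDl ?expR_ge0// addr_gt0// expR_gt0. Qed.

(* Expressions closed under partial derivatives; [Sig j al be] is a sigmoid of [al * x_j + be]. *)
Inductive texp := Cst of R | Coo of 'I_3 | Sig of 'I_3 & R & R | Add of texp & texp | Mul of texp & texp.

Fixpoint tev (e : texp) (x : R3) : R := match e with
  | Cst r => r
  | Coo j => coord j x
  | Sig j al be => sigmoid (al * coord j x + be)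
  | Add e1 e2 => tev e1 x + tev e2 x
  | Mul e1 e2 => tev e1 x * tev e2 x
  end.

Fixpoint tder (i : 'I_3) (e : texp) : texp := match e with
  | Cst r => Cst 0
  | Coo j => Cst (coord j (basis R i))
  | Sig j al be => Mul (Cst (al * coord j (basis R i))) (Mul (Sig j al be) (Add (Cst 1) (Mul (Cst (-1)) (Sig j al be))))
  | Add e1 e2 => Add (tder i e1) (tder i e2)
  | Mul e1 e2 => Add (Mul (tder i e1) e2) (Mul e1 (tder i e2))
  end.

Lemma tev_derive e x : differentiable (tev e) x /\ forall i, 'D_(basis R i) (tev e) x = tev (tder i e) x.
Proof.
elim: e x => [r|j|j al be|e1 IH1 e2 IH2|e1 IH1 e2 IH2] x /=.
- by split => [|i]; [exact: differentiable_cst|rewrite derive_cst].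
- by split => [|i]; [exact: differentiable_coord|rewrite derive_coord].
- pose f : R3 -> R := (cst al * coord j) + cst be.
  have df0 : differentiable (cst al * coord j : R3 -> R) x.
    by apply: differentiableM; [exact: differentiable_cst|exact: differentiable_coord].
  have df : differentiable f x by apply: differentiableD => //; exact: differentiable_cst.
  have [dc dE] := differentiable_comp1 df (is_derive_sigmoid (f x)).
  split => // i; rewrite [LHS]dE /f deriveD; last 2 first.
  - exact: diff_derivable.
  - exact: diff_derivable.
  rewrite deriveM; last 2 first.
  - by apply: diff_derivable; exact: differentiable_cst.
  - by apply: diff_derivable; exact: differentiable_coord.
  rewrite !derive_cst derive_coord /GRing.scale/= !mulr0 !addr0 mulN1r mulrC.
  by rewrite /f /=.
- have [d1 E1] := IH1 x; have [d2 E2] := IH2 x.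
  split => [|i]; first exact: differentiableD.
  by rewrite -E1 -E2 [LHS]deriveD//; exact: diff_derivable.
- have [d1 E1] := IH1 x; have [d2 E2] := IH2 x.
  split => [|i]; first exact: differentiableM.
  rewrite -E1 -E2 [LHS]deriveM; [|exact: diff_derivable|exact: diff_derivable].
  by rewrite /GRing.scale/= addrC mulrC.
Qed.

Definition gauss (x : R3) : R := expR (- dot x x).

Definition qexp := Mul (Cst (-1)) (Add (Add (Mul (Coo ord0) (Coo ord0))
   (Mul (Coo (@Ordinal 3 1 isT)) (Coo (@Ordinal 3 1 isT)))) (Mul (Coo ord_max) (Coo ord_max))).

Lemma gaussE : gauss = expR \o tev qexp.
Proof. by apply/funext => x; rewrite /gauss /dot /= /coord/= mulN1r. Qed.

(** Product rule for e times the Gaussian, whose logarithm is [qexp]. *)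
Definition gder i e := Add (tder i e) (Mul e (tder i qexp)).

Lemma tgauss_derive e x : differentiable (fun x => tev e x * gauss x) x /\
  forall i, 'D_(basis R i) (fun x => tev e x * gauss x) x = tev (gder i e) x * gauss x.
Proof.
have [d1 E1] := tev_derive e x; have [dq Eq] := tev_derive qexp x.
have [d2 E2] := differentiable_comp1 dq (is_derive_expR (tev qexp x)).
have -> : (fun x => tev e x * gauss x) = (tev e * (expR \o tev qexp)).
  by rewrite gaussE; apply/funext => y.
split => [|i]; first exact: differentiableM.
rewrite deriveM; [|exact: diff_derivable|exact: diff_derivable].
by rewrite E1 E2 Eq /GRing.scale/= gaussE /=; ring.
Qed.

(** [partial] differentiates first along the last index of its list, which is why the inductions
    below run from the right end. *)
Lemma partial_rcons s i (f : R3 -> R) : partial (rcons s i) f = partial s (fun x => 'D_(basis R i) f x).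
Proof. by rewrite /partial foldr_rcons. Qed.

Lemma partial_tgauss s e : exists e', partial s (fun x => tev e x * gauss x) = (fun x => tev e' x * gauss x).
Proof.
elim/last_ind: s e => [|s i IH] e; first by exists e.
rewrite partial_rcons (_ : (fun x => _) = (fun x => tev (gder i e) x * gauss x)); first exact: IH.
by apply/funext => x; have [_ ->] := tgauss_derive e x.
Qed.

Lemma smooth_tgauss e : smooth (fun x => tev e x * gauss x).
Proof. by move=> s x; have [e' ->] := partial_tgauss s e; have [] := tgauss_derive e' x. Qed.

Lemma enorm_ge0 (x : R3) : 0 <= enorm x. Proof. exact: sqrtr_ge0. Qed.

Lemma dot_ge0 (x : R3) : 0 <= dot x x.
Proof. by rewrite /dot -!expr2 !addr_ge0 ?sqr_ge0. Qed.

Lemma enorm_sqr (x : R3) : enorm x ^+ 2 = dot x x.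
Proof. by rewrite sqr_sqrtr// dot_ge0. Qed.

Lemma coord_le_enorm j x : `|coord j x| <= enorm x.
Proof.
rewrite -sqrtr_sqr; apply: ler_wsqrtr; rewrite /coord /dot -!expr2.
by case: ifP => _; [|case: ifP => _]; have := sqr_ge0 x.1.1; have := sqr_ge0 x.1.2; have := sqr_ge0 x.2; lra.
Qed.

Lemma tev_bound e : exists K C, 0 <= C /\ forall x, `|tev e x| <= C * (1 + enorm x) ^+ K.
Proof.
have e1 (x : R3) : 1 <= 1 + enorm x by rewrite lerDl enorm_ge0.
elim: e => [r|j|j al be|e1' [K1 [C1 [C10 H1]]] e2 [K2 [C2 [C20 H2]]]|e1' [K1 [C1 [C10 H1]]] e2 [K2 [C2 [C20 H2]]]] /=.
- by exists 0%N, `|r|; split => // x; rewrite expr0 mulr1.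
- exists 1%N, 1; split => // x; rewrite mul1r expr1; apply: (le_trans (coord_le_enorm j x)).
  by rewrite lerDr.
- exists 0%N, 1; split => // x; rewrite mul1r expr0 ger0_norm ?sigmoid_le1//.
  exact: ltW (sigmoid_gt0 _).
- exists (maxn K1 K2), (C1 + C2); split; first exact: addr_ge0.
  move=> x; apply: (le_trans (ler_normD _ _)); rewrite mulrDl; apply: lerD.
    by apply: (le_trans (H1 x)); apply: ler_wpM2l => //; apply: ler_weXn2l => //; rewrite leq_maxl.
  by apply: (le_trans (H2 x)); apply: ler_wpM2l => //; apply: ler_weXn2l => //; rewrite leq_maxr.
- exists (K1 + K2)%N, (C1 * C2); split; first exact: mulr_ge0.
  by move=> x; rewrite normrM exprD mulrACA; apply: ler_pM.
Qed.

(** The inequality 1 + r <= (n + 1) exp (r / (n + 1)), raised to the power n + 1, gives a bound by a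
    multiple of [expR r], and r - r^2 <= 1. *)
Lemma gauss_bound n : exists M, forall x : R3, (1 + enorm x) ^+ n * gauss x <= M.
Proof.
exists (n.+1%:R ^+ n.+1 * expR 1) => x.
have r0 := enorm_ge0 x; set r := enorm x in r0 *.
have r1 : 1 <= 1 + r by rewrite lerDl.
have -> : gauss x = expR (- r ^+ 2) by rewrite /gauss -enorm_sqr.
have n0 : 0 < n.+1%:R :> R by [].
have H1 : 1 + r <= n.+1%:R * expR (r / n.+1%:R).
  apply: (@le_trans _ _ (n.+1%:R * (1 + r / n.+1%:R))).
    rewrite mulrDr mulr1 mulrC divfK ?lt0r_neq0// lerD2r.
    by rewrite ler1n.
  by apply: ler_wpM2l; [exact: ltW|exact: expR_ge1Dx].
have H2 : (1 + r) ^+ n.+1 <= n.+1%:R ^+ n.+1 * expR r.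
  have -> : expR r = expR (r / n.+1%:R) ^+ n.+1.
    by rewrite -expRM_natl -mulr_natl mulrC divfK ?lt0r_neq0.
  rewrite -exprMn lerXn2r// nnegrE; first exact: le_trans r1.
  by rewrite mulr_ge0 ?expR_ge0 ?ltW.
apply: (@le_trans _ _ ((1 + r) ^+ n.+1 * expR (- r ^+ 2))).
  by apply: ler_wpM2r; [exact: expR_ge0|apply: ler_weXn2l].
apply: (@le_trans _ _ (n.+1%:R ^+ n.+1 * expR r * expR (- r ^+ 2))).
  by apply: ler_wpM2r; [exact: expR_ge0|].
rewrite -mulrA -expRD; apply: ler_wpM2l; first by rewrite exprn_ge0// ltW.
rewrite ler_expR -subr_ge0 (_ : 1 - (r + - r ^+ 2) = (r - 1 / 2) ^+ 2 + 3 / 4); last by field.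
by rewrite addr_ge0 ?sqr_ge0.
Qed.

(** The weight exponent [N] stays fixed while the order of differentiation grows: each derivative of
    a test function is another one, so a bound for order n + 1 is the sum of a bound for the
    function itself and of the bounds for its three first derivatives at order n. *)
Lemma seminorm_tgauss N e : exists M, seminorm_le N M (fun x => tev e x * gauss x).
Proof.
suff H n : forall e, exists M, forall s x, (size s <= n)%N ->
    (1 + enorm x) ^+ N * `|partial s (fun x => tev e x * gauss x) x| <= M.
  exact: H.
elim: n => [|n IH] {}e.
  have [K [C [C0 HC]]] := tev_bound e; have [M HM] := gauss_bound (N + K).
  exists (C * M) => s x; rewrite leqn0 => /nilP -> /=.
  have g0 : 0 <= gauss x by exact: expR_ge0.
  rewrite normrM (ger0_norm g0).
  apply: (@le_trans _ _ (C * ((1 + enorm x) ^+ (N + K) * gauss x))); last exact: ler_wpM2l.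
  rewrite exprD (_ : C * _ = (1 + enorm x) ^+ N * (C * (1 + enorm x) ^+ K * gauss x)); last by ring.
  by apply: ler_wpM2l; [rewrite exprn_ge0// addr_ge0// enorm_ge0|apply: ler_wpM2r].
have [M0 H0] := IH e.
have {}IH i := IH (gder i e).
pose M i := sval (cid (IH i)); have HM i := svalP (cid (IH i)).
have M00 : 0 <= M0 by apply: le_trans (H0 [::] 0 isT); rewrite mulr_ge0// exprn_ge0// addr_ge0// enorm_ge0.
have Mi0 i : 0 <= M i by apply: le_trans (HM i [::] 0 isT); rewrite mulr_ge0// exprn_ge0// addr_ge0// enorm_ge0.
exists (M0 + \sum_i M i); elim/last_ind => [|s i _] x.
  by move=> _; apply: (le_trans (H0 [::] x isT)); rewrite lerDl sumr_ge0.
rewrite size_rcons ltnS => sn; rewrite partial_rcons.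
rewrite (_ : (fun x => 'D__ _ _) = (fun x => tev (gder i e) x * gauss x)); last first.
  by apply/funext => y; have [_ ->] := tgauss_derive e y.
apply: (le_trans (HM i s x sn)); rewrite (bigD1 i)//= addrCA lerDl addr_ge0// sumr_ge0//.
Qed.

Definition realfun (f : R3 -> R) (x : R3) : complex R := Complex (f x) 0.

Lemma schwartz_tgauss e : schwartz (realfun (fun x => tev e x * gauss x)).
Proof.
have z : (fun x : R3 => complex.Im (realfun (fun x => tev e x * gauss x) x)) = (fun x => tev (Cst 0) x * gauss x).
  by apply/funext => x /=; rewrite mul0r.
split; first exact: smooth_tgauss.
  by rewrite z; exact: smooth_tgauss.
move=> N; have [M1 H1] := seminorm_tgauss N e; have [M2 H2] := seminorm_tgauss N (Cst 0).
exists (Num.max M1 M2); split; first by move=> s x sN; rewrite le_max; apply/orP; left; exact: H1.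
by rewrite z; move=> s x sN; rewrite le_max; apply/orP; right; exact: H2.
Qed.

End test_functions.

(** * Quadrants as a determining class *)

Section quadrants.
Context (R : realType).
Notation mu := (@lebesgue_measure R).
Notation lebR3 := (@lebR3 R).
Notation R3 := (R * R * R)%type.

Definition quadrant (c : R3) : set R3 := [set x | x.1.1 <= c.1.1 /\ x.1.2 <= c.1.2 /\ x.2 <= c.2].
Definition quadrants : set (set R3) := [set A | exists c, A = quadrant c].

Lemma quadrants_setI : setI_closed quadrants.
Proof.
move=> _ _ [a ->] [b ->]; exists (Num.min a.1.1 b.1.1, Num.min a.1.2 b.1.2, Num.min a.2 b.2).
apply/seteqP; split => x /=; rewrite /quadrant/= !le_min.
  by move=> [[-> [-> ->]] [-> [-> ->]]].
by move=> [/andP[-> ->] [/andP[-> ->] /andP[-> ->]]].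
Qed.

Lemma measurable_quadrant c : measurable (quadrant c).
Proof.
pose p (x : R3) := (x.1.1 <= c.1.1) && ((x.1.2 <= c.1.2) && (x.2 <= c.2)).
have mp : measurable_fun setT p by rewrite /p; mtac.
rewrite (_ : quadrant c = p @^-1` [set true]); first by rewrite -[X in measurable X]setTI; exact: mp.
by apply/seteqP; split => x /=; rewrite /p /quadrant/=; [move=> [-> [-> ->]]|move=> /andP[-> /andP[-> ->]]].
Qed.

Lemma nat_ge_norm (r : R) : exists n, forall m, (n <= m)%N -> `|r| <= m%:R.
Proof.
exists (Num.bound `|r|) => m nm; apply: ltW.
by apply: (lt_le_trans (archi_boundP _)); rewrite ?ler_nat.
Qed.

Lemma quadrant_cover : \bigcup_n quadrant (n%:R, n%:R, n%:R) = setT.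
Proof.
apply/seteqP; split => // x _.
have [n1 H1] := nat_ge_norm x.1.1; have [n2 H2] := nat_ge_norm x.1.2; have [n3 H3] := nat_ge_norm x.2.
exists (maxn n1 (maxn n2 n3)) => //; rewrite /quadrant/=.
by do 2?split; apply: (le_trans (ler_norm _)); [apply: H1|apply: H2|apply: H3]; rewrite ?leq_max ?leqnn ?orbT.
Qed.

Lemma measurable_fun_le_gen d (T : measurableType d) (f : T -> R) :
  (forall c, measurable [set x | f x <= c]) -> measurable_fun setT f.
Proof.
move=> mf; apply: (measurability _ (RGenOInfty.measurableE R)) => _ [_ [c ->] <-].
rewrite setTI (_ : f @^-1` `]c, +oo[ = ~` [set x | f x <= c]); first exact: measurableC.
apply/seteqP; split => x /=; rewrite in_itv/= andbT ltNge; first by move=> /negP.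
by move=> /negP.
Qed.

(** Half-spaces are countable unions of quadrants, so the three coordinates are measurable for the
    generated sigma-algebra; hence so is the identity map into the product space, which is the
    nontrivial inclusion. *)
Lemma measurable_quadrants : measurable = <<s quadrants >>.
Proof.
apply/seteqP; split; last first.
  apply: smallest_sub; first exact: sigma_algebra_measurable.
  by move=> _ [c ->]; exact: measurable_quadrant.
pose T := g_sigma_algebraType quadrants.
have mq c : (measurable : set (set T)) (quadrant c) by apply: sub_sigma_algebra; exists c.
have m1 : measurable_fun setT (fun x : T => (x : R3).1.1).
  apply: measurable_fun_le_gen => c.
  rewrite (_ : [set _ | _] = \bigcup_n (quadrant (c, n%:R, n%:R) : set T)); first by apply: bigcupT_measurable => n; exact: mq.
  apply/seteqP; split => x /=; last by move=> [n _] [].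
  have [n2 H2] := nat_ge_norm (x : R3).1.2; have [n3 H3] := nat_ge_norm (x : R3).2.
  exists (maxn n2 n3) => //; rewrite /quadrant/=.
  by do 2?split => //; apply: (le_trans (ler_norm _)); [apply: H2|apply: H3]; rewrite ?leq_max ?leqnn ?orbT.
have m2 : measurable_fun setT (fun x : T => (x : R3).1.2).
  apply: measurable_fun_le_gen => c.
  rewrite (_ : [set _ | _] = \bigcup_n (quadrant (n%:R, c, n%:R) : set T)); first by apply: bigcupT_measurable => n; exact: mq.
  apply/seteqP; split => x /=; last by move=> [n _] [_ []].
  have [n2 H2] := nat_ge_norm (x : R3).1.1; have [n3 H3] := nat_ge_norm (x : R3).2.
  exists (maxn n2 n3) => //; rewrite /quadrant/=.
  by do 2?split => //; apply: (le_trans (ler_norm _)); [apply: H2|apply: H3]; rewrite ?leq_max ?leqnn ?orbT.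
have m3 : measurable_fun setT (fun x : T => (x : R3).2).
  apply: measurable_fun_le_gen => c.
  rewrite (_ : [set _ | _] = \bigcup_n (quadrant (n%:R, n%:R, c) : set T)); first by apply: bigcupT_measurable => n; exact: mq.
  apply/seteqP; split => x /=; last by move=> [n _] [_ []].
  have [n2 H2] := nat_ge_norm (x : R3).1.1; have [n3 H3] := nat_ge_norm (x : R3).1.2.
  exists (maxn n2 n3) => //; rewrite /quadrant/=.
  by do 2?split => //; apply: (le_trans (ler_norm _)); [apply: H2|apply: H3]; rewrite ?leq_max ?leqnn ?orbT.
have mid : measurable_fun setT (fun x : T => (((x : R3).1.1, (x : R3).1.2), (x : R3).2)).
  by apply: measurable_fun_pair => //; apply: measurable_fun_pair.
move=> A mA; have := mid measurableT A mA; rewrite setTI.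
by rewrite (_ : _ @^-1` A = A)//; apply/seteqP; split => -[[x y] z].
Qed.

(* The positive and negative parts of [f] are densities of measures that agree on quadrants, a pi-system generating the Borel sets. *)
Lemma quadrant_ae0 (f : R3 -> R) : lebR3.-integrable setT (EFin \o f) ->
  (forall c, \int[lebR3]_(x in quadrant c) f x = 0) -> {ae lebR3, forall x, f x = 0}.
Proof.
move=> fi fc.
have mf := measurable_int _ fi; move/measurable_EFinP in mf.
pose fp x := (`|f x| + f x) / 2; pose fn x := (`|f x| - f x) / 2.
have fp0 x : 0 <= fp x by rewrite divr_ge0// -[f x in X in _ + X]opprK subr_ge0 -normrN ler_norm.
have fn0 x : 0 <= fn x by rewrite divr_ge0// subr_ge0 ler_norm.
have mfp : measurable_fun setT fp by rewrite /fp; mtac.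
have mfn : measurable_fun setT fn by rewrite /fn; mtac.
have fpn x : f x = fp x - fn x.
  by rewrite /fp /fn; field.
have ifp : lebR3.-integrable setT (EFin \o fp).
  apply: (le_integrable measurableT _ _ fi) => /=; first by mtac.
  by move=> x _; rewrite lee_fin (ger0_norm (fp0 x)) /fp ler_pdivrMr// mulr_natr mulr2n lerD2l ler_norm.
have ifn : lebR3.-integrable setT (EFin \o fn).
  apply: (le_integrable measurableT _ _ fi) => /=; first by mtac.
  by move=> x _; rewrite lee_fin (ger0_norm (fn0 x)) /fn ler_pdivrMr// mulr_natr mulr2n lerD2l -normrN ler_norm.
have mid : measurable_fun setT (fun x : R3 => x) by mtac.
pose m1 := wpush lebR3 mid mfp fp0; pose m2 := wpush lebR3 mid mfn fn0.
have sub A (g : R3 -> R) : measurable A -> lebR3.-integrable setT (EFin \o g) -> lebR3.-integrable A (EFin \o g).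
  by move=> mA; apply: integrableS.
have E : forall A : set R3, measurable A -> (\int[lebR3]_(x in A) (fp x)%:E = \int[lebR3]_(x in A) (fn x)%:E)%E.
  apply: (@measure_unique _ R _ quadrants (fun n => quadrant (n%:R, n%:R, n%:R)) measurable_quadrants quadrants_setI _ quadrant_cover m1 m2).
  - by move=> n; exists (n%:R, n%:R, n%:R).
  - move=> _ [c ->]; have mc := measurable_quadrant c.
    have := fc c; under eq_Rintegral do rewrite fpn.
    rewrite RintegralB//; [|exact: sub|exact: sub] => /eqP; rewrite subr_eq0 => /eqP H.
    change (\int[lebR3]_(x in quadrant c) (fp x)%:E = \int[lebR3]_(x in quadrant c) (fn x)%:E)%E.
    have F1 : (\int[lebR3]_(x in quadrant c) (fp x)%:E)%E \is a fin_num by apply: integrable_fin_num => //; exact: sub.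
    have F2 : (\int[lebR3]_(x in quadrant c) (fn x)%:E)%E \is a fin_num by apply: integrable_fin_num => //; exact: sub.
    by rewrite -(fineK F1) -(fineK F2); congr EFin; exact: H.
  - move=> n; change (\int[lebR3]_(x in quadrant (n%:R, n%:R, n%:R)) (fp x)%:E < +oo)%E.
    have mc := measurable_quadrant (n%:R, n%:R, n%:R).
    by apply: integrable_lty => //; exact: sub.
(* On this set the density [fn] vanishes and off it [fp] does; evaluating the two equal measures on
   the set and on its complement gives both total masses 0. *)
have mA : measurable [set x | 0 < f x].
  pose p (x : R3) := 0 < f x; have mp : measurable_fun setT p by rewrite /p; mtac.
  rewrite (_ : [set x | 0 < f x] = p @^-1` [set true]); first by rewrite -[X in measurable X]setTI; exact: mp.
  by apply/seteqP; split => x.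
have mT (g : R3 -> R) (A : set R3) : measurable A -> (forall x, 0 <= g x) -> (forall x, ~ A x -> g x = 0) -> (\int[lebR3]_x (g x)%:E = \int[lebR3]_(x in A) (g x)%:E)%E.
  move=> mA' g0 gA; rewrite [RHS]integral_mkcond; apply: eq_integral => x _; rewrite patchE.
  by case: ifPn => // /negP xA; rewrite gA// => Ax; apply: xA; rewrite inE.
have Z1 : (\int[lebR3]_x (fp x)%:E = 0)%E.
  rewrite (mT fp _ mA fp0); last by move=> x /negP; rewrite -leNgt => h; rewrite /fp ler0_norm// addNr mul0r.
  rewrite (E _ mA).
  by rewrite integral0_eq// => x /= h; rewrite /fn gtr0_norm// subrr mul0r.
have Z2 : (\int[lebR3]_x (fn x)%:E = 0)%E.
  rewrite (mT fn _ (measurableC mA) fn0); last first.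
    by move=> x /contrapT h; rewrite /fn gtr0_norm// subrr mul0r.
  rewrite -(E _ (measurableC mA)).
  by rewrite integral0_eq// => x /= /negP; rewrite -leNgt => h; rewrite /fp ler0_norm// addNr mul0r.
have Z : (\int[lebR3]_x `|(EFin \o f) x| = 0)%E.
  transitivity (\int[lebR3]_x ((fp x)%:E + (fn x)%:E))%E.
    apply: eq_integral => x _; rewrite -EFinD /fp /fn /=; congr EFin.
    by field.
  rewrite ge0_integralD; last 5 first.
  - exact: measurableT.
  - by move=> x _; rewrite lee_fin.
  - by mtac.
  - by move=> x _; rewrite lee_fin.
  - by mtac.
  by rewrite Z1 Z2 adde0.
have /(ae_eq_integral_abs _ measurableT (measurable_int _ fi)) [N [mN N0 sN]] := Z.
exists N; split => // x /= nx; apply: sN => /= h; apply: nx.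
by have [] := h Logic.I.
Qed.

(** Continuity refers to the product topology and measurability to the product sigma-algebra. The
    link is that an open set is a countable union of the boxes with rational centers and radii 1 /
    (n + 1) that it contains. *)
Lemma open_measurable_fun (f : R3 -> R) : continuous f -> measurable_fun setT f.
Proof.
move=> cf; apply: (measurability _ (RGenOInfty.measurableE R)) => _ [_ [c ->] <-].
rewrite setTI; set U := _ @^-1` _.
have oU : open U by apply: open_comp => //; exact: interval_open.
pose box (q1 q2 q3 : rat) (n : nat) : set R3 :=
  [set x | `|x.1.1 - ratr q1| < n.+1%:R^-1 /\ `|x.1.2 - ratr q2| < n.+1%:R^-1 /\ `|x.2 - ratr q3| < n.+1%:R^-1].
have mbox q1 q2 q3 n : measurable (box q1 q2 q3 n).
  pose p (x : R3) := (`|x.1.1 - ratr q1| < n.+1%:R^-1) && ((`|x.1.2 - ratr q2| < n.+1%:R^-1) && (`|x.2 - ratr q3| < n.+1%:R^-1)).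
  have mp : measurable_fun setT p by rewrite /p; mtac.
  rewrite (_ : box q1 q2 q3 n = p @^-1` [set true]); first by rewrite -[X in measurable X]setTI; exact: mp.
  by apply/seteqP; split => x /=; rewrite /p /box/=; [move=> [-> [-> ->]]|move=> /andP[-> /andP[-> ->]]].
rewrite (_ : U = \bigcup_q1 \bigcup_q2 \bigcup_q3 \bigcup_n [set x | box q1 q2 q3 n x /\ box q1 q2 q3 n `<=` U]).
  apply: bigcupT_measurable_rat => q1; apply: bigcupT_measurable_rat => q2; apply: bigcupT_measurable_rat => q3.
  apply: bigcupT_measurable => n.
  have [sU|nU] := pselect (box q1 q2 q3 n `<=` U).
    by rewrite (_ : [set x | _] = box q1 q2 q3 n)//; apply/seteqP; split => x /=; [case|].
  by rewrite (_ : [set x | _] = set0)//; apply/seteqP; split => x /=; [case|].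
apply/seteqP; split => x; last by move=> [q1 _ [q2 _ [q3 _ [n _ [bx sU]]]]]; exact: sU.
move=> Ux; have : nbhs x U by exact: open_nbhs_nbhs.
rewrite -nbhs_ballE => -[e /= e0 be].
pose n := Num.bound (2 / e).
have ne : 2 / n.+1%:R < e.
  rewrite ltr_pdivrMr// mulrC -ltr_pdivrMr//.
  apply: (lt_le_trans (archi_boundP _)); first by rewrite divr_ge0// ltW.
  by rewrite ler_nat.
have n0 : 0 < n.+1%:R^-1 :> R by rewrite invr_gt0.
have rq (r d : R) : 0 < d -> exists q : rat, `|r - ratr q| < d.
  move=> d0; have [|q] := @rat_in_itvoo R (r - d) (r + d); first by rewrite ltrBlDr -addrA ltrDl addr_gt0.
  by rewrite in_itv/= => /andP[h1 h2]; exists q; rewrite ltr_norml; apply/andP; split; lra.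
have [q1 h1] := rq x.1.1 _ n0; have [q2 h2] := rq x.1.2 _ n0; have [q3 h3] := rq x.2 _ n0.
exists q1 => //; exists q2 => //; exists q3 => //; exists n => //; split => //= y [k1 [k2 k3]].
have tri (a b q d : R) : 2 * d < e -> `|a - q| < d -> `|b - q| < d -> `|a - b| < e.
  by move=> de ha hb; have := ler_distD q a b; rewrite (distrC q b); lra.
apply: be; split; first split; rewrite /ball/=; [exact: tri ne h1 k1|exact: tri ne h2 k2|exact: tri ne h3 k3].
Qed.

End quadrants.

Section real_dominated_convergence.
Context d (T : measurableType d) (R : realType) (m : {measure set T -> \bar R}).

Lemma Rdominated_convergence (fn : nat -> T -> R) (f g : T -> R) :
  (forall n, measurable_fun setT (fn n)) -> measurable_fun setT f ->
  {ae m, forall x, fn^~ x @ \oo --> f x} -> m.-integrable setT (EFin \o g) ->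
  {ae m, forall x, forall n, `|fn n x| <= g x} ->
  m.-integrable setT (EFin \o f) /\ \int[m]_x fn n x @[n --> \oo] --> \int[m]_x f x.
Proof.
move=> mfn mf cf ig [N [mN N0 sN]].
have fg : {ae m, forall x n, setT x -> (`|(fn n x)%:E| <= (EFin \o g) x)%E}.
  exists N; split => // x /= nx; apply: sN => /= h; apply: nx => n _.
  by rewrite lee_fin; exact: h.
have [N' [mN' N'0 sN']] := cf.
have ff : {ae m, forall x, setT x -> (fun n => (fn n x)%:E) @ \oo --> (f x)%:E}.
  exists N'; split => // x /= nx; apply: sN' => /= h; apply: nx => _.
  by apply: cvg_EFin; [exact: nearW|exact: h].
have mfn' n : measurable_fun setT (fun x => (fn n x)%:E) by exact/measurable_EFinP.
have [i _ c] := @dominated_convergence _ _ _ m setT measurableT (fun n x => (fn n x)%:E) (EFin \o f) (EFin \o g)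
   mfn' (iffRL (measurable_EFinP _ _) mf) ff ig fg.
split=> //; apply: fine_cvg; rewrite /Rintegral fineK//; last exact: integrable_fin_num.
Qed.
End real_dominated_convergence.

Section test_uniqueness.
Context (R : realType).
Notation mu := (@lebesgue_measure R).
Notation lebR3 := (@lebR3 R).
Notation R3 := (R * R * R)%type.

Lemma cvg_harmonic_bound (a : nat -> R) (l : R) : (\forall n \near \oo, `|a n - l| <= n.+1%:R^-1) -> a @ \oo --> l.
Proof.
move=> H; have h := @cvg_harmonic R.
have c1 : (fun n => l - harmonic n) @ \oo --> l.
  by rewrite -[X in _ --> X]subr0; apply: cvgB => //; exact: cvg_cst.
have c2 : (fun n => l + harmonic n) @ \oo --> l.
  by rewrite -[X in _ --> X]addr0; apply: cvgD => //; exact: cvg_cst.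
apply: (squeeze_cvgr _ c1 c2); near=> n; have : `|a n - l| <= n.+1%:R^-1 by near: n.
by rewrite /harmonic /=; move: (n.+1%:R^-1) => e0; rewrite ler_distl => /andP[h1 h2]; apply/andP; split; lra.
Unshelve. all: by end_near. Qed.

(* The offset [n%:R] makes the limit 1 also at [x = c]. *)
Lemma sigmoid_step (c x : R) : (fun n : nat => sigmoid (- (n%:R ^+ 2) * x + (n%:R ^+ 2 * c + n%:R))) @ \oo --> ((x <= c)%R%:R : R).
Proof.
have E n : - (n%:R ^+ 2) * x + (n%:R ^+ 2 * c + n%:R) = n%:R ^+ 2 * (c - x) + n%:R :> R by ring.
have b1 (u : R) : 0 <= u -> `|sigmoid u - 1| <= (u + 1)^-1.
  move=> u0; have e0 := expR_gt0 (- u).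
  have -> : sigmoid u - 1 = - (expR (- u) * sigmoid u).
    by rewrite /sigmoid; field; rewrite lt0r_neq0// addr_gt0.
  rewrite normrN ger0_norm; last by apply: mulr_ge0; apply: ltW => //; exact: sigmoid_gt0.
  apply: (@le_trans _ _ (expR (- u))); first by rewrite ler_piMr ?sigmoid_le1// ltW.
  by rewrite expRN lef_pV2 ?posrE ?expR_gt0 ?ltr_wpDl// addrC expR_ge1Dx.
have b2 (u : R) : 0 <= u -> `|sigmoid (- u) - 0| <= (u + 1)^-1.
  move=> u0; rewrite subr0 ger0_norm; last exact: ltW (sigmoid_gt0 _).
  rewrite /sigmoid opprK.
  have e0 := expR_gt0 u; rewrite lef_pV2 ?posrE; last 2 first.
  - by rewrite addr_gt0.
  - by rewrite ltr_wpDl.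
  by have := expR_ge1Dx u; lra.
apply: cvg_harmonic_bound; have [xc|cx] := leP x c.
  near=> n; rewrite E; have n0 : 0 <= n%:R ^+ 2 * (c - x) by rewrite mulr_ge0 ?sqr_ge0 ?subr_ge0.
  apply: (le_trans (b1 _ _)); first by rewrite addr_ge0.
  have nn : 0 <= n%:R :> R by [].
  have E1 : n.+1%:R = n%:R + 1 :> R by rewrite natr1.
  by rewrite E1; move: (_ * (c - x)) n0 => z z0; rewrite lef_pV2 ?posrE; lra.
have d0 : 0 < x - c by rewrite subr_gt0.
near=> n; rewrite E.
(* From this n on, n^2 (x - c) >= 2 n: the quadratic term outweighs the offset and the argument is
   at most - n. *)
have nd : 2 / (x - c) <= n%:R by near: n; apply: nbhs_infty_ger.
have nn : n%:R <= n%:R ^+ 2 * (x - c) - n%:R.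
  have : n%:R * 2 <= n%:R * (n%:R * (x - c)) by apply: ler_wpM2l => //; rewrite -ler_pdivrMr.
  by rewrite expr2; lra.
have n0 : 0 <= n%:R :> R by [].
rewrite (_ : n%:R ^+ 2 * (c - x) + n%:R = - (n%:R ^+ 2 * (x - c) - n%:R)); last by ring.
apply: (le_trans (b2 _ _)); first exact: le_trans nn.
have E1 : n.+1%:R = n%:R + 1 :> R by rewrite natr1.
by rewrite E1; move: (_ * (x - c) - _) nn => z z0; rewrite lef_pV2 ?posrE; lra.
Unshelve. all: by end_near. Qed.

Lemma measurable_tev e : measurable_fun setT (@tev R e).
Proof.
by apply: open_measurable_fun => x; apply: differentiable_continuous; have [] := tev_derive e x.
Qed.

Lemma measurable_gauss : measurable_fun setT (@gauss R).
Proof. by rewrite /gauss /dot; mtac. Qed.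

Lemma gauss_gt0 (x : R3) : 0 < gauss x. Proof. exact: expR_gt0. Qed.

(** Products of three sigmoids converge boundedly to the indicator of a quadrant, so f times the
    Gaussian integrates to 0 over quadrants by dominated convergence; the Gaussian never
    vanishes. *)
Lemma test_ae0 (f : R3 -> R) : measurable_fun setT f ->
  (forall e, lebR3.-integrable setT (EFin \o (fun x => f x * (tev e x * gauss x)))) ->
  (forall e, \int[lebR3]_x (f x * (tev e x * gauss x)) = 0) ->
  {ae lebR3, forall x, f x = 0}.
Proof.
move=> mf If Z; pose F x := f x * gauss x.
have mg := measurable_gauss.
have mF : measurable_fun setT F by rewrite /F; mtac.
have iF : lebR3.-integrable setT (EFin \o F).
  by rewrite (_ : F = (fun x => f x * (tev (Cst 1) x * gauss x))); [exact: If|apply/funext => x /=; rewrite mul1r].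
have [N [mN N0 sN]] : {ae lebR3, forall x, F x = 0}.
  apply: quadrant_ae0 => // c.
  pose sg (n : nat) (j : 'I_3) (c : R) := Sig j (- (n%:R ^+ 2)) (n%:R ^+ 2 * c + n%:R).
  pose e n := Mul (sg n ord0 c.1.1) (Mul (sg n (@Ordinal 3 1 isT) c.1.2) (sg n ord_max c.2)).
  pose ind (x : R3) : R := (x.1.1 <= c.1.1)%R%:R * ((x.1.2 <= c.1.2)%R%:R * (x.2 <= c.2)%R%:R).
  have tevn n x : 0 <= tev (e n) x <= 1.
    have p (u : R) : 0 <= sigmoid u by exact: ltW (sigmoid_gt0 _).
    by rewrite /=; apply/andP; split; [rewrite !mulr_ge0|rewrite !mulr_ile1 ?mulr_ge0 ?sigmoid_le1].
  have C := @Rdominated_convergence _ _ _ lebR3 (fun n x => f x * (tev (e n) x * gauss x)) (fun x => ind x * F x) (fun x => `|F x|).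
  have -> : \int[lebR3]_(x in quadrant c) F x = \int[lebR3]_x (ind x * F x).
    rewrite Rintegral_mkcond; apply: eq_Rintegral => x _; rewrite patchE.
    case: ifPn => [|/negP nx].
      by rewrite inE /quadrant /ind => /= -[-> [-> ->]]; rewrite !mul1r.
    rewrite (_ : ind x = 0) ?mul0r// /ind.
    case: (leP x.1.1 _) => h1; last by rewrite mul0r.
    case: (leP x.1.2 _) => h2; last by rewrite mul0r mulr0.
    case: (leP x.2 _) => h3; last by rewrite !mulr0.
    by exfalso; apply: nx; rewrite inE.
  have : (fun n : nat => 0 : R) @ \oo --> \int[lebR3]_x (ind x * F x).
    rewrite (_ : (fun _ => 0) = (fun n => \int[lebR3]_x (f x * (tev (e n) x * gauss x)))).
      apply: (proj2 (C _ _ _ _ _)).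
      - move=> n; have mt := measurable_tev (e n); mtac.
      - by rewrite /ind; mtac.
      - exists set0; split => // x /=; apply => /=.
        rewrite (_ : ind x * F x = f x * (ind x * gauss x)); last by rewrite /F; ring.
        apply: cvgM; first exact: cvg_cst.
        apply: cvgM; last exact: cvg_cst.
        apply: cvgM; first exact: sigmoid_step.
        by apply: cvgM; exact: sigmoid_step.
      - exact: (integrable_abse iF).
      - exists set0; split => // x nx; exfalso; apply: nx => n.
        move: (tev (e n) x) (tevn n x) => t /andP[t0 t1].
        by rewrite /F !normrM ler_wpM2l// (ger0_norm t0) ler_piMl.
    by apply/funext => n; rewrite Z.
  by move/(cvg_lim (@Rhausdorff R)); rewrite lim_cst.
exists N; split => // x /= nx; apply: sN => /= h; apply: nx.
by move/eqP: h; rewrite /F mulf_eq0 (gt_eqF (gauss_gt0 x)) orbF => /eqP.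
Qed.
End test_uniqueness.

(** * Duality *)
Section amplitude.
Context (R : realType).
Notation mu := (@lebesgue_measure R).
Notation lebR3 := (@lebR3 R).
Notation R3 := (R * R * R)%type.

Lemma ae_leb3_neq : {ae lebR3, forall q : R3, q.1.1 != 0}.
Proof.
have mA : measurable [set q : R3 | q.1.1 = 0].
  rewrite (_ : [set q | _] = (fun q : R3 => q.1.1 == 0) @^-1` [set true]); last by apply/seteqP; split => q /=; [move=> ->; rewrite eqxx|move/eqP].
  by rewrite -[X in measurable X]setTI; apply: measurable_fun_eqr => //; mtac.
exists [set q : R3 | q.1.1 = 0]; split => //; last by move=> q /= /negP; rewrite negbK => /eqP.
pose z (v : R) : bool := v == 0.
have mz : measurable_fun setT z by apply: measurable_fun_eqr; mtac.
have -> : (lebR3 [set q : R3 | q.1.1 = 0%R] = \int[lebR3]_q ((z q.1.1)%:R)%:E)%E.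
  rewrite -[LHS]mul1e -integral_cst// integral_mkcond; apply: eq_integral => q _; rewrite patchE /z.
  case: ifPn => [|/negP h]; first by rewrite inE /= => ->; rewrite eqxx.
  by case: eqP => // q0; case: h; rewrite inE.
rewrite ge0_integral_leb3; last 2 first.
- by mtac.
- by move=> q; rewrite lee_fin.
transitivity (\int[mu]_x (0 : \bar R))%E; last by rewrite integral0.
apply: ge0_ae_eq_integral => //.
- by mtac.
- by move=> x _; apply: integral_ge0 => y _; apply: integral_ge0 => w _; rewrite lee_fin.
- have [N [mN N0 sN]] := @ae_neq R 0; exists N; split => // x nx; apply: sN => /= x0; apply: nx => _.
  by rewrite integral0_eq// => y _; rewrite integral0_eq// => w _ /=; rewrite /z (negbTE x0).
Qed.

Lemma ae_eq_Rintegral d (T : measurableType d) (m : {measure set T -> \bar R}) (f g : T -> R) :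
  measurable_fun setT f -> measurable_fun setT g -> {ae m, forall x, f x = g x} ->
  \int[m]_x f x = \int[m]_x g x.
Proof.
move=> mf mg [N [mN N0 sN]]; apply: (congr1 fine); apply: ae_eq_integral => //.
- exact/measurable_EFinP.
- exact/measurable_EFinP.
- by exists N; split => // x nx; apply: sN => /= h; apply: nx => _; rewrite h.
Qed.

Lemma measurable_sphase k c d (T : measurableType d) (u : T -> R) (v w : T -> R3) :
  measurable_fun setT u -> measurable_fun setT v -> measurable_fun setT w ->
  measurable_fun setT (fun t => sphase k c (u t) (v t) (w t)).
Proof. by move=> mu' mv mw; rewrite /sphase /enorm /dot; mtac. Qed.

Lemma integrable_cosM (h : R3 -> R) (u : R3 -> R) : lebR3.-integrable setT (EFin \o h) -> measurable_fun setT u ->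
  lebR3.-integrable setT (EFin \o (fun xi => cos (u xi) * h xi)).
Proof.
move=> ih mu'; apply: (integrable_osc ih); last by move=> y; rewrite ler_norml cos_geN1 cos_le1.
by mtac.
Qed.

Lemma integrable_sinM (h : R3 -> R) (u : R3 -> R) : lebR3.-integrable setT (EFin \o h) -> measurable_fun setT u ->
  lebR3.-integrable setT (EFin \o (fun xi => sin (u xi) * h xi)).
Proof.
move=> ih mu'; apply: (integrable_osc ih); last by move=> y; rewrite ler_norml sin_geN1 sin_le1.
by mtac.
Qed.

(** The cone coordinates miss the axis, so [h] is first set to 0 on the plane xi_1 = 0, a null set
    that contains it. This changes no amplitude and does not increase the norm. *)
Lemma amp_bound_all (k c : R) (h : R3 -> R) : k != 0 -> lebR3.-integrable setT (EFin \o h) ->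
  (\int[lebR3]_x (\int[mu]_t (`|amp k c h t x| ^+ 3)%:E) ^+ 2 <=
   (64 * (144 * pi / k) ^+ 2 * (2 * pi) ^+ 6)%:E * (\int[lebR3]_xi (h xi ^+ 2 * enorm xi ^+ 2)%:E) ^+ 3)%E.
Proof.
move=> k0 ih; have mh := measurable_int _ ih; move/measurable_EFinP in mh.
pose h' (xi : R3) := (xi.1.1 != 0)%R%:R * h xi.
have mne : measurable_fun setT (fun q : R3 => q.1.1 != 0) by apply: measurable_neqr; mtac.
have mh' : measurable_fun setT h' by rewrite /h'; mtac.
have h'h q : `|h' q| <= `|h q| by rewrite /h' normrM ler_piMl// normr_nat lern1 leq_b1.
have ih' : lebR3.-integrable setT (EFin \o h').
  apply: (le_integrable measurableT _ _ ih) => /=; first exact/measurable_EFinP.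
  by move=> q _; rewrite lee_fin.
have h'0 q : nrm2 q.1 = 0 -> h' q = 0.
  move=> n0; rewrite /h' (_ : q.1.1 = 0) ?eqxx ?mul0r//.
  move/eqP: n0; rewrite /nrm2 sqrtr_eq0 => n0; apply/eqP; rewrite -sqrf_eq0 eq_le sqr_ge0 andbT.
  by apply: le_trans n0; rewrite lerDl sqr_ge0.
have aE t x : amp k c h t x = amp k c h' t x.
  apply: ae_eq_Rintegral.
  - have ms : measurable_fun setT (fun xi => sphase k c t x xi) by apply: measurable_sphase; mtac.
    by mtac.
  - have ms : measurable_fun setT (fun xi => sphase k c t x xi) by apply: measurable_sphase; mtac.
    by mtac.
  - have [N [mN N0 sN]] := ae_leb3_neq; exists N; split => // q nq; apply: sN => /= q0; apply: nq.
    by rewrite /= /h' q0 mul1r.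
apply: (@le_trans _ _ (\int[lebR3]_x (\int[mu]_t (`|amp k c h' t x| ^+ 3)%:E) ^+ 2)%E).
  by apply: ge0_le_integral_mono => x; [apply: expe_ge0; apply: integral_ge0 => t _; rewrite lee_fin exprn_ge0|under eq_integral do rewrite aE].
apply: (le_trans (amp_bound c k0 ih' h'0)).
apply: lee_wpmul2l; first by rewrite lee_fin; apply: mulr_ge0; [apply: mulr_ge0 => //; exact: sqr_ge0|rewrite exprn_ge0// mulr_ge0// pi_ge0].
have I0 (f : R3 -> R) : (0 <= \int[lebR3]_xi (f xi ^+ 2 * enorm xi ^+ 2)%:E)%E.
  by apply: integral_ge0 => q _; rewrite lee_fin mulr_ge0 ?sqr_ge0.
have L : (\int[lebR3]_xi (h' xi ^+ 2 * enorm xi ^+ 2)%:E <= \int[lebR3]_xi (h xi ^+ 2 * enorm xi ^+ 2)%:E)%E.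
  apply: ge0_le_integral_mono => q; first by rewrite lee_fin mulr_ge0 ?sqr_ge0.
  rewrite lee_fin ler_wpM2r ?sqr_ge0// -(real_normK (num_real (h' q))) -(real_normK (num_real (h q))).
  by rewrite lerXn2r ?nnegrE.
by rewrite !expeS expe0 !mule1; apply: lee_pmul => //; [exact: mule_ge0|apply: lee_pmul].
Qed.

Definition theta (k c t : R) (xi : R3) : R := t * (k * (xi.2 / enorm xi)) + c.

Lemma measurable_theta k c t : measurable_fun setT (theta k c t).
Proof. by rewrite /theta /enorm /dot; mtac. Qed.

(** At fixed t the oscillation in [theta] is absorbed into the amplitude, and Plancherel in space is
    applied to [h1] and [h2]; the 4 is the price of the difference of two terms. The bound will
    measure the increments between truncations. *)
Lemma amp_L2 (k c t : R) (h : R3 -> R) : lebR3.-integrable setT (EFin \o h) ->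
  (\int[lebR3]_x (amp k c h t x ^+ 2)%:E <= (4 * (2 * pi) ^+ 3)%:E * \int[lebR3]_xi (h xi ^+ 2)%:E)%E.
Proof.
move=> ih; have mh := measurable_int _ ih; move/measurable_EFinP in mh.
have mt := measurable_theta k c t.
pose h1 xi := cos (theta k c t xi) * h xi; pose h2 xi := sin (theta k c t xi) * h xi.
have i1 : lebR3.-integrable setT (EFin \o h1) by exact: integrable_cosM.
have i2 : lebR3.-integrable setT (EFin \o h2) by exact: integrable_sinM.
have m1 := measurable_int _ i1; move/measurable_EFinP in m1.
have m2 := measurable_int _ i2; move/measurable_EFinP in m2.
pose psi (x y : R3) := x.1.1 * y.1.1 + x.1.2 * y.1.2 + x.2 * y.2 + 0.
have mpsi : measurable_fun setT (fun p : R3 * R3 => psi p.1 p.2) by rewrite /psi; mtac.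
have mpsix x : measurable_fun setT (psi x) by rewrite /psi; mtac.
have P1 := plancherel_space 0 i1; have P2 := plancherel_space 0 i2.
have aE x : amp k c h t x = cosint lebR3 psi h1 x - sinint lebR3 psi h2 x.
  rewrite /amp /cosint /sinint -RintegralB//; last 2 first.
  - exact: integrable_cosM.
  - exact: integrable_sinM.
  apply: eq_Rintegral => xi _; rewrite /h1 /h2 (_ : sphase k c t x xi = psi x xi + theta k c t xi).
    by rewrite cosD; ring.
  by rewrite /sphase /psi /theta /dot; ring.
have mc1 : measurable_fun setT (cosint lebR3 psi h1) by exact: measurable_cosint.
have ms1 : measurable_fun setT (sinint lebR3 psi h1) by exact: measurable_sinint.
have mc2 : measurable_fun setT (cosint lebR3 psi h2) by exact: measurable_cosint.
have ms2 : measurable_fun setT (sinint lebR3 psi h2) by exact: measurable_sinint.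
pose q (H : R3 -> R) x : \bar R := (cosint lebR3 psi H x ^+ 2 + sinint lebR3 psi H x ^+ 2)%:E.
have q0 H x : (0 <= q H x)%E by rewrite lee_fin addr_ge0 ?sqr_ge0.
have mq1 : measurable_fun setT (q h1) by rewrite /q; mtac.
have mq2 : measurable_fun setT (q h2) by rewrite /q; mtac.
apply: (@le_trans _ _ (\int[lebR3]_x (2%:E * (q h1 x + q h2 x)))%E).
  apply: ge0_le_integral_mono => x; first by rewrite lee_fin sqr_ge0.
  rewrite /q -EFinD -EFinM lee_fin aE.
  move: (cosint lebR3 psi h1 x) (sinint lebR3 psi h1 x) (cosint lebR3 psi h2 x) (sinint lebR3 psi h2 x) => a b c' d.
  rewrite -subr_ge0 (_ : _ - _ = (a + d) ^+ 2 + 2 * b ^+ 2 + 2 * c' ^+ 2); last by ring.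
  by have := sqr_ge0 (a + d); have := sqr_ge0 b; have := sqr_ge0 c'; lra.
rewrite ge0_intZl; last 3 first.
- exact: emeasurable_funD.
- by move=> x; rewrite adde_ge0.
- by [].
rewrite ge0_integralD; last 5 first.
- exact: measurableT.
- by move=> x _; exact: q0.
- exact: mq1.
- by move=> x _; exact: q0.
- exact: mq2.
have pi3 : 0 <= (2 * pi) ^+ 3 :> R by rewrite exprn_ge0// mulr_ge0// pi_ge0.
have le1 (H : R3 -> R) : (forall xi, `|H xi| <= `|h xi|) -> (\int[lebR3]_xi (H xi ^+ 2)%:E <= \int[lebR3]_xi (h xi ^+ 2)%:E)%E.
  move=> Hh; apply: ge0_le_integral_mono => xi; first by rewrite lee_fin sqr_ge0.
  by rewrite lee_fin -(real_normK (num_real (H xi))) -(real_normK (num_real (h xi))) lerXn2r ?nnegrE.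
apply: (@le_trans _ _ (2%:E * (((2 * pi) ^+ 3)%:E * (\int[lebR3]_xi (h xi ^+ 2)%:E) + ((2 * pi) ^+ 3)%:E * (\int[lebR3]_xi (h xi ^+ 2)%:E)))%E).
  apply: lee_wpmul2l => //; apply: leeD.
    apply: (le_trans P1); apply: lee_wpmul2l; first by rewrite lee_fin.
    by apply: le1 => xi; rewrite /h1 normrM ler_piMl// ler_norml cos_geN1 cos_le1.
  apply: (le_trans P2); apply: lee_wpmul2l; first by rewrite lee_fin.
  by apply: le1 => xi; rewrite /h2 normrM ler_piMl// ler_norml sin_geN1 sin_le1.
rewrite -[X in (_ * X)%E]mule2n -mule_natl !muleA -!EFinM le_eqVlt; apply/orP; left; apply/eqP; congr (_%:E * _)%E; ring.
Qed.

(** The transpose of [amp] at time t: the same kernel, integrated in space. *)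
Definition dualamp (k c t : R) (phi : R3 -> R) (xi : R3) : R :=
  \int[lebR3]_x (cos (sphase k c t x xi) * phi x).

Lemma measurable_dualamp k c t phi : measurable_fun setT phi -> measurable_fun setT (dualamp k c t phi).
Proof.
move=> mphi; apply: (@measurable_fun_Rintegral _ _ R _ _ lebR3 (fun xi x => cos (sphase k c t x xi) * phi x)).
by mtac; apply: measurable_sphase; mtac.
Qed.

(** Here [theta] is constant in the integration variable and merely rotates the vector (cosint,
    sinint); a coordinate of the rotated vector is at most its length. *)
Lemma dualamp_L2 (k c t : R) (phi : R3 -> R) : lebR3.-integrable setT (EFin \o phi) ->
  (\int[lebR3]_xi (dualamp k c t phi xi ^+ 2)%:E <= ((2 * pi) ^+ 3)%:E * \int[lebR3]_x (phi x ^+ 2)%:E)%E.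
Proof.
move=> ip; have mp := measurable_int _ ip; move/measurable_EFinP in mp.
apply: le_trans (plancherel_space 0 ip); apply: ge0_le_integral_mono => xi; first by rewrite lee_fin sqr_ge0.
pose psi (x y : R3) := x.1.1 * y.1.1 + x.1.2 * y.1.2 + x.2 * y.2 + 0.
have mpsix x : measurable_fun setT (psi x) by rewrite /psi; mtac.
have ic : lebR3.-integrable setT (EFin \o (fun x => cos (psi xi x) * phi x)) by exact: integrable_cosM.
have is_ : lebR3.-integrable setT (EFin \o (fun x => sin (psi xi x) * phi x)) by exact: integrable_sinM.
have -> : dualamp k c t phi xi = cos (theta k c t xi) * cosint lebR3 psi phi xi - sin (theta k c t xi) * sinint lebR3 psi phi xi.
  rewrite /dualamp /cosint /sinint -RintegralZl// -RintegralZl// -RintegralB//; last 2 first.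
  - exact: (integrableZl measurableT (cos (theta k c t xi)) ic).
  - exact: (integrableZl measurableT (sin (theta k c t xi)) is_).
  apply: eq_Rintegral => x _; rewrite (_ : sphase k c t x xi = psi xi x + theta k c t xi).
    by rewrite cosD; ring.
  by rewrite /sphase /psi /theta /dot; ring.
rewrite lee_fin -/psi; have := cos2Dsin2 (theta k c t xi).
move: (cos (theta k c t xi)) (sin (theta k c t xi)) (cosint lebR3 psi phi xi) (sinint lebR3 psi phi xi) => a b C S E.
rewrite -subr_ge0 (_ : _ - _ = (a * S + b * C) ^+ 2 + (1 - (a ^+ 2 + b ^+ 2)) * (C ^+ 2 + S ^+ 2)); last by ring.
by rewrite E subrr mul0r addr0 sqr_ge0.
Qed.

Lemma dualamp_le (k c t : R) (phi : R3 -> R) xi : lebR3.-integrable setT (EFin \o phi) ->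
  `|dualamp k c t phi xi| <= \int[lebR3]_x `|phi x|.
Proof.
move=> ip; have mp := measurable_int _ ip; move/measurable_EFinP in mp.
have ms : measurable_fun setT (fun x => sphase k c t x xi) by apply: measurable_sphase; mtac.
apply: (le_trans (le_normr_Rintegral measurableT (integrable_cosM ip ms))).
apply: le_Rintegral => //.
- exact: (integrable_abse (integrable_cosM ip ms)).
- exact: (integrable_abse ip).
- by move=> x _; rewrite normrM ler_piMl// ler_norml cos_geN1 cos_le1.
Qed.

Lemma amp_le (k c t : R) (h : R3 -> R) x : lebR3.-integrable setT (EFin \o h) ->
  `|amp k c h t x| <= \int[lebR3]_xi `|h xi|.
Proof.
move=> ip; have mp := measurable_int _ ip; move/measurable_EFinP in mp.
have ms : measurable_fun setT (fun xi => sphase k c t x xi) by apply: measurable_sphase; mtac.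
apply: (le_trans (le_normr_Rintegral measurableT (integrable_cosM ip ms))).
apply: le_Rintegral => //.
- exact: (integrable_abse (integrable_cosM ip ms)).
- exact: (integrable_abse ip).
- by move=> y _; rewrite normrM ler_piMl// ler_norml cos_geN1 cos_le1.
Qed.

Lemma amp_dual (k c t : R) (h phi : R3 -> R) : lebR3.-integrable setT (EFin \o h) -> lebR3.-integrable setT (EFin \o phi) ->
  \int[lebR3]_x (amp k c h t x * phi x) = \int[lebR3]_xi (h xi * dualamp k c t phi xi).
Proof.
move=> ih ip.
have mp := measurable_int _ ip; move/measurable_EFinP in mp.
have mh := measurable_int _ ih; move/measurable_EFinP in mh.
pose F (z : R3 * R3) := cos (sphase k c t z.1 z.2) * (phi z.1 * h z.2).
have ms : measurable_fun setT (fun z : R3 * R3 => sphase k c t z.1 z.2) by apply: measurable_sphase; mtac.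
have mF : measurable_fun setT F by rewrite /F; mtac.
have iF : (tensor lebR3 lebR3).-integrable setT (EFin \o F).
  apply: (le_integrable measurableT _ _ (integrable_tensor ip ih)) => /=; first by mtac.
  by move=> z _; rewrite lee_fin /F normrM ler_piMl// ler_norml cos_geN1 cos_le1.
have E := integral_tensor iF; have := integral_tensor_swap iF; rewrite E => {E} E.
rewrite /Rintegral; congr fine.
have msx x : measurable_fun setT (fun xi => sphase k c t x xi) by apply: measurable_sphase; mtac.
have msxi xi : measurable_fun setT (fun x => sphase k c t x xi) by apply: measurable_sphase; mtac.
have E1 x : ((amp k c h t x * phi x)%:E = \int[lebR3]_xi (EFin \o F) (x, xi))%E.
  have iO := integrable_cosM ih (msx x).
  rewrite mulrC EFinM /amp /Rintegral fineK; last exact: integrable_fin_num.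
  rewrite -integralZl//.
  by apply: eq_integral => xi _; rewrite /F/= -EFinM; congr EFin; ring.
have E2 xi : ((h xi * dualamp k c t phi xi)%:E = \int[lebR3]_x (EFin \o F) (x, xi))%E.
  have iO := integrable_cosM ip (msxi xi).
  rewrite EFinM /dualamp /Rintegral fineK; last exact: integrable_fin_num.
  rewrite -integralZl//.
  by apply: eq_integral => x _; rewrite /F/= -EFinM; congr EFin; ring.
under eq_integral do rewrite E1.
under [RHS]eq_integral do rewrite E2.
exact: E.
Qed.

(* Integrable, and dominates Schwartz functions up to a constant. *)
Definition wt (x : R3) : R := pker 1 x.1.1 * pker 1 x.1.2 * pker 1 x.2.

Lemma wt_gt0 x : 0 < wt x.
Proof.
have p0 (v : R) : 0 < pker 1 v by rewrite /pker divr_gt0// ?mulr_gt0// ltr_pwDl ?sqr_ge0// expr1n.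
by rewrite /wt; apply: mulr_gt0 => //; apply: mulr_gt0.
Qed.

Lemma measurable_wt : measurable_fun setT wt.
Proof. by rewrite /wt /pker; mtac. Qed.

Lemma integral_wt : (\int[lebR3]_x (wt x)%:E <= ((2 * pi) ^+ 3)%:E)%E.
Proof.
have := @integral_pker3_le R 1 1 0 0 0 ltr01 (oner_neq0 _); rewrite normr1 divr1; apply: le_trans.
rewrite le_eqVlt; apply/orP; left; apply/eqP; apply: eq_integral => x _.
by rewrite /wt /pker !sub0r mul1r !sqrrN.
Qed.

Lemma integrable_wt : lebR3.-integrable setT (EFin \o wt).
Proof.
apply/integrableP; split; first by apply/measurable_EFinP; exact: measurable_wt.
under eq_integral => x _ do rewrite gee0_abs ?lee_fin ?(ltW (wt_gt0 x))//.
by apply: le_lt_trans integral_wt _; rewrite ltry.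
Qed.

Lemma wt_le8 x : wt x <= 8.
Proof.
have p2 (v : R) : pker 1 v <= 2 by rewrite /pker ler_pdivrMr ?ltr_pwDl ?sqr_ge0//; have := sqr_ge0 v; lra.
have p0 (v : R) : 0 <= pker 1 v by apply: pker_ge0.
rewrite /wt (_ : 8 = 2 * 2 * 2 :> R); last by ring.
by apply: ler_pM => //; [apply: mulr_ge0|apply: ler_pM].
Qed.
End amplitude.

(** * Limits of truncations *)
Section ereal_tools.
Context (R : realType).

Lemma measurable_nneseries d (T : measurableType d) (f : nat -> T -> \bar R) :
  (forall n, measurable_fun setT (f n)) -> (forall n x, 0 <= f n x)%E ->
  measurable_fun setT (fun x => \sum_(n <oo) f n x)%E.
Proof.
move=> mf f0; apply: (emeasurable_fun_cvg (fun n x => \sum_(0 <= i < n) f i x)%E).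
  by move=> n; apply: emeasurable_sum.
by move=> x _; exact: is_cvg_nneseries.
Qed.

(** Allows Fatou's lemma in time to be followed by Fatou's lemma in space across the square in the
    mixed norm. *)
Lemma limn_einf_sqr (y : nat -> \bar R) : (forall n, 0 <= y n)%E ->
  ((limn_einf y) ^+ 2 <= limn_einf (fun n => y n ^+ 2))%E.
Proof.
move=> y0; rewrite !limn_einf_lim.
have e0 n : (0 <= einfs y n)%E by apply: le_ereal_inf_tmp => _ [m _ <-].
have c1 : cvgn (einfs y) by exact: is_cvg_einfs.
have L0 : (0 <= limn (einfs y))%E by apply: lime_ge => //; exact: nearW.
have c2 : (fun n => einfs y n * einfs y n)%E @ \oo --> (limn (einfs y) * limn (einfs y))%E.
  by apply: cvgeM => //; rewrite /mule_def; case: (limn _) => [r| |] //=; rewrite ?andbF.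
rewrite expe2 -(cvg_lim (@ereal_hausdorff R) c2); apply: lee_lim.
- by apply/cvg_ex; eexists; exact: c2.
- exact: is_cvg_einfs.
apply: nearW => n; apply: le_ereal_inf_tmp => _ [m nm <-].
rewrite expe2; apply: lee_pmul => //; apply: ereal_inf_lbound; exists m => //.
Qed.

(** Telescoping; the bound by the first term plus the total variation serves as dominating function
    for the truncated amplitudes. *)
Lemma abs_summable_cvg (a : nat -> R) : (\sum_(n <oo) (`|a n.+1 - a n|)%:E < +oo)%E ->
  exists2 l : R, a @ \oo --> l & forall n, `|a n| <= `|a 0%N| + fine (\sum_(n <oo) (`|a n.+1 - a n|)%:E)%E.
Proof.
set S := (\sum_(n <oo) _)%E => Sfin.
have S0 : (0 <= S)%E by apply: nneseries_ge0 => n _ _; rewrite lee_fin.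
have Sf : S \is a fin_num by rewrite ge0_fin_numE.
pose d n := a n.+1 - a n.
have part n : (\sum_(0 <= i < n) `|d i|) <= fine S.
  rewrite -lee_fin fineK// -sumEFin; apply: nneseries_lim_ge => i _ _; by rewrite lee_fin.
have tel n : a n = a 0%N + series d n by rewrite /series/= telescope_sumr// addrC subrK.
have cd : cvgn (series d).
  apply: normed_cvg; apply: nondecreasing_is_cvgn.
    by apply: nondecreasing_series => i *; exact: normr_ge0.
  by exists (fine S) => _ [n _ <-]; exact: part.
exists (a 0%N + limn (series d)).
  have E : a = (fun n => a 0%N + series d n) by apply/funext.
  by rewrite [X in X @ _]E; apply: cvgD; [exact: cvg_cst|exact: cd].
move=> n; rewrite tel; apply: (le_trans (ler_normD _ _)); rewrite lerD2l.
by apply: (le_trans (ler_norm_sum _ _ _)); exact: part.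
Qed.

Lemma nneseries_geometric_le (y : nat -> \bar R) (c : R) : 0 <= c -> (forall n, 0 <= y n)%E ->
  (forall n, y n <= (c / 2 ^+ n)%:E)%E -> (\sum_(n <oo) y n <= (2 * c)%:E)%E.
Proof.
move=> c0 y0 yc; apply: lime_le; first exact: is_cvg_nneseries.
apply: nearW => n; apply: (@le_trans _ _ (\sum_(0 <= i < n) (c / 2 ^+ i)%:E)%E); first exact: lee_sum.
rewrite sumEFin lee_fin.
suff -> : \sum_(0 <= i < n) c / 2 ^+ i = 2 * c - 2 * c / 2 ^+ n by rewrite gerBl divr_ge0 ?mulr_ge0 ?exprn_ge0.
elim: n => [|n IH]; first by rewrite big_geq// expr0 divr1 subrr.
by rewrite big_nat_recr//= IH exprS; field; rewrite expf_neq0.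
Qed.
End ereal_tools.

Section limit_amplitude.
Context (R : realType).
Notation mu := (@lebesgue_measure R).
Notation lebR3 := (@lebR3 R).
Notation R3 := (R * R * R)%type.
Variables (k c : R) (h : R3 -> R).

Definition cut (j : nat) (xi : R3) : R := (enorm xi <= 2 ^+ j)%R%:R * h xi.
Definition camp (j : nat) (t : R) (x : R3) : R := amp k c (cut j) t x.
Definition csum (t : R) (x : R3) : \bar R := (\sum_(j <oo) (`|camp j.+1 t x - camp j t x|)%:E)%E.
Definition conv (t : R) (x : R3) : bool := (csum t x < +oo)%E.
(* The limit of [camp ^~ t ^~ x], and 0 where absolute convergence fails. *)
Definition lamp (t : R) (x : R3) : R := (conv t x)%:R * fine (limn_esup (fun j => (camp j t x)%:E)).

Lemma camp_cvg t x : conv t x -> camp ^~ t ^~ x @ \oo --> lamp t x.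
Proof.
move=> C; have [l cl _] := abs_summable_cvg C.
suff -> : lamp t x = l by [].
rewrite /lamp C mul1r; have cE : (fun j => (camp j t x)%:E) @ \oo --> l%:E by apply: cvg_EFin => //; exact: nearW.
by rewrite (cvg_limn_einf_sup cE).2.
Qed.

Lemma camp_le j t x : conv t x -> `|camp j t x| <= `|camp 0 t x| + fine (csum t x).
Proof. by move=> C; have [l _] := abs_summable_cvg C; exact. Qed.

(** Where the truncations fail to converge absolutely [lamp] is 0, so the inequality holds at every
    point and Fatou's lemma applies without an exceptional set. *)
Lemma lamp_cube_le t x : ((`|lamp t x| ^+ 3)%:E <= limn_einf (fun j => (`|camp j t x| ^+ 3)%:E))%E.
Proof.
have [C|C] := boolP (conv t x); last first.
  rewrite /lamp (negbTE C) mul0r normr0 expr0n/= limn_einf_lim.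
  apply: lime_ge; first exact: is_cvg_einfs.
  by apply: nearW => n; apply: le_ereal_inf_tmp => _ [m _ <-]; rewrite lee_fin exprn_ge0.
have cl := camp_cvg C.
have c3 : (fun j => (`|camp j t x| ^+ 3)%:E) @ \oo --> (`|lamp t x| ^+ 3)%:E.
  apply: cvg_EFin; first exact: nearW.
  apply: (@cvg_comp _ _ _ (fun j => `|camp j t x|) (fun y : R => y ^+ 3) _ (nbhs `|lamp t x|)).
    exact: cvg_norm.
  exact: exprn_continuous.
by rewrite (cvg_limn_einf_sup c3).1.
Qed.

Hypothesis mh : measurable_fun setT h.
Hypothesis ih : forall j, lebR3.-integrable setT (EFin \o cut j).
Hypothesis Dfin : (\int[lebR3]_xi (h xi ^+ 2 * enorm xi ^+ 2)%:E < +oo)%E.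
Let D : R := fine (\int[lebR3]_xi (h xi ^+ 2 * enorm xi ^+ 2)%:E)%E.

Let D0 : 0 <= D.
Proof. by apply: fine_ge0; apply: integral_ge0 => xi _; rewrite lee_fin mulr_ge0 ?sqr_ge0. Qed.

Let DE : (\int[lebR3]_xi (h xi ^+ 2 * enorm xi ^+ 2)%:E = D%:E)%E.
Proof. by rewrite /D fineK// ge0_fin_numE//; apply: integral_ge0 => xi _; rewrite lee_fin mulr_ge0 ?sqr_ge0. Qed.

Lemma measurable_cut j : measurable_fun setT (cut j).
Proof. by rewrite /cut /enorm /dot; mtac. Qed.

Lemma measurable_camp j d (T : measurableType d) (u : T -> R) (v : T -> R3) :
  measurable_fun setT u -> measurable_fun setT v -> measurable_fun setT (fun s => camp j (u s) (v s)).
Proof.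
move=> mu' mv; apply: (measurableT_comp (measurable_amp k c (measurable_cut j)) (g := fun s => (u s, v s))).
by mtac.
Qed.

Lemma measurable_csum d (T : measurableType d) (u : T -> R) (v : T -> R3) :
  measurable_fun setT u -> measurable_fun setT v -> measurable_fun setT (fun s => csum (u s) (v s)).
Proof.
move=> mu' mv; apply: (@measurable_nneseries R _ _ (fun j s => (`|camp j.+1 (u s) (v s) - camp j (u s) (v s)|)%:E)).
  by move=> n; mtac; apply: measurable_camp.
by move=> n s; rewrite lee_fin.
Qed.

Lemma measurable_lamp d (T : measurableType d) (u : T -> R) (v : T -> R3) :
  measurable_fun setT u -> measurable_fun setT v -> measurable_fun setT (fun s => lamp (u s) (v s)).
Proof.
move=> mu' mv; rewrite /lamp; apply: measurable_funM.
  by apply: measurable_fun_nat; apply: measurable_funlty; exact: measurable_csum.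
apply: (measurableT_comp (@fine_measurable R setT measurableT)).
by apply: measurable_fun_limn_esup => n; apply: measurable_fun_EFin; exact: measurable_camp.
Qed.

Lemma csum_ge0 t x : (0 <= csum t x)%E.
Proof. by apply: nneseries_ge0 => n _ _; rewrite lee_fin. Qed.

Let cutdiff j t x : camp j.+1 t x - camp j t x = amp k c (fun xi => cut j.+1 xi - cut j xi) t x.
Proof.
have ms : measurable_fun setT (fun xi => sphase k c t x xi) by apply: measurable_sphase; mtac.
rewrite /camp /amp -RintegralB//; last 2 first.
- exact: integrable_cosM.
- exact: integrable_cosM.
by apply: eq_Rintegral => xi _; rewrite mulrBr.
Qed.

Let cutdiff_int j : lebR3.-integrable setT (EFin \o (fun xi => cut j.+1 xi - cut j xi)).
Proof. by have := integrableB measurableT (ih j.+1) (ih j). Qed.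

(** The increment lives on |xi| > 2^j, where |xi|^2 / 4^j >= 1: a finite H^1 norm gives L^2
    increments of size 2^-j, hence summable. *)
Let cutdiff_sqr j : (\int[lebR3]_xi ((cut j.+1 xi - cut j xi) ^+ 2)%:E <= (D / 4 ^+ j)%:E)%E.
Proof.
have p0 : 0 <= 2 ^+ j :> R by rewrite exprn_ge0.
have p4 : 0 < 4 ^+ j :> R by rewrite exprn_gt0.
have E4 : 4 ^+ j = (2 ^+ j) ^+ 2 :> R by rewrite -exprM mulnC exprM; congr (_ ^+ _); ring.
apply: (@le_trans _ _ (\int[lebR3]_xi ((4 ^+ j)^-1%:E * (h xi ^+ 2 * enorm xi ^+ 2)%:E))%E).
  apply: ge0_le_integral_mono => xi; first by rewrite lee_fin sqr_ge0.
  rewrite -EFinM lee_fin ler_pdivlMl// /cut.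
  have [e1|e1] := leP (enorm xi) (2 ^+ j).
    have -> : enorm xi <= 2 ^+ j.+1 by apply: (le_trans e1); rewrite exprS ler_peMl// ler1n.
    by rewrite subrr expr0n/= mulr0 mulr_ge0 ?sqr_ge0.
  rewrite mul0r subr0; have H : 4 ^+ j <= enorm xi ^+ 2.
    by rewrite E4 lerXn2r ?nnegrE ?enorm_ge0// ltW.
  rewrite mulrC exprMn; apply: ler_pM => //; first by rewrite mulr_ge0 ?sqr_ge0.
  by case: (enorm xi <= 2 ^+ j.+1) => /=; rewrite ?expr1n ?mul1r ?expr0n/= ?mul0r ?sqr_ge0.
rewrite ge0_intZl; last 3 first.
- by rewrite /enorm /dot; mtac.
- by move=> xi; rewrite lee_fin mulr_ge0 ?sqr_ge0.
- by rewrite lee_fin invr_ge0 ltW.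
by rewrite DE -EFinM mulrC.
Qed.

(** The n-th increment v has L^2 norm of order 2^-n, while [wt] is integrable and bounded by 8.
    Young's inequality wt v <= 2^n v^2 + wt^2 / 2^n makes both terms O(2^-n) after integration, and
    the series is geometric. *)
Lemma integral_csum_wt t : (\int[lebR3]_x (csum t x * (wt x)%:E) < +oo)%E.
Proof.
have mw := @measurable_wt R.
have E x : (csum t x * (wt x)%:E = \sum_(j <oo) (wt x * `|camp j.+1 t x - camp j t x|)%:E)%E.
  rewrite muleC /csum -nneseriesZl; last by move=> n _; rewrite lee_fin.
  by apply: eq_eseriesr => n _; rewrite -EFinM.
under eq_integral do rewrite E.
rewrite integral_nneseries; last 3 first.
- exact: measurableT.
- by move=> n; mtac; apply: measurable_camp; mtac.
- by move=> n x _; rewrite lee_fin mulr_ge0// ltW// wt_gt0.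
pose C : R := 4 * (2 * pi) ^+ 3 * D + 8 * (2 * pi) ^+ 3.
have pi3 : 0 <= (2 * pi) ^+ 3 :> R by rewrite exprn_ge0// mulr_ge0// pi_ge0.
have C0 : 0 <= C by apply: addr_ge0; apply: mulr_ge0 => //; apply: mulr_ge0.
apply: (@le_lt_trans _ _ (2 * C)%:E); last by rewrite ltry.
apply: nneseries_geometric_le => // n.
  by apply: integral_ge0 => x _; rewrite lee_fin mulr_ge0// ltW// wt_gt0.
have p2 : 0 < 2 ^+ n :> R by rewrite exprn_gt0.
pose g := amp k c (fun xi => cut n.+1 xi - cut n xi) t.
have mg : measurable_fun setT g.
  have mcd : measurable_fun setT (fun xi => cut n.+1 xi - cut n xi).
    by have m1 := measurable_cut n.+1; have m2 := measurable_cut n; mtac.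
  by apply: (measurableT_comp (measurable_amp k c mcd) (g := fun x => (t, x))); mtac.
apply: (@le_trans _ _ (\int[lebR3]_x ((2 ^+ n)%:E * (g x ^+ 2)%:E + (8 / 2 ^+ n)%:E * (wt x)%:E))%E).
  apply: ge0_le_integral_mono => x; first by rewrite lee_fin mulr_ge0// ltW// wt_gt0.
  rewrite -!EFinM -EFinD lee_fin cutdiff -/(g x).
  have w0 := wt_gt0 x; have w8 := wt_le8 x.
  rewrite -(real_normK (num_real (g x))); set v := `|g x|.
  have H1 : wt x * v <= 2 ^+ n * v ^+ 2 + wt x ^+ 2 / 2 ^+ n.
    rewrite -subr_ge0 (_ : _ - _ = ((2 ^+ n * v - wt x / 2) ^+ 2 + 3 / 4 * wt x ^+ 2) / 2 ^+ n); last by field; exact: lt0r_neq0.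
    by rewrite divr_ge0 ?(ltW p2)// addr_ge0 ?sqr_ge0// mulr_ge0 ?sqr_ge0.
  apply: (le_trans H1); by rewrite lerD2l [leRHS]mulrAC ler_pM2r ?invr_gt0// expr2 ler_pM2r.
rewrite ge0_integralD; last 5 first.
- exact: measurableT.
- by move=> x _; rewrite -EFinM lee_fin mulr_ge0 ?sqr_ge0// ltW.
- by mtac.
- by move=> x _; rewrite -EFinM lee_fin mulr_ge0 ?(ltW (wt_gt0 x))// divr_ge0// ltW.
- by mtac.
rewrite !ge0_intZl; last 6 first.
- by mtac.
- by move=> x; rewrite lee_fin (ltW (wt_gt0 x)).
- by rewrite lee_fin divr_ge0// ltW.
- by mtac.
- by move=> x; rewrite lee_fin sqr_ge0.
- by rewrite lee_fin ltW.
apply: (@le_trans _ _ ((2 ^+ n)%:E * ((4 * (2 * pi) ^+ 3)%:E * (D / 4 ^+ n)%:E) + (8 / 2 ^+ n)%:E * ((2 * pi) ^+ 3)%:E)%E).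
  apply: leeD; apply: lee_wpmul2l.
  - by rewrite lee_fin ltW.
  - apply: (le_trans (amp_L2 k c t (cutdiff_int n))); apply: lee_wpmul2l => //.
    by rewrite lee_fin mulr_ge0.
  - by rewrite lee_fin divr_ge0// ltW.
  - exact: integral_wt.
rewrite -!EFinM -EFinD lee_fin /C le_eqVlt; apply/orP; left; apply/eqP.
have -> : 4 ^+ n = 2 ^+ n * 2 ^+ n :> R by rewrite -exprMn; congr (_ ^+ _); ring.
by field; exact: lt0r_neq0.
Qed.

Lemma conv_ae t : {ae lebR3, forall x, conv t x}.
Proof.
have mw := @measurable_wt R.
have mc : measurable_fun setT (csum t) by apply: measurable_csum; mtac.
have m1 : measurable_fun setT (fun x => csum t x * (wt x)%:E)%E by apply: emeasurable_funM; mtac.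
have [N [mN N0 sN]] := @ge0_integral_lty_ae R _ _ lebR3 _ m1 (fun x => mule_ge0 (csum_ge0 t x) (ltW (wt_gt0 x : (0 < (wt x)%:E)%E))) (integral_csum_wt t).
exists N; split => // x nx; apply: sN => /= H; apply: nx.
rewrite /= /conv ltNge leye_eq; apply/negP => /eqP S; move: H.
by rewrite S gt0_mulye ?lte_fin ?wt_gt0.
Qed.

Variable phi : R3 -> R.
Hypothesis mphi : measurable_fun setT phi.
Variable M : R.
Hypothesis phiM : forall x, `|phi x| <= M * wt x.

Let M0 : 0 <= M.
Proof.
have := le_trans (normr_ge0 _) (phiM (0, 0, 0)).
by rewrite pmulr_lge0// wt_gt0.
Qed.

Lemma integrable_wt_bounded : lebR3.-integrable setT (EFin \o phi).
Proof.
have iM : lebR3.-integrable setT (EFin \o (fun x => M * wt x)).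
  by have := integrableZl measurableT M (integrable_wt R).
apply: (le_integrable measurableT _ _ iM) => /=; first exact/measurable_EFinP.
by move=> x _; rewrite lee_fin (ger0_norm (mulr_ge0 M0 (ltW (wt_gt0 x)))).
Qed.

Lemma lamp_test t : lebR3.-integrable setT (EFin \o (fun x => lamp t x * phi x)) /\
  \int[lebR3]_x (camp j t x * phi x) @[j --> \oo] --> \int[lebR3]_x (lamp t x * phi x).
Proof.
have mw := @measurable_wt R.
have mc : measurable_fun setT (csum t) by apply: measurable_csum; mtac.
have mc0 : measurable_fun setT (camp 0 t) by apply: measurable_camp; mtac.
have [N [mN N0 sN]] := conv_ae t.
have mfc : measurable_fun setT (fun x => fine (csum t x)) by apply: (measurableT_comp (@fine_measurable R setT measurableT)).
apply: (@Rdominated_convergence _ _ _ lebR3 (fun j x => camp j t x * phi x) (fun x => lamp t x * phi x)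
   (fun x => (`|camp 0 t x| + fine (csum t x)) * (M * wt x))).
- by move=> j; mtac; apply: measurable_camp; mtac.
- by mtac; apply: measurable_lamp; mtac.
- exists N; split => // x nx; apply: sN => /= C; apply: nx.
  by apply: cvgM; [exact: camp_cvg|exact: cvg_cst].
- apply/integrableP; split; first by apply/measurable_EFinP; mtac.
  pose L := \int[lebR3]_xi `|cut 0 xi|.
  have L0 : 0 <= L by apply: Rintegral_ge0.
  apply: (@le_lt_trans _ _ (\int[lebR3]_x ((L * M)%:E * (wt x)%:E + M%:E * (csum t x * (wt x)%:E)))%E).
    apply: ge0_le_integral_mono => x; first exact: abse_ge0.
    have w0 := ltW (wt_gt0 x).
    have f0 : 0 <= fine (csum t x) by rewrite fine_ge0 ?csum_ge0.
    rewrite -[X in (X <= _)%E]/((`|(`|camp 0 t x| + fine (csum t x)) * (M * wt x)|)%:E).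
    rewrite (ger0_norm (mulr_ge0 (addr_ge0 (normr_ge0 _) f0) (mulr_ge0 M0 w0))) mulrDl EFinD; apply: leeD.
      rewrite -EFinM lee_fin mulrA; apply: ler_wpM2r => //; apply: ler_wpM2r => //.
      exact: (amp_le k c t x (ih 0)).
    rewrite mulrCA EFinM; apply: lee_wpmul2l; first by rewrite lee_fin.
    rewrite EFinM; apply: lee_wpmul2r; first by rewrite lee_fin.
    have := csum_ge0 t x; case: (csum t x) => [r| |]//= _; rewrite ?leey//.
  rewrite ge0_integralD; last 5 first.
  - exact: measurableT.
  - by move=> x _; rewrite -EFinM lee_fin mulr_ge0 ?(ltW (wt_gt0 x))// mulr_ge0.
  - by mtac.
  - by move=> x _; rewrite mule_ge0 ?lee_fin// mule_ge0 ?csum_ge0// lee_fin (ltW (wt_gt0 x)).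
  - by mtac.
  rewrite !ge0_intZl; last 6 first.
  - by mtac.
  - by move=> x; rewrite lee_fin (ltW (wt_gt0 x)).
  - by rewrite lee_fin mulr_ge0.
  - by mtac.
  - by move=> x; rewrite mule_ge0 ?csum_ge0// lee_fin (ltW (wt_gt0 x)).
  - by rewrite lee_fin.
  apply: lte_add_pinfty.
    apply: (@le_lt_trans _ _ ((L * M)%:E * ((2 * pi) ^+ 3)%:E)%E); last by rewrite -EFinM ltry.
    by apply: lee_wpmul2l; [rewrite lee_fin mulr_ge0|exact: integral_wt].
  by apply: lte_mul_pinfty; [rewrite lee_fin|by []|exact: integral_csum_wt].
- exists N; split => // x nx; apply: sN => /= C; apply: nx => j.
  by rewrite normrM ler_pM// camp_le.
Qed.

(** Duality holds for each truncation by Fubini, and both sides pass to the limit: in space by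
    [lamp_test], in frequency by a domination that treats low and high frequencies separately. *)
Lemma lamp_dual t : lebR3.-integrable setT (EFin \o (fun xi => h xi * dualamp k c t phi xi)) /\
  \int[lebR3]_x (lamp t x * phi x) = \int[lebR3]_xi (h xi * dualamp k c t phi xi).
Proof.
have ip := integrable_wt_bounded.
have mda := measurable_dualamp k c t mphi.
pose L := \int[lebR3]_x `|phi x|.
have L0 : 0 <= L by apply: Rintegral_ge0.
have me : measurable_fun setT (@enorm R) by rewrite /enorm /dot; mtac.
have [i C] : lebR3.-integrable setT (EFin \o (fun xi => h xi * dualamp k c t phi xi)) /\
    \int[lebR3]_xi (cut j xi * dualamp k c t phi xi) @[j --> \oo] --> \int[lebR3]_xi (h xi * dualamp k c t phi xi).
  (* For |xi| <= 1, [h] coincides with the integrable [cut 0] and the dual amplitude is at most [L].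
     For |xi| > 1 the product is bounded by the sum of the squares of h |xi| and of the dual
     amplitude, both integrable. *)
  apply: (@Rdominated_convergence _ _ _ lebR3 (fun j xi => cut j xi * dualamp k c t phi xi) _
    (fun xi => L * `|cut 0 xi| + (h xi ^+ 2 * enorm xi ^+ 2 + dualamp k c t phi xi ^+ 2))).
  - by move=> j; have mcj := measurable_cut j; mtac.
  - by mtac.
  - exists set0; split => // xi nx; exfalso; apply: nx => /=.
    apply: cvgM; last exact: cvg_cst.
    apply: cvg_near_cst; near=> j.
    rewrite /cut (_ : enorm xi <= 2 ^+ j) ?mul1r//.
    have j1 : enorm xi <= j%:R by near: j; exact: nbhs_infty_ger.
    apply: (le_trans j1); rewrite -natrX ler_nat; exact: ltnW (ltn_expl _ _).
  - have iL : lebR3.-integrable setT (EFin \o (fun xi => L * `|cut 0 xi|)).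
      by have := integrableZl measurableT L (integrable_abse (ih 0)).
    have iD : lebR3.-integrable setT (EFin \o (fun xi => h xi ^+ 2 * enorm xi ^+ 2)).
      apply/integrableP; split; first by apply/measurable_EFinP; mtac.
      have E x : (`|(EFin \o (fun xi => (h xi ^+ 2 * enorm xi ^+ 2)%R)) x| = (h x ^+ 2 * enorm x ^+ 2)%:E)%E.
        by rewrite gee0_abs// lee_fin mulr_ge0 ?sqr_ge0.
      by under eq_integral do rewrite E.
    have iP : lebR3.-integrable setT (EFin \o (fun xi => dualamp k c t phi xi ^+ 2)).
      apply/integrableP; split; first by apply/measurable_EFinP; mtac.
      under eq_integral => x _ do rewrite gee0_abs ?lee_fin ?sqr_ge0//.
      apply: (le_lt_trans (dualamp_L2 k c t ip)).
      apply: lte_mul_pinfty; [by rewrite lee_fin exprn_ge0// mulr_ge0// pi_ge0|by []|].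
      apply: (@le_lt_trans _ _ (\int[lebR3]_x ((M * 8 * M)%:E * (wt x)%:E))%E).
        apply: ge0_le_integral_mono => x; first by rewrite lee_fin sqr_ge0.
        have w0 := ltW (wt_gt0 x).
        rewrite -EFinM lee_fin -(real_normK (num_real (phi x))) expr2.
        rewrite (_ : M * 8 * M * wt x = (M * wt x) * (M * 8)); last by ring.
        by apply: ler_pM => //; apply: (le_trans (phiM x)); apply: ler_wpM2l => //; exact: wt_le8.
      rewrite ge0_intZl; last 3 first.
      - by have mw := @measurable_wt R; mtac.
      - by move=> x; rewrite lee_fin (ltW (wt_gt0 x)).
      - by rewrite lee_fin !mulr_ge0.
      apply: (@le_lt_trans _ _ ((M * 8 * M)%:E * ((2 * pi) ^+ 3)%:E)%E); last by rewrite -EFinM ltry.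
      by apply: lee_wpmul2l; [rewrite lee_fin !mulr_ge0|exact: integral_wt].
    have := integrableD measurableT iL (integrableD measurableT iD iP); exact.
  - exists set0; split => // xi nx; exfalso; apply: nx => j.
    have dle := dualamp_le k c t xi ip; rewrite -/L in dle.
    have e0 := enorm_ge0 xi.
    rewrite normrM; have [e1|e1] := leP (enorm xi) 1.
      have -> : cut j xi = cut 0 xi by rewrite /cut expr0 e1 (le_trans e1)// exprn_ege1// ler1n.
      apply: (@le_trans _ _ (L * `|cut 0 xi|)); first by rewrite mulrC ler_wpM2r.
      by rewrite lerDl; apply: addr_ge0; [apply: mulr_ge0; exact: sqr_ge0|exact: sqr_ge0].
    apply: (@le_trans _ _ (h xi ^+ 2 * enorm xi ^+ 2 + dualamp k c t phi xi ^+ 2)); last by rewrite lerDr mulr_ge0.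
    have c1 : `|cut j xi| <= `|h xi| by rewrite /cut normrM ler_piMl// normr_nat lern1 leq_b1.
    rewrite -(real_normK (num_real (h xi))) -(real_normK (num_real (dualamp k c t phi xi))).
    move: `|cut j xi| `|h xi| `|dualamp k c t phi xi| (normr_ge0 (cut j xi)) (normr_ge0 (h xi)) (normr_ge0 (dualamp k c t phi xi)) c1 => a b d a0 b0 d0 ab.
    apply: (@le_trans _ _ (b * d)); first exact: ler_wpM2r.
    apply: (@le_trans _ _ (b ^+ 2 + d ^+ 2)).
      by rewrite -subr_ge0 (_ : _ - _ = (b - d / 2) ^+ 2 + 3 / 4 * d ^+ 2); [rewrite addr_ge0 ?sqr_ge0// mulr_ge0 ?sqr_ge0|field].
    by rewrite lerD2r ler_peMr ?sqr_ge0// exprn_ege1// ltW.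
split => //; have [_ C'] := lamp_test t.
apply: (cvg_unique (@Rhausdorff R) C' _).
rewrite (_ : (fun j => _) = (fun j => \int[lebR3]_xi (cut j xi * dualamp k c t phi xi))); first exact: C.
by apply/funext => j; exact: amp_dual.
Unshelve. all: by end_near. Qed.

End limit_amplitude.

Section lamp_bound.
Context (R : realType).
Notation mu := (@lebesgue_measure R).
Notation lebR3 := (@lebR3 R).
Notation R3 := (R * R * R)%type.

(** Fatou's lemma in time and then in space transfers the bound from the truncations, whose H^1
    norms do not exceed that of [h]. *)
Lemma lamp_bound (k c : R) (h : R3 -> R) : k != 0 -> measurable_fun setT h ->
  (forall j, lebR3.-integrable setT (EFin \o cut h j)) ->
  (\int[lebR3]_x (\int[mu]_t (`|lamp k c h t x| ^+ 3)%:E) ^+ 2 <=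
   (64 * (144 * pi / k) ^+ 2 * (2 * pi) ^+ 6)%:E * (\int[lebR3]_xi (h xi ^+ 2 * enorm xi ^+ 2)%:E) ^+ 3)%E.
Proof.
move=> k0 mh ih.
pose J j x : \bar R := (\int[mu]_t (`|camp k c h j t x| ^+ 3)%:E)%E.
have J0 j x : (0 <= J j x)%E by apply: integral_ge0 => t _; rewrite lee_fin exprn_ge0.
have mcp j : measurable_fun setT (fun p : R3 * R => camp k c h j p.2 p.1) by apply: measurable_camp => //; mtac.
have mJ j : measurable_fun setT (J j).
  apply: (@measurable_fun_integral _ _ R _ _ mu (fun x t => (`|camp k c h j t x| ^+ 3)%:E)).
  by mtac; exact: mcp.
apply: (@le_trans _ _ (\int[lebR3]_x limn_einf (fun j => (J j x ^+ 2)%E))%E).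
  apply: ge0_le_integral_mono => x; first by apply: expe_ge0; apply: integral_ge0 => t _; rewrite lee_fin exprn_ge0.
  apply: le_trans (limn_einf_sqr (fun j => J0 j x)).
  have I0 : (0 <= \int[mu]_t (`|lamp k c h t x| ^+ 3)%:E)%E by apply: integral_ge0 => t _; rewrite lee_fin exprn_ge0.
  suff H : (\int[mu]_t (`|lamp k c h t x| ^+ 3)%:E <= limn_einf (J ^~ x))%E by rewrite !expe2; apply: lee_pmul.
  apply: (@le_trans _ _ (\int[mu]_t limn_einf (fun j => (`|camp k c h j t x| ^+ 3)%:E))%E).
    by apply: ge0_le_integral_mono => t; [rewrite lee_fin exprn_ge0|exact: lamp_cube_le].
  apply: (@fatou _ _ R mu setT measurableT (fun j t => (`|camp k c h j t x| ^+ 3)%:E)).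
  - move=> j; have mjx : measurable_fun setT (fun t => camp k c h j t x) by apply: measurable_camp => //; mtac.
    by mtac.
  - by move=> j t _; rewrite lee_fin exprn_ge0.
apply: (@le_trans _ _ (limn_einf (fun j => (\int[lebR3]_x (J j x ^+ 2))%E))).
  apply: (@fatou _ _ R lebR3 setT measurableT (fun j x => J j x ^+ 2)%E).
  - by move=> j; exact: (measurable_fun_expe 2 (mJ j)).
  - by move=> j x _; apply: expe_ge0.
rewrite limn_einf_lim; apply: lime_le; first exact: is_cvg_einfs.
apply: nearW => j; apply: (@le_trans _ _ (\int[lebR3]_x (J j x ^+ 2))%E).
  by apply: ereal_inf_lbound; exists j => /=.
apply: (le_trans (amp_bound_all c k0 (ih j))).
apply: lee_wpmul2l; first by rewrite lee_fin; apply: mulr_ge0; [apply: mulr_ge0 => //; exact: sqr_ge0|rewrite exprn_ge0// mulr_ge0// pi_ge0].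
have I0 (f : R3 -> R) : (0 <= \int[lebR3]_xi (f xi ^+ 2 * enorm xi ^+ 2)%:E)%E.
  by apply: integral_ge0 => q _; rewrite lee_fin mulr_ge0 ?sqr_ge0.
have L : (\int[lebR3]_xi (cut h j xi ^+ 2 * enorm xi ^+ 2)%:E <= \int[lebR3]_xi (h xi ^+ 2 * enorm xi ^+ 2)%:E)%E.
  apply: ge0_le_integral_mono => q; first by rewrite lee_fin mulr_ge0 ?sqr_ge0.
  rewrite lee_fin ler_wpM2r ?sqr_ge0// /cut exprMn ler_piMl ?sqr_ge0//.
  by case: (enorm q <= _) => /=; rewrite ?expr1n ?expr0n.
by rewrite !expeS expe0 !mule1; apply: lee_pmul => //; [exact: mule_ge0|apply: lee_pmul].
Qed.

End lamp_bound.

(** * The propagator *)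
Section schwartz_facts.
Context (R : realType).
Notation R3 := (R * R * R)%type.

Lemma smooth_measurable (f : R3 -> R) : smooth f -> measurable_fun setT f.
Proof.
move=> sf; apply: open_measurable_fun => x; apply: differentiable_continuous; exact: (sf [::] x).
Qed.

(** The order 6 comes from 1 + x_i^2 <= (1 + |x|)^2 in each of the three coordinates; the 8 is the
    product of the three factors 2 in [pker 1]. *)
Lemma seminorm_wt (f : R3 -> R) (M : R) : seminorm_le 6 M f -> forall x, `|f x| <= M / 8 * wt x.
Proof.
move=> sM x; have := sM [::] x isT; rewrite /partial/= => H.
have e0 := enorm_ge0 x.
have b (v : R) : v ^+ 2 <= enorm x ^+ 2 -> 1 + v ^+ 2 <= (1 + enorm x) ^+ 2.
  by move=> ve; rewrite sqrrD expr1n mul1r -addrA lerD2l; apply: (le_trans ve); rewrite lerDr mulrn_wge0.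
have E := enorm_sqr x; rewrite /dot -!expr2 in E.
have s1 := sqr_ge0 x.1.1; have s2 := sqr_ge0 x.1.2; have s3 := sqr_ge0 x.2.
have b1 : 1 + x.1.1 ^+ 2 <= (1 + enorm x) ^+ 2 by apply: b; rewrite E; lra.
have b2 : 1 + x.1.2 ^+ 2 <= (1 + enorm x) ^+ 2 by apply: b; rewrite E; lra.
have b3 : 1 + x.2 ^+ 2 <= (1 + enorm x) ^+ 2 by apply: b; rewrite E; lra.
have p1 : 0 < 1 + x.1.1 ^+ 2 by lra.
have p2 : 0 < 1 + x.1.2 ^+ 2 by lra.
have p3 : 0 < 1 + x.2 ^+ 2 by lra.
have P0 : 0 < (1 + x.1.1 ^+ 2) * (1 + x.1.2 ^+ 2) * (1 + x.2 ^+ 2) by apply: mulr_gt0 => //; apply: mulr_gt0.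
have P6 : (1 + x.1.1 ^+ 2) * (1 + x.1.2 ^+ 2) * (1 + x.2 ^+ 2) <= (1 + enorm x) ^+ 6.
  rewrite (_ : (1 + enorm x) ^+ 6 = (1 + enorm x) ^+ 2 * (1 + enorm x) ^+ 2 * (1 + enorm x) ^+ 2); last by rewrite -!exprD.
  by apply: ler_pM => //; [apply: mulr_ge0; exact: ltW|exact: ltW|apply: ler_pM => //; exact: ltW].
have -> : M / 8 * wt x = M / ((1 + x.1.1 ^+ 2) * (1 + x.1.2 ^+ 2) * (1 + x.2 ^+ 2)).
  by rewrite /wt /pker !expr1n !mulr1; field; rewrite !lt0r_neq0.
by rewrite ler_pdivlMr// mulrC; apply: le_trans H; apply: ler_wpM2r.
Qed.

End schwartz_facts.

Section propagator.
Context (R : realType).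
Notation mu := (@lebesgue_measure R).
Notation lebR3 := (@lebR3 R).
Notation R3 := (R * R * R)%type.
Notation C := (complex R).
Variables (k : R) (wr wi : R3 -> R).
Hypotheses (mwr : measurable_fun setT wr) (mwi : measurable_fun setT wi).
Hypothesis iwr : forall j, lebR3.-integrable setT (EFin \o cut wr j).
Hypothesis iwi : forall j, lebR3.-integrable setT (EFin \o cut wi j).
Hypothesis Dwr : (\int[lebR3]_xi (wr xi ^+ 2 * enorm xi ^+ 2)%:E < +oo)%E.
Hypothesis Dwi : (\int[lebR3]_xi (wi xi ^+ 2 * enorm xi ^+ 2)%:E < +oo)%E.

Let s : R := - (pi / 2).
Let cosDs a : cos (a + s) = sin a :> R.
Proof. by rewrite /s cosB cos_pihalf sin_pihalf mulr0 mulr1 add0r. Qed.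

(** Real and imaginary part of the integral of e^{i phase} (wr + i wi), where the shift [s] by - pi
    / 2 makes a cosine amplitude a sine amplitude. *)
Definition prop (t : R) (x : R3) : C :=
  Complex (lamp k 0 wr t x - lamp k s wi t x) (lamp k s wr t x + lamp k 0 wi t x).

Lemma ReM (a b : R) (z : C) : complex.Re (Complex a b * z) = a * complex.Re z - b * complex.Im z.
Proof. by case: z. Qed.

Lemma ImM (a b : R) (z : C) : complex.Im (Complex a b * z) = a * complex.Im z + b * complex.Re z.
Proof. by case: z. Qed.

Lemma Rintegral_leb3 (f : R3 -> R) : \int[leb3 R]_x f x = \int[lebR3]_x f x.
Proof. by []. Qed.

Lemma dotC (x y : R3) : dot x y = dot y x.
Proof. by rewrite /dot; congr (_ + _ + _); rewrite mulrC. Qed.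

(** Moves the multiplier from the amplitude to the test side: its product with the inverse transform
    of phi is a combination of dual amplitudes with shifts 0 and [s]. *)
Lemma inv_fourier_dual (phi : R3 -> C) t xi :
  lebR3.-integrable setT (EFin \o (fun x => complex.Re (phi x))) ->
  lebR3.-integrable setT (EFin \o (fun x => complex.Im (phi x))) ->
  (expi (t * (k * (xi.2 / enorm xi))) * inv_fourier phi xi)%R =
  Complex (dualamp k 0 t (fun x => complex.Re (phi x)) xi - dualamp k s t (fun x => complex.Im (phi x)) xi)
          (dualamp k s t (fun x => complex.Re (phi x)) xi + dualamp k 0 t (fun x => complex.Im (phi x)) xi).
Proof.
set fr := (fun x => complex.Re (phi x)); set fi := (fun x => complex.Im (phi x)) => ir ii.
set th := t * _.
have md : measurable_fun setT (fun x : R3 => dot x xi) by rewrite /dot; mtac.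
have icr := integrable_cosM ir md; have isr := integrable_sinM ir md.
have ici := integrable_cosM ii md; have isi := integrable_sinM ii md.
pose Cr := \int[lebR3]_x (cos (dot x xi) * fr x); pose Sr := \int[lebR3]_x (sin (dot x xi) * fr x).
pose Ci := \int[lebR3]_x (cos (dot x xi) * fi x); pose Si := \int[lebR3]_x (sin (dot x xi) * fi x).
have -> : inv_fourier phi xi = Complex (Cr - Si) (Ci + Sr).
  rewrite /inv_fourier /cintegral !Rintegral_leb3; congr Complex.
    rewrite /Cr /Si -(RintegralB measurableT icr isi).
    by apply: eq_Rintegral => x _; rewrite dotC ReM.
  rewrite /Ci /Sr -(RintegralD measurableT ici isr).
  by apply: eq_Rintegral => x _; rewrite dotC ImM.
have d0 f : lebR3.-integrable setT (EFin \o f) -> dualamp k 0 t f xi =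
    cos th * (\int[lebR3]_x (cos (dot x xi) * f x)) - sin th * (\int[lebR3]_x (sin (dot x xi) * f x)).
  move=> if_; have ic := integrable_cosM if_ md; have is_ := integrable_sinM if_ md.
  rewrite -(RintegralZl (cos th) measurableT ic) -(RintegralZl (sin th) measurableT is_).
  rewrite -(RintegralB measurableT (integrableZl measurableT (cos th) ic) (integrableZl measurableT (sin th) is_)).
  apply: eq_Rintegral => x _; rewrite /sphase addr0 -/th cosD.
  move: (cos (dot x xi)) (sin (dot x xi)) (cos th) (sin th) (f x) => a1 a2 a3 a4 a5; ring.
have ds f : lebR3.-integrable setT (EFin \o f) -> dualamp k s t f xi =
    sin th * (\int[lebR3]_x (cos (dot x xi) * f x)) + cos th * (\int[lebR3]_x (sin (dot x xi) * f x)).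
  move=> if_; have ic := integrable_cosM if_ md; have is_ := integrable_sinM if_ md.
  rewrite -(RintegralZl (sin th) measurableT ic) -(RintegralZl (cos th) measurableT is_).
  rewrite -(RintegralD measurableT (integrableZl measurableT (sin th) ic) (integrableZl measurableT (cos th) is_)).
  apply: eq_Rintegral => x _; rewrite /sphase cosDs -/th sinD.
  move: (cos (dot x xi)) (sin (dot x xi)) (cos th) (sin th) (f x) => a1 a2 a3 a4 a5; ring.
rewrite (d0 _ ir) (d0 _ ii) (ds _ ir) (ds _ ii) -/Cr -/Sr -/Ci -/Si /expi.
move: (cos th) (sin th) Cr Sr Ci Si => a1 a2 a3 a4 a5 a6.
by apply/eqP; rewrite eq_complex /=; apply/andP; split; apply/eqP; ring.
Qed.

(** The pairing is bilinear, without conjugation. Splitting amplitude, oscillation and test function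
    into real and imaginary parts yields eight real dualities, instances of [lamp_dual], which
    recombine linearly. *)
Lemma prop_inv_fourier t : is_inv_fourier (fun xi => expi (t * (k * (xi.2 / enorm xi))) * Complex (wr xi) (wi xi)) (prop t).
Proof.
move=> phi [sr si bd]; have [M [Mr Mi]] := bd 6%N.
set fr := (fun x => complex.Re (phi x)) in sr Mr; set fi := (fun x => complex.Im (phi x)) in si Mi.
have mr := smooth_measurable sr; have mi := smooth_measurable si.
have br := seminorm_wt Mr; have bi := seminorm_wt Mi.
have ir := integrable_wt_bounded mr br; have ii := integrable_wt_bounded mi bi.
have [rr0 rr0E] := lamp_dual k 0 mwr iwr Dwr mr br t.
have [rrs rrsE] := lamp_dual k s mwr iwr Dwr mr br t.
have [ri0 ri0E] := lamp_dual k 0 mwr iwr Dwr mi bi t.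
have [ris risE] := lamp_dual k s mwr iwr Dwr mi bi t.
have [ir0 ir0E] := lamp_dual k 0 mwi iwi Dwi mr br t.
have [irs irsE] := lamp_dual k s mwi iwi Dwi mr br t.
have [ii0 ii0E] := lamp_dual k 0 mwi iwi Dwi mi bi t.
have [iis iisE] := lamp_dual k s mwi iwi Dwi mi bi t.
have [lrr0 _] := lamp_test k 0 mwr iwr Dwr mr br t.
have [lrrs _] := lamp_test k s mwr iwr Dwr mr br t.
have [lri0 _] := lamp_test k 0 mwr iwr Dwr mi bi t.
have [lris _] := lamp_test k s mwr iwr Dwr mi bi t.
have [lir0 _] := lamp_test k 0 mwi iwi Dwi mr br t.
have [lirs _] := lamp_test k s mwi iwi Dwi mr br t.
have [lii0 _] := lamp_test k 0 mwi iwi Dwi mi bi t.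
have [liis _] := lamp_test k s mwi iwi Dwi mi bi t.
have addI (f g : R3 -> R) : lebR3.-integrable setT (EFin \o f) -> lebR3.-integrable setT (EFin \o g) ->
   lebR3.-integrable setT (EFin \o (fun x => f x + g x)).
  by move=> if_ ig; have := integrableD measurableT if_ ig.
have subI (f g : R3 -> R) : lebR3.-integrable setT (EFin \o f) -> lebR3.-integrable setT (EFin \o g) ->
   lebR3.-integrable setT (EFin \o (fun x => f x - g x)).
  by move=> if_ ig; have := integrableB measurableT if_ ig.
pose V0r x := lamp k 0 wr t x * fr x; pose Vsr x := lamp k s wr t x * fr x.
pose V0i x := lamp k 0 wr t x * fi x; pose Vsi x := lamp k s wr t x * fi x.
pose W0r x := lamp k 0 wi t x * fr x; pose Wsr x := lamp k s wi t x * fr x.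
pose W0i x := lamp k 0 wi t x * fi x; pose Wsi x := lamp k s wi t x * fi x.
have RE : (fun x => complex.Re (prop t x * phi x)%R) = (fun x => (V0r x - Wsr x) - (Vsi x + W0i x)).
  apply/funext => x; rewrite /prop ReM /V0r /Wsr /Vsi /W0i -/(fr x) -/(fi x).
  move: (lamp k 0 wr t x) (lamp k s wr t x) (lamp k 0 wi t x) (lamp k s wi t x) (fr x) (fi x) => a1 a2 a3 a4 a5 a6; ring.
have IE : (fun x => complex.Im (prop t x * phi x)%R) = (fun x => (V0i x - Wsi x) + (Vsr x + W0r x)).
  apply/funext => x; rewrite /prop ImM /V0i /Wsi /Vsr /W0r -/(fr x) -/(fi x).
  move: (lamp k 0 wr t x) (lamp k s wr t x) (lamp k 0 wi t x) (lamp k s wi t x) (fr x) (fi x) => a1 a2 a3 a4 a5 a6; ring.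
pose A0r x := wr x * dualamp k 0 t fr x; pose Asr x := wr x * dualamp k s t fr x.
pose A0i x := wr x * dualamp k 0 t fi x; pose Asi x := wr x * dualamp k s t fi x.
pose B0r x := wi x * dualamp k 0 t fr x; pose Bsr x := wi x * dualamp k s t fr x.
pose B0i x := wi x * dualamp k 0 t fi x; pose Bsi x := wi x * dualamp k s t fi x.
have GE xi : (expi (t * (k * (xi.2 / enorm xi))) * Complex (wr xi) (wi xi) * inv_fourier phi xi)%R =
   Complex ((A0r xi - Bsr xi) - (Asi xi + B0i xi)) ((A0i xi - Bsi xi) + (Asr xi + B0r xi)).
  rewrite mulrAC (inv_fourier_dual _ _ ir ii) -/fr -/fi /A0r /Bsr /Asi /B0i /A0i /Bsi /Asr /B0r.
  move: (dualamp k 0 t fr xi) (dualamp k s t fr xi) (dualamp k 0 t fi xi) (dualamp k s t fi xi) (wr xi) (wi xi) => a1 a2 a3 a4 a5 a6.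
  by apply/eqP; rewrite eq_complex /=; apply/andP; split; apply/eqP; ring.
have RG : (fun xi => complex.Re (expi (t * (k * (xi.2 / enorm xi))) * Complex (wr xi) (wi xi) * inv_fourier phi xi)%R) =
   (fun x => (A0r x - Bsr x) - (Asi x + B0i x)) by apply/funext => xi; rewrite GE.
have IG : (fun xi => complex.Im (expi (t * (k * (xi.2 / enorm xi))) * Complex (wr xi) (wi xi) * inv_fourier phi xi)%R) =
   (fun x => (A0i x - Bsi x) + (Asr x + B0r x)) by apply/funext => xi; rewrite GE.
have v1 : lebR3.-integrable setT (EFin \o (fun x => V0r x - Wsr x)) by exact: (subI _ _ lrr0 lirs).
have v2 : lebR3.-integrable setT (EFin \o (fun x => Vsi x + W0i x)) by exact: (addI _ _ lris lii0).
have v3 : lebR3.-integrable setT (EFin \o (fun x => V0i x - Wsi x)) by exact: (subI _ _ lri0 liis).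
have v4 : lebR3.-integrable setT (EFin \o (fun x => Vsr x + W0r x)) by exact: (addI _ _ lrrs lir0).
have a1 : lebR3.-integrable setT (EFin \o (fun x => A0r x - Bsr x)) by exact: (subI _ _ rr0 irs).
have a2 : lebR3.-integrable setT (EFin \o (fun x => Asi x + B0i x)) by exact: (addI _ _ ris ii0).
have a3 : lebR3.-integrable setT (EFin \o (fun x => A0i x - Bsi x)) by exact: (subI _ _ ri0 iis).
have a4 : lebR3.-integrable setT (EFin \o (fun x => Asr x + B0r x)) by exact: (addI _ _ rrs ir0).
split.
- by split; [rewrite RE; exact: (subI _ _ v1 v2)|rewrite IE; exact: (addI _ _ v3 v4)].
- by split; [rewrite RG; exact: (subI _ _ a1 a2)|rewrite IG; exact: (addI _ _ a3 a4)].
have eqR (f g : R3 -> R) : f = g -> \int[leb3 R]_x f x = \int[lebR3]_x g x by move=> ->.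
rewrite /cintegral (eqR _ _ RE).
rewrite (eqR _ _ IE).
rewrite (eqR _ _ RG).
rewrite (eqR _ _ IG).
congr Complex.
  rewrite (RintegralB measurableT v1 v2) (RintegralB measurableT a1 a2).
  rewrite (RintegralB measurableT lrr0 lirs) (RintegralB measurableT rr0 irs).
  rewrite (RintegralD measurableT lris lii0) (RintegralD measurableT ris ii0).
  by apply: congr2; [apply: congr2; [exact: rr0E|congr (- _); exact: irsE]|congr (- _); apply: congr2; [exact: risE|exact: ii0E]].
rewrite (RintegralD measurableT v3 v4) (RintegralD measurableT a3 a4).
rewrite (RintegralB measurableT lri0 liis) (RintegralB measurableT ri0 iis).
rewrite (RintegralD measurableT lrrs lir0) (RintegralD measurableT rrs ir0).
by apply: congr2; [apply: congr2; [exact: ri0E|congr (- _); exact: iisE]|apply: congr2; [exact: rrsE|exact: ir0E]].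
Qed.

Lemma measurable_prop_Re : measurable_fun setT (fun p : R * R3 => complex.Re (prop p.1 p.2)).
Proof. by rewrite /prop/=; mtac; apply: measurable_lamp => //; mtac. Qed.

Lemma measurable_prop_Im : measurable_fun setT (fun p : R * R3 => complex.Im (prop p.1 p.2)).
Proof. by rewrite /prop/=; mtac; apply: measurable_lamp => //; mtac. Qed.

End propagator.

Section fourier_side.
Context (R : realType).
Notation mu := (@lebesgue_measure R).
Notation lebR3 := (@lebR3 R).
Notation R3 := (R * R * R)%type.
Notation C := (complex R).

(** Testing with the Gaussian alone suffices: it is positive, so dividing by it recovers
    measurability, and on |xi| <= 2^j it is at least the reciprocal of [c], which gives
    integrability of the truncation. *)
Lemma is_fourier_local (g : (R3 -> C) -> C) (w : R3 -> C) : is_fourier g w ->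
  [/\ measurable_fun setT (fun xi => complex.Re (w xi)), measurable_fun setT (fun xi => complex.Im (w xi)),
      forall j, lebR3.-integrable setT (EFin \o cut (fun xi => complex.Re (w xi)) j) &
      forall j, lebR3.-integrable setT (EFin \o cut (fun xi => complex.Im (w xi)) j)].
Proof.
move=> gw; have [[iR iI] _] := gw _ (schwartz_tgauss (Cst 1)).
have mg := @measurable_gauss R.
have loc (f : R3 -> R) : lebR3.-integrable setT (EFin \o (fun xi => f xi * gauss xi)) ->
    measurable_fun setT f /\ forall j, lebR3.-integrable setT (EFin \o cut f j).
  move=> if_; have mfg := measurable_int _ if_; move/measurable_EFinP in mfg.
  have mf : measurable_fun setT f.
    rewrite (_ : f = (fun xi => f xi * gauss xi / gauss xi)); last first.
      by apply/funext => xi; rewrite mulfK// lt0r_neq0// gauss_gt0.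
    pose fg (xi : R3) := f xi * gauss xi; have mfg' : measurable_fun setT fg := mfg.
    by rewrite (_ : (fun xi => _) = (fun xi => fg xi / gauss xi))//; mtac.
  split => // j; pose c := expR ((2 ^+ j) ^+ 2) : R.
  have ic : lebR3.-integrable setT (EFin \o (fun xi => c * (f xi * gauss xi))).
    by have := integrableZl measurableT c if_.
  apply: (le_integrable measurableT _ _ ic) => /=.
    by apply/measurable_EFinP; exact: measurable_cut.
  move=> xi _; rewrite lee_fin /cut; have [e1|_] := leP (enorm xi) (2 ^+ j); last by rewrite mul0r normr0.
  rewrite mul1r mulrCA normrM ler_peMr// ger0_norm; last by rewrite mulr_ge0// ltW ?expR_gt0// gauss_gt0.
  have e2 : enorm xi ^+ 2 <= (2 ^+ j) ^+ 2 by rewrite lerXn2r ?nnegrE ?enorm_ge0 ?exprn_ge0.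
  by rewrite /c /gauss -expRD -[leLHS]expR0 ler_expR subr_ge0 -enorm_sqr.
have [mR lR] : measurable_fun setT (fun xi => complex.Re (w xi)) /\
    forall j, lebR3.-integrable setT (EFin \o cut (fun xi => complex.Re (w xi)) j).
  apply: loc; rewrite (_ : (fun xi => _) = (fun xi => complex.Re (w xi * realfun (fun x => tev (Cst 1) x * gauss x) xi)%R)); first exact: iR.
  by apply/funext => xi; case: (w xi) => a b; rewrite /= mul1r mulr0 subr0.
have [mI lI] : measurable_fun setT (fun xi => complex.Im (w xi)) /\
    forall j, lebR3.-integrable setT (EFin \o cut (fun xi => complex.Im (w xi)) j).
  apply: loc; rewrite (_ : (fun xi => _) = (fun xi => complex.Im (w xi * realfun (fun x => tev (Cst 1) x * gauss x) xi)%R)); first exact: iI.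
  by apply/funext => xi; case: (w xi) => a b; rewrite /= mul1r mulr0 add0r.
by split.
Qed.

(** Real test functions let the real and imaginary parts of the difference be tested separately;
    both integrate to 0 against the class of [test_ae0]. *)
Lemma is_inv_fourier_unique (G v1 v2 : R3 -> C) :
  measurable_fun setT (fun x => complex.Re (v1 x)) -> measurable_fun setT (fun x => complex.Im (v1 x)) ->
  measurable_fun setT (fun x => complex.Re (v2 x)) -> measurable_fun setT (fun x => complex.Im (v2 x)) ->
  is_inv_fourier G v1 -> is_inv_fourier G v2 -> {ae lebR3, forall x, v1 x = v2 x}.
Proof.
move=> mr1 mi1 mr2 mi2 H1 H2.
pose tg e (x : R3) : R := tev e x * gauss x.
have key (p1 p2 : R3 -> R) : measurable_fun setT p1 -> measurable_fun setT p2 ->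
    (forall e, lebR3.-integrable setT (EFin \o (fun x => p1 x * tg e x))) ->
    (forall e, lebR3.-integrable setT (EFin \o (fun x => p2 x * tg e x))) ->
    (forall e, \int[lebR3]_x (p1 x * tg e x) = \int[lebR3]_x (p2 x * tg e x)) ->
    {ae lebR3, forall x, p1 x - p2 x = 0}.
  move=> m1 m2 i1 i2 E.
  have E1 e : (fun x => (p1 x - p2 x) * (tev e x * gauss x)) = (fun x => p1 x * tg e x - p2 x * tg e x).
    by apply/funext => x; rewrite mulrBl.
  apply: test_ae0 => [|e|e]; first by mtac.
  - by rewrite E1; have := integrableB measurableT (i1 e) (i2 e).
  - by rewrite E1 (RintegralB measurableT (i1 e) (i2 e)) E subrr.
have ReE (v : R3 -> C) e : (fun x => complex.Re (v x * realfun (tg e) x)%R) = (fun x => complex.Re (v x) * tg e x).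
  by apply/funext => x; rewrite /realfun; case: (v x) => a b /=; rewrite mulr0 subr0.
have ImE (v : R3 -> C) e : (fun x => complex.Im (v x * realfun (tg e) x)%R) = (fun x => complex.Im (v x) * tg e x).
  by apply/funext => x; rewrite /realfun; case: (v x) => a b /=; rewrite mulr0 add0r.
have iRe (v : R3 -> C) : is_inv_fourier G v -> forall e, lebR3.-integrable setT (EFin \o (fun x => complex.Re (v x) * tg e x)).
  by move=> H e; have [[+ _] _ _] := H _ (schwartz_tgauss e); rewrite ReE.
have iIm (v : R3 -> C) : is_inv_fourier G v -> forall e, lebR3.-integrable setT (EFin \o (fun x => complex.Im (v x) * tg e x)).
  by move=> H e; have [[_ +] _ _] := H _ (schwartz_tgauss e); rewrite ImE.
have eRI e : cintegral (fun x => v1 x * realfun (tg e) x) = cintegral (fun x => v2 x * realfun (tg e) x).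
  have [_ _ E1] := H1 _ (schwartz_tgauss e); have [_ _ E2] := H2 _ (schwartz_tgauss e).
  exact: etrans E1 (esym E2).
have [N1 [mN1 N10 s1]] := key _ _ mr1 mr2 (iRe _ H1) (iRe _ H2) (fun e => etrans (etrans (congr1 (fun f => \int[lebR3]_x f x) (esym (ReE v1 e))) (congr1 (@complex.Re R) (eRI e))) (congr1 (fun f => \int[lebR3]_x f x) (ReE v2 e))).
have [N2 [mN2 N20 s2]] := key _ _ mi1 mi2 (iIm _ H1) (iIm _ H2) (fun e => etrans (etrans (congr1 (fun f => \int[lebR3]_x f x) (esym (ImE v1 e))) (congr1 (@complex.Im R) (eRI e))) (congr1 (fun f => \int[lebR3]_x f x) (ImE v2 e))).
exists (N1 `|` N2); split; [exact: measurableU|by rewrite measureU0|].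
move=> x /= nx; apply: contrapT => /not_orP[n1 n2]; apply: nx.
have r1 : complex.Re (v1 x) - complex.Re (v2 x) = 0 by apply: contrapT => H; apply: n1; apply: s1.
have r2 : complex.Im (v1 x) - complex.Im (v2 x) = 0 by apply: contrapT => H; apply: n2; apply: s2.
by apply/eqP; rewrite eq_complex -subr_eq0 r1 eqxx -subr_eq0 r2 eqxx.
Qed.

Lemma normcE (z : C) : Normc.normc z = Num.sqrt (complex.Re z ^+ 2 + complex.Im z ^+ 2).
Proof. by case: z. Qed.

Lemma normc_ge0 (z : C) : 0 <= Normc.normc z.
Proof. by rewrite normcE sqrtr_ge0. Qed.

Lemma normc_sqr (z : C) : Normc.normc z ^+ 2 = complex.Re z ^+ 2 + complex.Im z ^+ 2.
Proof. by rewrite normcE sqr_sqrtr// addr_ge0 ?sqr_ge0. Qed.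

Lemma normc_le_sum (z : C) : Normc.normc z <= `|complex.Re z| + `|complex.Im z|.
Proof.
rewrite -(@ler_pXn2r _ 2)// ?nnegrE ?normc_ge0 ?addr_ge0// normc_sqr -(real_normK (num_real (complex.Re z))) -(real_normK (num_real (complex.Im z))).
by rewrite sqrrD lerD2r lerDl mulrn_wge0// mulr_ge0.
Qed.

(** The hypothesis gives, for almost every t, equality for almost every x, whereas the norm
    integrates in t first. Tonelli applied to [E], the squared distance of u and v, exchanges the
    two quantifiers. *)
Lemma mixed_norm_ae_eq (u v : R -> R3 -> C) :
  measurable_fun setT (fun p : R * R3 => complex.Re (u p.1 p.2)) ->
  measurable_fun setT (fun p : R * R3 => complex.Im (u p.1 p.2)) ->
  measurable_fun setT (fun p : R * R3 => complex.Re (v p.1 p.2)) ->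
  measurable_fun setT (fun p : R * R3 => complex.Im (v p.1 p.2)) ->
  {ae mu, forall t, {ae lebR3, forall x, u t x = v t x}} ->
  (\int[lebR3]_x (\int[mu]_t (Normc.normc (u t x) ^+ 3)%:E) ^+ 2 =
   \int[lebR3]_x (\int[mu]_t (Normc.normc (v t x) ^+ 3)%:E) ^+ 2)%E.
Proof.
move=> mru miu mrv miv [N [mN N0 sN]].
pose ru t x := complex.Re (u t x); pose iu t x := complex.Im (u t x).
pose rv t x := complex.Re (v t x); pose iv t x := complex.Im (v t x).
have sec (f : R -> R3 -> R) d (T : measurableType d) (a : T -> R) (b : T -> R3) :
    measurable_fun setT (fun p : R * R3 => f p.1 p.2) -> measurable_fun setT a -> measurable_fun setT b ->
    measurable_fun setT (fun s => f (a s) (b s)).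
  by move=> mf ma mb; apply: (measurableT_comp mf (g := fun s => (a s, b s))); mtac.
pose E t x : R := (ru t x - rv t x) ^+ 2 + (iu t x - iv t x) ^+ 2.
have E0 t x : 0 <= E t x by rewrite addr_ge0 ?sqr_ge0.
have mE d (T : measurableType d) (a : T -> R) (b : T -> R3) : measurable_fun setT a -> measurable_fun setT b ->
    measurable_fun setT (fun s => E (a s) (b s)).
  by move=> ma mb; rewrite /E; mtac; [exact: (sec ru)|exact: (sec rv)|exact: (sec iu)|exact: (sec iv)].
have Euv t x : E t x = 0 -> u t x = v t x.
  move=> /eqP; rewrite paddr_eq0 ?sqr_ge0// !sqrf_eq0 !subr_eq0 => /andP[h1 h2].
  by apply/eqP; rewrite eq_complex; apply/andP; split.
have Z : (\int[lebR3]_x \int[mu]_t (E t x)%:E = 0)%E.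
  rewrite (@ge0_integral_swap _ _ _ _ _ lebR3 mu (fun x t => (E t x)%:E)); last 2 first.
  - by apply: measurable_fun_EFin; apply: mE; mtac.
  - by move=> x t; rewrite lee_fin.
  transitivity (\int[mu]_x (0 : \bar R))%E; last by rewrite integral0.
  apply: ge0_ae_eq_integral.
  - exact: measurableT.
  - apply: (@measurable_fun_integral _ _ R _ _ lebR3 (fun t x => (E t x)%:E)).
    by apply: measurable_fun_EFin; apply: mE; mtac.
  - exact: measurable_cst.
  - by move=> t _; apply: integral_ge0 => x _; rewrite lee_fin.
  - by move=> t _.
  - exists N; split => // t nt; apply: sN => /= -[N' [mN' N'0 sN']]; apply: nt => _.
    transitivity (\int[lebR3]_x (0 : \bar R))%E; last by rewrite integral0.
    apply: ge0_ae_eq_integral.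
    + exact: measurableT.
    + by apply: measurable_fun_EFin; apply: mE; mtac.
    + exact: measurable_cst.
    + by move=> x _; rewrite lee_fin.
    + by move=> x _.
    + exists N'; split => // x nx; apply: sN' => /= uv; apply: nx => _.
      by rewrite /E /ru /rv /iu /iv uv !subrr expr0n/= addr0.
have mEx : measurable_fun setT (fun x => \int[mu]_t (E t x)%:E)%E.
  apply: (@measurable_fun_integral _ _ R _ _ mu (fun x t => (E t x)%:E)).
  by apply: measurable_fun_EFin; apply: mE; mtac.
have Ex0 x : (0 <= \int[mu]_t (E t x)%:E)%E by apply: integral_ge0 => t _; rewrite lee_fin.
have [N1 [mN1 N10 s1]] : {ae lebR3, forall x, (\int[mu]_t (E t x)%:E = 0)%E}.
  have Z' : (\int[lebR3]_x `|\int[mu]_t (E t x)%:E| = 0)%E.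
    by rewrite -Z; apply: eq_integral => x _; rewrite gee0_abs.
  have /(ae_eq_integral_abs lebR3 measurableT mEx) [N1 [mN1 N10 s1]] := Z'.
  exists N1; split => // x nx; apply: s1 => /= H; apply: nx; exact: H.
have mnc (w : R -> R3 -> C) : measurable_fun setT (fun p : R * R3 => complex.Re (w p.1 p.2)) ->
    measurable_fun setT (fun p : R * R3 => complex.Im (w p.1 p.2)) ->
    forall d (T : measurableType d) (a : T -> R) (b : T -> R3), measurable_fun setT a -> measurable_fun setT b ->
    measurable_fun setT (fun s => (Normc.normc (w (a s) (b s)) ^+ 3)%:E).
  move=> mr mi d T a b ma mb.
  rewrite (_ : (fun s => _) = (fun s => (Num.sqrt (complex.Re (w (a s) (b s)) ^+ 2 + complex.Im (w (a s) (b s)) ^+ 2) ^+ 3)%:E)); last by apply/funext => s; rewrite normcE.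
  by mtac; [exact: (sec (fun t x => complex.Re (w t x)))|exact: (sec (fun t x => complex.Im (w t x)))].
apply: ge0_ae_eq_integral.
- exact: measurableT.
- apply: measurable_fun_expe; apply: (@measurable_fun_integral _ _ R _ _ mu (fun x t => (Normc.normc (u t x) ^+ 3)%:E)).
  by apply: mnc => //; mtac.
- apply: measurable_fun_expe; apply: (@measurable_fun_integral _ _ R _ _ mu (fun x t => (Normc.normc (v t x) ^+ 3)%:E)).
  by apply: mnc => //; mtac.
- by move=> x _; apply: expe_ge0; apply: integral_ge0 => t _; rewrite lee_fin exprn_ge0// normc_ge0.
- by move=> x _; apply: expe_ge0; apply: integral_ge0 => t _; rewrite lee_fin exprn_ge0// normc_ge0.
- exists N1; split => // x nx; apply: s1 => /= Z1; apply: nx => _; congr (_ ^+ 2)%E.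
  apply: ge0_ae_eq_integral.
  + exact: measurableT.
  + by apply: mnc => //; mtac.
  + by apply: mnc => //; mtac.
  + by move=> t _; rewrite lee_fin exprn_ge0// normc_ge0.
  + by move=> t _; rewrite lee_fin exprn_ge0// normc_ge0.
  + have mEt : measurable_fun setT (fun t => (E t x)%:E) by apply: measurable_fun_EFin; apply: mE; mtac.
    have Z' : (\int[mu]_t `|(E t x)%:E| = 0)%E.
      by rewrite -Z1; apply: eq_integral => t _; rewrite gee0_abs// lee_fin.
    have /(ae_eq_integral_abs mu measurableT mEt) [N2 [mN2 N20 s2]] := Z'.
    exists N2; split => // t nt; apply: s2 => /= H; apply: nt => _.
    by rewrite (Euv t x)//; have [] := H Logic.I.
Qed.

(** The modulus is at most the sum of the absolute values of four amplitudes. Two rounds of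
    splitting a sum in two cost 64 each, and the four terms obey the same bound: 64 * 64 * 4 =
    2^14. *)
Lemma prop_bound (k : R) (w : R3 -> C) (D : R) : k != 0 ->
  measurable_fun setT (fun xi => complex.Re (w xi)) -> measurable_fun setT (fun xi => complex.Im (w xi)) ->
  (forall j, lebR3.-integrable setT (EFin \o cut (fun xi => complex.Re (w xi)) j)) ->
  (forall j, lebR3.-integrable setT (EFin \o cut (fun xi => complex.Im (w xi)) j)) ->
  (\int[lebR3]_xi (Normc.normc (w xi) ^+ 2 * enorm xi ^+ 2)%:E = D%:E)%E ->
  (\int[lebR3]_x (\int[mu]_t (Normc.normc (prop k (fun xi => complex.Re (w xi)) (fun xi => complex.Im (w xi)) t x) ^+ 3)%:E) ^+ 2 <=
   (2 ^+ 14 * (64 * (144 * pi / k) ^+ 2 * (2 * pi) ^+ 6) * D ^+ 3)%:E)%E.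
Proof.
set wr := (fun xi => complex.Re (w xi)); set wi := (fun xi => complex.Im (w xi)).
move=> k0 mr mi ir ii DE; set s := - (pi / 2) : R.
pose K := 64 * (144 * pi / k) ^+ 2 * (2 * pi) ^+ 6 : R.
have K0 : 0 <= K by rewrite /K; apply: mulr_ge0; [apply: mulr_ge0 => //; exact: sqr_ge0|rewrite exprn_ge0// mulr_ge0// pi_ge0].
have Db (h : R3 -> R) : (forall xi, h xi ^+ 2 <= Normc.normc (w xi) ^+ 2) -> measurable_fun setT h ->
    (forall j, lebR3.-integrable setT (EFin \o cut h j)) -> forall c,
    (\int[lebR3]_x (\int[mu]_t (`|lamp k c h t x| ^+ 3)%:E) ^+ 2 <= (K * D ^+ 3)%:E)%E.
  move=> hw mh ih c; apply: (le_trans (lamp_bound c k0 mh ih)); rewrite (EFinM K).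
  apply: lee_wpmul2l; first by rewrite lee_fin.
  have L : (\int[lebR3]_xi (h xi ^+ 2 * enorm xi ^+ 2)%:E <= D%:E)%E.
    rewrite -DE; apply: ge0_le_integral_mono => xi; first by rewrite lee_fin mulr_ge0 ?sqr_ge0.
    by rewrite lee_fin ler_wpM2r ?sqr_ge0.
  have I0 : (0 <= \int[lebR3]_xi (h xi ^+ 2 * enorm xi ^+ 2)%:E)%E.
    by apply: integral_ge0 => q _; rewrite lee_fin mulr_ge0 ?sqr_ge0.
  by rewrite EFin_expe !expeS expe0 !mule1; apply: lee_pmul => //; [exact: mule_ge0|apply: lee_pmul].
have wrw xi : wr xi ^+ 2 <= Normc.normc (w xi) ^+ 2 by rewrite normc_sqr lerDl sqr_ge0.
have wiw xi : wi xi ^+ 2 <= Normc.normc (w xi) ^+ 2 by rewrite normc_sqr lerDr sqr_ge0.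
pose a1 := lamp k 0 wr; pose a2 := lamp k s wi; pose a3 := lamp k s wr; pose a4 := lamp k 0 wi.
have ma1 d (T : measurableType d) (p : T -> R) (q : T -> R3) : measurable_fun setT p -> measurable_fun setT q -> measurable_fun setT (fun s => a1 (p s) (q s)) := fun mp mq => measurable_lamp k 0 mr mp mq.
have ma2 d (T : measurableType d) (p : T -> R) (q : T -> R3) : measurable_fun setT p -> measurable_fun setT q -> measurable_fun setT (fun s => a2 (p s) (q s)) := fun mp mq => measurable_lamp k s mi mp mq.
have ma3 d (T : measurableType d) (p : T -> R) (q : T -> R3) : measurable_fun setT p -> measurable_fun setT q -> measurable_fun setT (fun s => a3 (p s) (q s)) := fun mp mq => measurable_lamp k s mr mp mq.
have ma4 d (T : measurableType d) (p : T -> R) (q : T -> R3) : measurable_fun setT p -> measurable_fun setT q -> measurable_fun setT (fun s => a4 (p s) (q s)) := fun mp mq => measurable_lamp k 0 mi mp mq.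
pose J (a : R -> R3 -> R) x : \bar R := (\int[mu]_t (`|a t x| ^+ 3)%:E)%E.
have J0 a x : (0 <= J a x)%E by apply: integral_ge0 => t _; rewrite lee_fin exprn_ge0.
have add4 (a b : R -> R3 -> R) (f : R -> R) x :
    (forall d (T : measurableType d) (p : T -> R) (q : T -> R3), measurable_fun setT p -> measurable_fun setT q -> measurable_fun setT (fun s => a (p s) (q s))) ->
    (forall d (T : measurableType d) (p : T -> R) (q : T -> R3), measurable_fun setT p -> measurable_fun setT q -> measurable_fun setT (fun s => b (p s) (q s))) ->
    (forall t, 0 <= f t <= `|a t x| + `|b t x|) ->
    (\int[mu]_t (f t ^+ 3)%:E <= 4%:E * (J a x + J b x))%E.
  move=> ma mb fab.
  have mat : measurable_fun setT (a ^~ x) by apply: ma; mtac.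
  have mbt : measurable_fun setT (b ^~ x) by apply: mb; mtac.
  rewrite /J -ge0_integralD; last 5 first.
  - exact: measurableT.
  - by move=> t _; rewrite lee_fin exprn_ge0.
  - by mtac.
  - by move=> t _; rewrite lee_fin exprn_ge0.
  - by mtac.
  rewrite -ge0_intZl; last 3 first.
  - by apply: emeasurable_funD; mtac.
  - by move=> t; rewrite adde_ge0// lee_fin exprn_ge0.
  - by [].
  apply: ge0_le_integral_mono => t; have /andP[f0 fle] := fab t; first by rewrite lee_fin exprn_ge0.
  rewrite -EFinD -EFinM lee_fin; apply: (@le_trans _ _ ((`|a t x| + `|b t x|) ^+ 3)).
    by rewrite lerXn2r ?nnegrE// addr_ge0.
  exact: cube_add_le.
pose p12 t x := `|a1 t x| + `|a2 t x|; pose p34 t x := `|a3 t x| + `|a4 t x|.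
have mp12 d (T : measurableType d) (p : T -> R) (q : T -> R3) : measurable_fun setT p -> measurable_fun setT q -> measurable_fun setT (fun s => p12 (p s) (q s)).
  by move=> mp mq; rewrite /p12; mtac; [exact: ma1|exact: ma2].
have mp34 d (T : measurableType d) (p : T -> R) (q : T -> R3) : measurable_fun setT p -> measurable_fun setT q -> measurable_fun setT (fun s => p34 (p s) (q s)).
  by move=> mp mq; rewrite /p34; mtac; [exact: ma3|exact: ma4].
have pp12 t x : 0 <= p12 t x by rewrite addr_ge0.
have pp34 t x : 0 <= p34 t x by rewrite addr_ge0.
have mJ2 (a : R -> R3 -> R) :
    (forall d (T : measurableType d) (p : T -> R) (q : T -> R3), measurable_fun setT p -> measurable_fun setT q -> measurable_fun setT (fun s => a (p s) (q s))) ->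
    measurable_fun setT (fun x => J a x ^+ 2)%E.
  move=> ma; apply: measurable_fun_expe; apply: (@measurable_fun_integral _ _ R _ _ mu (fun x t => (`|a t x| ^+ 3)%:E)).
  by mtac; apply: ma; mtac.
have J20 a x : (0 <= J a x ^+ 2)%E by apply: expe_ge0.
have sqe (y y1 y2 : \bar R) : (0 <= y)%E -> (0 <= y1)%E -> (0 <= y2)%E -> (y <= 4%:E * (y1 + y2))%E ->
    (y ^+ 2 <= 64%:E * (y1 ^+ 2 + y2 ^+ 2))%E.
  by move=> h0 h1 h2 h; apply: (sqe_add_le h0 h1 h2 h); [rewrite leeDl// expe_ge0|rewrite leeDr// expe_ge0].
pose S x : \bar R := ((J a1 x ^+ 2 + J a2 x ^+ 2) + (J a3 x ^+ 2 + J a4 x ^+ 2))%E.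
apply: (@le_trans _ _ (\int[lebR3]_x ((64 * 64)%:E * S x))%E).
  apply: ge0_le_integral_mono => x; first by apply: expe_ge0; apply: integral_ge0 => t _; rewrite lee_fin exprn_ge0// normc_ge0.
  have H12 : (J p12 x ^+ 2 <= 64%:E * (J a1 x ^+ 2 + J a2 x ^+ 2))%E.
    apply: sqe; [exact: J0|exact: J0|exact: J0|].
    by apply: (add4 a1 a2 (fun t => `|p12 t x|) x ma1 ma2) => t; rewrite normr_ge0 (ger0_norm (pp12 t x)) lexx.
  have H34 : (J p34 x ^+ 2 <= 64%:E * (J a3 x ^+ 2 + J a4 x ^+ 2))%E.
    apply: sqe; [exact: J0|exact: J0|exact: J0|].
    by apply: (add4 a3 a4 (fun t => `|p34 t x|) x ma3 ma4) => t; rewrite normr_ge0 (ger0_norm (pp34 t x)) lexx.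
  have H : ((\int[mu]_t (Normc.normc (prop k wr wi t x) ^+ 3)%:E) ^+ 2 <= 64%:E * (J p12 x ^+ 2 + J p34 x ^+ 2))%E.
    apply: sqe; [by apply: integral_ge0 => t _; rewrite lee_fin exprn_ge0// normc_ge0|exact: J0|exact: J0|].
    apply: (add4 p12 p34 (fun t => Normc.normc (prop k wr wi t x)) x mp12 mp34) => t.
    apply/andP; split; first exact: normc_ge0.
    apply: (@le_trans _ _ (p12 t x + p34 t x)); last by apply: lerD; exact: ler_norm.
    apply: (le_trans (normc_le_sum _)); apply: lerD; [exact: ler_normB|exact: ler_normD].
  apply: (le_trans H); apply: (@le_trans _ _ (64%:E * (64%:E * (J a1 x ^+ 2 + J a2 x ^+ 2) + 64%:E * (J a3 x ^+ 2 + J a4 x ^+ 2)))%E).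
    by apply: lee_wpmul2l; [by []|exact: (leeD H12 H34)].
  rewrite /S -(ge0_muleDr _ (adde_ge0 (J20 a1 x) (J20 a2 x)) (adde_ge0 (J20 a3 x) (J20 a4 x))) muleA -EFinM le_eqVlt; apply/orP; left; apply/eqP; by [].
have mS1 := emeasurable_funD (mJ2 _ ma1) (mJ2 _ ma2).
have mS2 := emeasurable_funD (mJ2 _ ma3) (mJ2 _ ma4).
rewrite ge0_intZl; last 3 first.
- exact: (emeasurable_funD mS1 mS2).
- by move=> x; rewrite !adde_ge0.
- by rewrite lee_fin mulr_ge0.
have B (f1 f2 : R3 -> \bar R) (b1 b2 : \bar R) : measurable_fun setT f1 -> measurable_fun setT f2 ->
    (forall x, 0 <= f1 x)%E -> (forall x, 0 <= f2 x)%E -> (\int[lebR3]_x f1 x <= b1)%E -> (\int[lebR3]_x f2 x <= b2)%E ->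
    (\int[lebR3]_x (f1 x + f2 x) <= b1 + b2)%E.
  by move=> mf1 mf2 f10 f20 h1 h2; rewrite ge0_integralD//; exact: leeD.
pose X := (K * D ^+ 3)%:E.
have B12 := B _ _ X X (mJ2 _ ma1) (mJ2 _ ma2) (J20 a1) (J20 a2) (Db wr wrw mr ir 0) (Db wi wiw mi ii s).
have B34 := B _ _ X X (mJ2 _ ma3) (mJ2 _ ma4) (J20 a3) (J20 a4) (Db wr wrw mr ir s) (Db wi wiw mi ii 0).
have BS := B _ _ _ _ mS1 mS2 (fun x => adde_ge0 (J20 a1 x) (J20 a2 x)) (fun x => adde_ge0 (J20 a3 x) (J20 a4 x)) B12 B34.
apply: (@le_trans _ _ ((64 * 64)%:E * ((X + X) + (X + X)))%E).
  by apply: lee_wpmul2l; [rewrite lee_fin mulr_ge0|exact: BS].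
rewrite /X -!EFinD -EFinM lee_fin -/K le_eqVlt; apply/orP; left; apply/eqP.
rewrite (_ : 2 ^+ 14 = 64 * 64 * 4 :> R); last by ring.
ring.
Qed.
End fourier_side.

(** Existence of a propagation is asserted beside the bound, so that the latter is not vacuous; the
    bound holds for every representative because any two of them have the same mixed norm. *)
Theorem mainTheorem6 (R : realType) :
  exists C : R, 0 < C /\
    forall (eps : R) (minus : bool) (g : (euclid3 R -> complex R) -> complex R),
      0 < eps -> Hdot1 g ->
      (exists u : R -> euclid3 R -> complex R, is_propagation minus eps g u) /\
      (forall u : R -> euclid3 R -> complex R, is_propagation minus eps g u ->
         (L6x_L3t_norm u <= (C * eps `^ 3^-1)%:E * Hdot1_norm g)%E).
Proof.
(* Constant of [prop_bound] with the factor k^-2 removed: k is the signed reciprocal of eps, so k^-2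
   = eps^2 is the whole dependence on eps. *)
pose C6 : R := 2 ^+ 14 * (64 * (144 * pi) ^+ 2 * (2 * pi) ^+ 6).
have pi0 := pi_gt0 R.
have C60 : 0 < C6 by rewrite /C6 !mulr_gt0 ?exprn_gt0 ?mulr_gt0.
exists (C6 `^ 6^-1); split; first exact: powR_gt0.
move=> eps minus g e0 [_ gG Hfin].
have gw : is_fourier g (hat g) by exact: (xgetPex (fun=> 0) gG).
set w := hat g in gw; have [mr mi ir ii] := is_fourier_local gw.
pose wr xi := complex.Re (w xi); pose wi xi := complex.Im (w xi).
pose k : R := (-1) ^+ minus / eps.
have k0 : k != 0 by rewrite /k mulf_neq0 ?signr_eq0 ?invr_neq0 ?lt0r_neq0.
set I := (\int[lebR3]_xi (Normc.normc (w xi) ^+ 2 * enorm xi ^+ 2)%:E)%E.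
have I0 : (0 <= I)%E by apply: integral_ge0 => xi _; rewrite lee_fin mulr_ge0 ?sqr_ge0.
have HE : Hdot1_norm g = (I `^ 2^-1)%E by [].
have Ifin : (I < +oo)%E by apply: (@lty_poweRy _ _ 2^-1) => //; rewrite -HE.
pose D := fine I; have DE : I = D%:E by rewrite fineK// ge0_fin_numE.
have D0 : 0 <= D by exact: fine_ge0.
have Dle (h : R * R * R -> R) : (forall xi, h xi ^+ 2 <= Normc.normc (w xi) ^+ 2) ->
    (\int[lebR3]_xi (h xi ^+ 2 * enorm xi ^+ 2)%:E < +oo)%E.
  move=> hw; apply: le_lt_trans Ifin; apply: ge0_le_integral_mono => xi; first by rewrite lee_fin mulr_ge0 ?sqr_ge0.
  by rewrite lee_fin ler_wpM2r ?sqr_ge0.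
have Dr : (\int[lebR3]_xi (wr xi ^+ 2 * enorm xi ^+ 2)%:E < +oo)%E by apply: Dle => xi; rewrite normc_sqr lerDl sqr_ge0.
have Di : (\int[lebR3]_xi (wi xi ^+ 2 * enorm xi ^+ 2)%:E < +oo)%E by apply: Dle => xi; rewrite normc_sqr lerDr sqr_ge0.
pose U := prop k wr wi.
have UP : is_propagation minus eps g U.
  split.
  - exact: measurable_prop_Re.
  - exact: measurable_prop_Im.
  (* The constructed [U] is an inverse Fourier transform for every t, so the exceptional set is
     empty. *)
  - exists set0; split => // t nt; exfalso; apply: nt => /=.
    rewrite (_ : (fun xi => _) = (fun xi => expi (t * (k * (xi.2 / enorm xi))) * Complex (wr xi) (wi xi))).
      exact: prop_inv_fourier.
    apply/funext => xi; rewrite /multiplier -/w /wr /wi; congr (expi _ * _); first by rewrite /k; ring.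
    by case: (w xi).
split; first by exists U.
move=> u [mru miu uinv].
have L6 : (\int[lebR3]_x (\int[lebesgue_measure]_t (Normc.normc (u t x) ^+ 3)%:E) ^+ 2 <= (C6 * eps ^+ 2 * D ^+ 3)%:E)%E.
  have [mrU miU Uinv] := UP.
  (* By uniqueness [u] may be replaced by the constructed [U], for which the bound is known. *)
  rewrite (mixed_norm_ae_eq mru miu mrU miU); last first.
    have [N1 [mN1 N10 s1]] := uinv; have [N2 [mN2 N20 s2]] := Uinv.
    exists (N1 `|` N2); split; [exact: measurableU|by rewrite measureU0|].
    move=> t /= nt; apply: contrapT => /not_orP[n1 n2]; apply: nt.
    have h1 : is_inv_fourier (fun xi => multiplier minus eps t xi * hat g xi) (u t) by apply: contrapT => H; apply: n1; apply: s1.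
    have h2 : is_inv_fourier (fun xi => multiplier minus eps t xi * hat g xi) (U t) by apply: contrapT => H; apply: n2; apply: s2.
    have sec (v : R -> R * R * R -> R) : measurable_fun setT (fun p : R * (R * R * R) => v p.1 p.2) -> measurable_fun setT (v t).
      by move=> mv; apply: (measurableT_comp mv (g := fun x => (t, x))); mtac.
    apply: (is_inv_fourier_unique _ _ _ _ h1 h2).
    - exact: (sec (fun t x => complex.Re (u t x))).
    - exact: (sec (fun t x => complex.Im (u t x))).
    - exact: (sec (fun t x => complex.Re (U t x))).
    - exact: (sec (fun t x => complex.Im (U t x))).
  apply: (le_trans (prop_bound k0 mr mi ir ii DE)).
  rewrite lee_fin le_eqVlt; apply/orP; left; apply/eqP; rewrite /C6 /k.
  have -> : (144 * pi / ((-1) ^+ minus / eps)) ^+ 2 = (144 * pi) ^+ 2 * eps ^+ 2.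
    by rewrite invfM invrK !exprMn exprVn sqrr_sign invr1 mul1r.
  ring.
have I6 : (0 <= \int[lebR3]_x (\int[lebesgue_measure]_t (Normc.normc (u t x) ^+ 3)%:E) ^+ 2)%E.
  by apply: integral_ge0 => x _; apply: expe_ge0; apply: integral_ge0 => t _; rewrite lee_fin exprn_ge0// normc_ge0.
rewrite HE DE poweR_EFin -EFinM.
(* Sixth root: eps^2 becomes eps^(1/3), and D^3 becomes D^(1/2), the homogeneous H^1 norm. *)
have -> : (C6 `^ 6^-1 * eps `^ 3^-1 * D `^ 2^-1 = (C6 * eps ^+ 2 * D ^+ 3) `^ 6^-1)%R.
  have e2 : 0 <= eps ^+ 2 by exact: sqr_ge0.
  rewrite (@powRM _ (C6 * eps ^+ 2) (D ^+ 3)); [|by apply: mulr_ge0 => //; exact: ltW|exact: exprn_ge0].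
  rewrite (@powRM _ C6 (eps ^+ 2)); [|exact: ltW|exact: e2].
  rewrite -(powR_mulrn 2 (ltW e0)) -(powR_mulrn 3 D0) -!powRrM.
  by congr (_ * _ `^ _ * _ `^ _); field.
rewrite -poweR_EFin; apply: gt0_ler_poweR => //.
- by rewrite in_itv; apply/andP; split; [exact: I6|exact: leey].
- by rewrite in_itv/= leey andbT lee_fin; apply: mulr_ge0; [apply: mulr_ge0; [exact: ltW|exact: sqr_ge0]|exact: exprn_ge0].
Qed.
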